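(* Let $G$ be a step $2$ Carnot group with stratified Lie algebra $\mathfrak g=V_1\oplus V_2$ and let $r=\dim V_1$. The abnormal set $\mathrm{Abn}_G$ is contained in an algebraic subvariety of $G$ of codimension three (or more) in each of the following cases: (i) $G$ has dimension $r+1$ or $r+2$; (ii) $G$ has dimension $\frac{r^2+r}{2}-1$ or $\frac{r^2+r}{2}-2$; (iii) $r=4$ and $G$ has dimension $7$.
   Context: A Carnot group of step $2$ is a connected, simply connected Lie group $G$ whose (finite-dimensional real) Lie algebra has a direct sum decomposition $\mathfrak g=V_1\oplus V_2$ with $V_2=[V_1,V_1]\neq\{0\}$ and $[V_2,V_1]=\{0\}$; ''dimension'' of $G$ is its topological dimension. Denote by $e$ the identity and by $L_g$ left translation by $g$. For $u\in L^2([0,1],V_1)$ let $\gamma_u:[0,1]\to G$ be the absolutely continuous curve with $\gamma_u(0)=e$ and $\dot\gamma_u(t)=(\mathrm dL_{\gamma_u(t)})_e\,u(t)$ for a.e. $t$. The endpoint map is $\mathrm{End}:L^2([0,1],V_1)\to G$, $\mathrm{End}(u)=\gamma_u(1)$. The curve $\gamma_u$ is called abnormal if the image of the differential $\mathrm d\,\mathrm{End}_u$ is a proper subspace of $T_{\gamma_u(1)}G$. The abnormal set is $\mathrm{Abn}_G=\{\gamma(1):\gamma \text{ abnormal},\ \gamma(0)=e\}$, i.e. the set of singular (critical) values of $\mathrm{End}$. The exponential map $\exp:\mathfrak g\to G$ is a diffeomorphism, through which $G$ is identified with the vector space $\mathfrak g$; algebraic subvarieties of $G$ are understood as (real affine)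 algebraic subvarieties in these coordinates. *)

(* Defs.v *)
From HB Require Import structures.
From mathcomp Require Import all_boot all_order all_algebra.
From mathcomp Require Import all_classical all_reals all_analysis.
From mathcomp Require mpoly.

Set Implicit Arguments.
Unset Strict Implicit.
Unset Printing Implicit Defensive.

Import Order.TTheory GRing.Theory Num.Theory.
Import numFieldNormedType.Exports.

Local Open Scope classical_set_scope.
Local Open Scope ring_scope.

(* A finite-dimensional real Lie algebra is given by a bracket on 'rV[R]_n, and
   the simply connected group is this vector space in exponential coordinates. *)

Record lie_bracket (R : realType) (n : nat)
    (br : 'rV[R]_n -> 'rV[R]_n -> 'rV[R]_n) : Prop := LieBracket {
  lie_linearl : forall a x y z, br (a *: x + y) z = a *: br x z + br y z ;
  lie_linearr : forall a x y z, br z (a *: x + y) = a *: br z x + br z y ;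
  lie_alternating : forall x, br x x = 0 ;
  lie_jacobi : forall x y z,
    br x (br y z) + br y (br z x) + br z (br x y) = 0 }.

(* [A, B], the span of all br a b with a \in A and b \in B; by bilinearity
   it is enough to let a and b range over bases. *)
Definition bracket_space (R : realType) (n : nat)
    (br : 'rV[R]_n -> 'rV[R]_n -> 'rV[R]_n) (A B : {vspace 'rV[R]_n}) :
    {vspace 'rV[R]_n} :=
  <<[seq br a b | a <- vbasis A, b <- vbasis B]>>%VS.

Record step2_stratification (R : realType) (n : nat)
    (br : 'rV[R]_n -> 'rV[R]_n -> 'rV[R]_n) (V1 V2 : {vspace 'rV[R]_n}) :
    Prop := Step2Stratification {
  strat_lie : lie_bracket br ;
  strat_sum : (V1 + V2 = fullv)%VS ;
  strat_direct : (V1 :&: V2 = 0)%VS ;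
  strat_generated : V2 = bracket_space br V1 V1 ;
  strat_nonabelian : V2 != 0%VS ;
  strat_step2 : bracket_space br V2 V1 = 0%VS }.

(* Baker-Campbell-Hausdorff product, which stops at the first bracket in
   step 2; the identity element is 0. *)
Definition carnot_mul (R : realType) (n : nat)
    (br : 'rV[R]_n -> 'rV[R]_n -> 'rV[R]_n) (g h : 'rV[R]_n) : 'rV[R]_n :=
  g + h + 2^-1 *: br g h.

Definition leb01 (R : realType) : {measure set (measurableTypeR R) -> \bar R} :=
  mrestr (@lebesgue_measure R) (measurable_itv `[0%R, 1%R]).

(* Representatives of the elements of L^2([0,1], V1). *)
Definition L2_control (R : realType) (n : nat) (V1 : {vspace 'rV[R]_n})
    (u : R -> 'rV[R]_n) : Prop :=
  (forall t : R, 0 <= t <= 1 -> u t \in V1) /\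
  (forall i, (fun t => u t 0 i) \in Lfun (@leb01 R) 2%:E).

(* `|u t| is the sup norm of 'rV[R]_n; another norm on V1 gives an equivalent
   norm on L^2([0,1], V1), hence the same differentials. *)
Definition L2_norm (R : realType) (n : nat) (u : R -> 'rV[R]_n) : R :=
  fine ('N[@leb01 R]_2%:E[(fun t => `|u t|%R%:E)])%E.

Definition abs_continuous01 (R : realType) (n : nat) (f : R -> 'rV[R]_n) :
    Prop :=
  forall eps : R, 0 < eps -> exists2 delta : R, 0 < delta &
    forall (k : nat) (a b : 'I_k -> R),
      (forall i, 0 <= a i /\ a i <= b i /\ b i <= 1) ->
      (forall i j, i != j -> b i <= a j \/ b j <= a i) ->
      \sum_(i < k) (b i - a i) < delta ->
      \sum_(i < k) `|f (b i) - f (a i)| < eps.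

(* gamma is the curve gamma_u; only its restriction to [0,1] matters, since
   derivatives are taken at almost every t. *)
Definition curve_of_control (R : realType) (n : nat)
    (br : 'rV[R]_n -> 'rV[R]_n -> 'rV[R]_n)
    (u gamma : R -> 'rV[R]_n) : Prop :=
  [/\ abs_continuous01 gamma, gamma 0 = 0 &
    {ae (@lebesgue_measure R), forall t : R, 0 <= t <= 1 ->
       is_derive t 1 gamma ('d (carnot_mul br (gamma t)) 0 (u t))}].

(* gamma_u is unique on [0,1], so that the choice made by get is immaterial. *)
Definition endpoint (R : realType) (n : nat)
    (br : 'rV[R]_n -> 'rV[R]_n -> 'rV[R]_n) (u : R -> 'rV[R]_n) : 'rV[R]_n :=
  get [set g | exists2 gamma, curve_of_control br u gamma & gamma 1 = g].

(* D is the Frechet differential at u of a map E on L^2([0,1], V1): a bounded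
   linear map with E (u + h) = E u + D h + o(L2_norm h).  E and D act on
   representatives. *)
Definition L2_differential (R : realType) (n : nat) (V1 : {vspace 'rV[R]_n})
    (E : (R -> 'rV[R]_n) -> 'rV[R]_n) (u : R -> 'rV[R]_n)
    (D : (R -> 'rV[R]_n) -> 'rV[R]_n) : Prop :=
  [/\ forall (a : R) (v w : R -> 'rV[R]_n),
        L2_control V1 v -> L2_control V1 w ->
        D (fun t => a *: v t + w t) = a *: D v + D w,
      exists C : R, forall v, L2_control V1 v -> `|D v| <= C * L2_norm v &
      forall eps : R, 0 < eps -> exists2 delta : R, 0 < delta &
        forall h, L2_control V1 h -> L2_norm h < delta ->
        `|E (fun t => u t + h t) - E u - D h| <= eps * L2_norm h].

(* The tangent space at the endpoint is the whole of 'rV[R]_n. *)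
Definition abnormal (R : realType) (n : nat)
    (br : 'rV[R]_n -> 'rV[R]_n -> 'rV[R]_n) (V1 : {vspace 'rV[R]_n})
    (u : R -> 'rV[R]_n) : Prop :=
  exists2 D, L2_differential V1 (endpoint br) u D &
    D @` [set v | L2_control V1 v] `<` setT.

Definition abnormal_set (R : realType) (n : nat)
    (br : 'rV[R]_n -> 'rV[R]_n -> 'rV[R]_n) (V1 : {vspace 'rV[R]_n}) :
    set 'rV[R]_n :=
  endpoint br @` [set u | L2_control V1 u /\ abnormal br V1 u].

Definition algebraic_set (R : realType) (n : nat) (Z : set 'rV[R]_n) : Prop :=
  exists I : set (mpoly.mpoly n R),
    Z = [set x | forall p, I p -> mpoly.meval (fun i => x 0 i) p = 0].

Definition irreducible_algebraic_set (R : realType) (n : nat)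
    (Z : set 'rV[R]_n) : Prop :=
  [/\ algebraic_set Z, Z !=set0 &
    forall A B, algebraic_set A -> algebraic_set B ->
      Z `<=` A `|` B -> Z `<=` A \/ Z `<=` B].

(* Codimension at least c in R^n, for the Krull dimension of the Zariski
   topology: a chain C_0 < ... < C_k of irreducible algebraic subsets of Z has
   length k <= n - c. *)
Definition codim_ge (R : realType) (n : nat) (c : nat) (Z : set 'rV[R]_n) :
    Prop :=
  forall (k : nat) (C : nat -> set 'rV[R]_n),
    (forall i, (i <= k)%N -> irreducible_algebraic_set (C i) /\ C i `<=` Z) ->
    (forall i, (i < k)%N -> C i `<` C i.+1) ->
    (k + c <= n)%N.

(* Main.v *)
Require Import Defs.
From HB Require Import structures.
From mathcomp Require Import all_boot all_order all_algebra.
From mathcomp Require Import all_classical all_reals all_analysis.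
From mathcomp Require Import ring lra zify.
From mathcomp Require mpoly.

(* Testing the differential of the endpoint map on steps 1_[0,b] v shows that a
   covector vanishing on its image is a nonzero la on V2 such that the horizontal
   part of the curve stays in K_la, the kernel of the skew form
   omega_la = la [. , .] on V1.  Hence the abnormal set lies in the union over
   la <> 0 of K_la + [K_la, K_la].

   This union is covered by finitely many images of rational maps, and dimensions
   are bounded by Hilbert functions: polynomials of degree at most N restrict to a
   space of dimension O(N^m).  A chain of length k of irreducible algebraic sets
   yields about N^k independent functions on the largest one, so k <= m, which
   also bounds the dimension of the Zariski closure.

   K_la + [K_la, K_la] has dimension at most q + q (q - 1) / 2 for
   q = dim K_la, and [K_la, K_la] lies in the kernel of la.  With a center of
   dimension at most three one counts the parameters la up to scaling, separating
   omega_la of rank two by the vanishing of the 4 x 4 Pfaffians.  In case (ii) the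
   center is all of the second exterior power up to codimension d = 1, 2.  If
   omega_la has rank at least three, K_la lies in the kernel of three independent
   covectors.  Otherwise omega_la is a multiple of a /\ b, where the plane (a, b)
   is killed by the d-dimensional annihilator of the forms omega_la, and such
   planes have codimension d in the Grassmannian; for d = 2 this rests on a
   discussion of pencils of skew forms. *)

(** Images of polynomial maps are in general not algebraic, so dimension is bounded for arbitrary
    sets: [dimle] passes to subsets, finite unions and rational images, strata may be described by
    the mere existence of parameters, and Krull dimension enters only at the end.

    The counts leave no slack, since each case ends exactly at n - 3. In case (ii) the planes give 2
    (r - 2) - d parameters; adding (r - 2) + 'C(r - 2, 2) for the kernel and its brackets yields n -
    3, whereas rank at least three leaves codimension 6 - d. Hence no dimension may be lost in
    counting the planes, which is why pencils have to be stratified.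

    As [endpoint] is defined through [get], computing it requires uniqueness of the curve, which
    rests on the constancy of absolutely continuous functions whose derivative vanishes almost
    everywhere. *)

Set Implicit Arguments.
Unset Strict Implicit.
Unset Printing Implicit Defensive.

Import Order.TTheory GRing.Theory Num.Theory.
Import numFieldNormedType.Exports.

Local Open Scope classical_set_scope.
Local Open Scope ring_scope.

(** * Polynomial functions on coordinate spaces *)

(* Points with finitely many coordinate functions, so that products of spaces of
   matrices carry polynomials without being flattened to K^n. *)
Record cspace (K : fieldType) := CSpace {
  pts :> Type;
  cidx : finType;
  ccoord : cidx -> pts -> K }.

Section Polynomials.
Variable K : fieldType.
Implicit Types X Y : cspace K.

Definition point_space := @CSpace K unit void (fun i _ => match i with end).
Definition line_space := @CSpace K K unit (fun _ x => x).
Definition mx_space m n :=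
  @CSpace K 'M[K]_(m, n) ('I_m * 'I_n)%type (fun ij (A : 'M[K]_(m, n)) => A ij.1 ij.2).
Definition prod_space X Y := @CSpace K (X * Y)%type (cidx X + cidx Y)%type
  (fun i p => match i with inl j => ccoord j p.1 | inr j => ccoord j p.2 end).

(** A predicate on functions, not on expressions, so that substitution is plain composition. N is
    only an upper bound for the degree. *)
Inductive poldeg X : nat -> (X -> K) -> Prop :=
| poldeg_cst N c : poldeg N (fun=> c)
| poldeg_coord N i : poldeg N.+1 (fun x => ccoord i x)
| poldeg_add N f g : poldeg N f -> poldeg N g -> poldeg N (fun x => f x + g x)
| poldeg_mul M N f g :
    poldeg M f -> poldeg N g -> poldeg (M + N) (fun x => f x * g x).

Definition ispol X (f : X -> K) := exists N, poldeg N f.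

Lemma poldeg_ext X N (f g : X -> K) : f =1 g -> poldeg N f -> poldeg N g.
Proof. by move=> /funext ->. Qed.

Lemma poldeg_leq X M N (f : X -> K) : (M <= N)%N -> poldeg M f -> poldeg N f.
Proof.
move=> leMN fM; rewrite -(subnK leMN).
apply: (@poldeg_ext _ _ (fun x => 1 * f x)) => [x|]; first by rewrite mul1r.
exact: poldeg_mul (poldeg_cst _ _ _) fM.
Qed.

Lemma poldeg_sum X N (I : Type) (r : seq I) (P : pred I) (F : I -> X -> K) :
  (forall i, P i -> poldeg N (F i)) ->
  poldeg N (fun x => \sum_(i <- r | P i) F i x).
Proof.
move=> FN; elim: r => [|i r IH].
  by apply: (@poldeg_ext _ _ (fun=> 0)) => [x|]; [rewrite big_nil|exact: poldeg_cst].
case Pi : (P i); last first.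
  by apply: poldeg_ext IH => x; rewrite big_cons Pi.
apply: (@poldeg_ext _ _ (fun x => F i x + \sum_(j <- r | P j) F j x)) => [x|].
  by rewrite big_cons Pi.
by apply: poldeg_add => //; apply: FN.
Qed.

Lemma poldeg_exp X N (f : X -> K) k : poldeg N f -> poldeg (k * N) (fun x => f x ^+ k).
Proof.
move=> fN; elim: k => [|k IH].
  by apply: (@poldeg_ext _ _ (fun=> 1)) => [x|]; [rewrite expr0|exact: poldeg_cst].
apply: (@poldeg_ext _ _ (fun x => f x * f x ^+ k)) => [x|]; first by rewrite exprS.
by rewrite mulSn; exact: poldeg_mul.
Qed.

Lemma ispol_ext X (f g : X -> K) : f =1 g -> ispol f -> ispol g.
Proof. by move=> /funext ->. Qed.

Lemma ispol_cst X c : ispol (fun _ : X => c).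
Proof. by exists 0%N; exact: poldeg_cst. Qed.

Lemma ispol_coord X i : ispol (fun x : X => ccoord i x).
Proof. by exists 1%N; exact: poldeg_coord. Qed.

Lemma ispolD X (f g : X -> K) : ispol f -> ispol g -> ispol (fun x => f x + g x).
Proof.
move=> [M fM] [N gN]; exists (maxn M N).
by apply: poldeg_add; [apply: poldeg_leq fM|apply: poldeg_leq gN];
  rewrite ?leq_maxl ?leq_maxr.
Qed.

Lemma ispolM X (f g : X -> K) : ispol f -> ispol g -> ispol (fun x => f x * g x).
Proof. by move=> [M fM] [N gN]; exists (M + N)%N; exact: poldeg_mul. Qed.

Lemma ispolN X (f : X -> K) : ispol f -> ispol (fun x => - f x).
Proof.
move=> fP; apply: (@ispol_ext _ (fun x => -1 * f x)) => [x|]; first by rewrite mulN1r.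
exact: ispolM (ispol_cst _ _) fP.
Qed.

Lemma ispolX X (f : X -> K) k : ispol f -> ispol (fun x => f x ^+ k).
Proof. by move=> [N fN]; exists (k * N)%N; exact: poldeg_exp. Qed.

Lemma ispol_sum X (I : Type) (r : seq I) (P : pred I) (F : I -> X -> K) :
  (forall i, P i -> ispol (F i)) -> ispol (fun x => \sum_(i <- r | P i) F i x).
Proof.
move=> FN; elim: r => [|i r IH].
  by apply: (@ispol_ext _ (fun=> 0)) => [x|]; [rewrite big_nil|exact: ispol_cst].
case Pi : (P i); last first.
  by apply: ispol_ext IH => x; rewrite big_cons Pi.
apply: (@ispol_ext _ (fun x => F i x + \sum_(j <- r | P j) F j x)) => [x|].
  by rewrite big_cons Pi.
by apply: ispolD => //; apply: FN.
Qed.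

Lemma ispol_prod X (I : Type) (r : seq I) (P : pred I) (F : I -> X -> K) :
  (forall i, P i -> ispol (F i)) -> ispol (fun x => \prod_(i <- r | P i) F i x).
Proof.
move=> FN; elim: r => [|i r IH].
  by apply: (@ispol_ext _ (fun=> 1)) => [x|]; [rewrite big_nil|exact: ispol_cst].
case Pi : (P i); last first.
  by apply: ispol_ext IH => x; rewrite big_cons Pi.
apply: (@ispol_ext _ (fun x => F i x * \prod_(j <- r | P j) F j x)) => [x|].
  by rewrite big_cons Pi.
by apply: ispolM => //; apply: FN.
Qed.

Lemma ispol_comp X Y (h : Y -> X) (f : X -> K) :
  (forall i, ispol (fun y => ccoord i (h y))) -> ispol f -> ispol (fun y => f (h y)).
Proof.
move=> hP [N]; elim=> {N f} [N c|N i|N f g _ fP _ gP|M N f g _ fP _ gP].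
- exact: ispol_cst.
- exact: hP.
- exact: ispolD.
- exact: ispolM.
Qed.

Lemma ispol_fst X Y (f : X -> K) : ispol f -> ispol (fun p : prod_space X Y => f p.1).
Proof.
by apply: (@ispol_comp X (prod_space X Y)) => i; exact: (@ispol_coord (prod_space X Y) (inl i)).
Qed.

Lemma ispol_snd X Y (f : Y -> K) : ispol f -> ispol (fun p : prod_space X Y => f p.2).
Proof.
by apply: (@ispol_comp Y (prod_space X Y)) => i; exact: (@ispol_coord (prod_space X Y) (inr i)).
Qed.

Lemma ispol_entry m n i j : ispol (fun A : mx_space m n => A i j).
Proof. exact: (@ispol_coord (mx_space m n) (i, j)). Qed.

Definition ispolmx X m n (F : X -> 'M[K]_(m, n)) := forall i j, ispol (fun x => F x i j).

Lemma ispolmx_cst X m n (A : 'M[K]_(m, n)) : ispolmx (fun _ : X => A).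
Proof. by move=> i j; exact: ispol_cst. Qed.

Lemma ispolmx_id m n : ispolmx (fun A : mx_space m n => A).
Proof. by move=> i j; exact: ispol_entry. Qed.

Lemma ispolmx_fst X Y m n (F : X -> 'M[K]_(m, n)) :
  ispolmx F -> ispolmx (fun p : prod_space X Y => F p.1).
Proof. by move=> FP i j; apply: (@ispol_fst _ _ (fun x => F x i j)); exact: FP. Qed.

Lemma ispolmx_snd X Y m n (F : Y -> 'M[K]_(m, n)) :
  ispolmx F -> ispolmx (fun p : prod_space X Y => F p.2).
Proof. by move=> FP i j; apply: (@ispol_snd _ _ (fun x => F x i j)); exact: FP. Qed.

Lemma ispolmxD X m n (F G : X -> 'M[K]_(m, n)) :
  ispolmx F -> ispolmx G -> ispolmx (fun x => F x + G x).
Proof.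
move=> FP GP i j; apply: (@ispol_ext _ (fun x => F x i j + G x i j)) => [x|].
  by rewrite mxE.
exact: ispolD.
Qed.

Lemma ispolmxN X m n (F : X -> 'M[K]_(m, n)) :
  ispolmx F -> ispolmx (fun x => - F x).
Proof.
move=> FP i j; apply: (@ispol_ext _ (fun x => - F x i j)) => [x|].
  by rewrite mxE.
exact: ispolN.
Qed.

Lemma ispolmxB X m n (F G : X -> 'M[K]_(m, n)) :
  ispolmx F -> ispolmx G -> ispolmx (fun x => F x - G x).
Proof. by move=> FP GP; apply: ispolmxD => //; exact: ispolmxN. Qed.

Lemma ispolmxZ X m n (f : X -> K) (F : X -> 'M[K]_(m, n)) :
  ispol f -> ispolmx F -> ispolmx (fun x => f x *: F x).
Proof.
move=> fP FP i j; apply: (@ispol_ext _ (fun x => f x * F x i j)) => [x|].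
  by rewrite mxE.
exact: ispolM.
Qed.

Lemma ispolmxM X m n p (F : X -> 'M[K]_(m, n)) (G : X -> 'M[K]_(n, p)) :
  ispolmx F -> ispolmx G -> ispolmx (fun x => F x *m G x).
Proof.
move=> FP GP i j.
apply: (@ispol_ext _ (fun x => \sum_k F x i k * G x k j)) => [x|].
  by rewrite mxE.
by apply: ispol_sum => k _; exact: ispolM.
Qed.

Lemma ispolmx_sum X m n (I : Type) (r : seq I) (P : pred I)
    (F : I -> X -> 'M[K]_(m, n)) :
  (forall i, P i -> ispolmx (F i)) -> ispolmx (fun x => \sum_(i <- r | P i) F i x).
Proof.
move=> FP i j; apply: (@ispol_ext _ (fun x => \sum_(k <- r | P k) F k x i j)) => [x|].
  by rewrite summxE.
by apply: ispol_sum => k Pk; exact: FP.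
Qed.

Lemma ispolmx_tr X m n (F : X -> 'M[K]_(m, n)) : ispolmx F -> ispolmx (fun x => (F x)^T).
Proof.
by move=> FP i j; apply: ispol_ext (FP j i) => x; rewrite mxE.
Qed.

Lemma ispolmx_sub X m n m' n' (f : 'I_m' -> 'I_m) (g : 'I_n' -> 'I_n)
    (F : X -> 'M[K]_(m, n)) : ispolmx F -> ispolmx (fun x => mxsub f g (F x)).
Proof.
by move=> FP i j; apply: ispol_ext (FP (f i) (g j)) => x; rewrite mxE.
Qed.

Lemma ispol_det X n (F : X -> 'M[K]_n) : ispolmx F -> ispol (fun x => \det (F x)).
Proof.
move=> FP; apply: ispol_sum => s _; apply: ispolM; first exact: ispol_cst.
by apply: ispol_prod => i _; exact: FP.
Qed.

Lemma ispolmx_adj X n (F : X -> 'M[K]_n) : ispolmx F -> ispolmx (fun x => \adj (F x)).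
Proof.
move=> FP i j.
apply: (@ispol_ext _ (fun x => cofactor (F x) j i)) => [x|]; first by rewrite mxE.
apply: ispolM; first exact: ispol_cst.
apply: ispol_det => a b.
by apply: ispol_ext (FP (lift j a) (lift i b)) => x; rewrite !mxE.
Qed.

Lemma ispolmx_row X m n1 n2 (F : X -> 'M[K]_(m, n1)) (G : X -> 'M[K]_(m, n2)) :
  ispolmx F -> ispolmx G -> ispolmx (fun x => row_mx (F x) (G x)).
Proof.
move=> FP GP i j; case: (split_ordP j) => k ->.
  by apply: ispol_ext (FP i k) => x; rewrite row_mxEl.
by apply: ispol_ext (GP i k) => x; rewrite row_mxEr.
Qed.

End Polynomials.

(** * Dimension through Hilbert functions *)

Section Dimension.
Variable K : fieldType.
Implicit Types X Y : cspace K.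

(* dimle S m bounds the Hilbert function of S: the polynomials of degree at
   most N restrict to a space of functions on S of dimension O(N^m). *)
Definition dimle X (S : set X) (m : nat) := exists C : nat, forall N,
  exists (I : finType) (e : I -> X -> K), (#|I| <= C * N.+1 ^ m)%N /\
    forall f, poldeg N f ->
      exists c : I -> K, forall x, S x -> f x = \sum_i c i * e i x.

Lemma dimle_sub X (S T : set X) m : S `<=` T -> dimle T m -> dimle S m.
Proof.
move=> ST [C HC]; exists C => N; have [I [e [cI He]]] := HC N.
by exists I, e; split => // f /He [c fc]; exists c => x /ST /fc.
Qed.

Lemma dimle_leq X (S : set X) m n : (m <= n)%N -> dimle S m -> dimle S n.
Proof.
move=> mn [C HC]; exists C => N; have [I [e [cI He]]] := HC N.
exists I, e; split => //; apply: (leq_trans cI).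
by rewrite leq_mul2l leq_pexp2l ?orbT.
Qed.

Lemma dimle_set0 X m : dimle (set0 : set X) m.
Proof.
exists 0%N => N; exists void, (fun (i : void) (_ : X) => match i with end).
by split; [rewrite card_void|move=> f _; exists (fun=> 0)].
Qed.

(** The spanning functions need not be polynomial, so each of the two families can be cut off by the
    indicator of S. *)
Lemma dimleU X (S T : set X) m : dimle S m -> dimle T m -> dimle (S `|` T) m.
Proof.
move=> [C HC] [D HD]; exists (C + D)%N => N.
have [I [e [cI He]]] := HC N; have [J [g [cJ Hg]]] := HD N.
exists (I + J)%type, (fun k x => match k with
  | inl i => if `[< S x >] then e i x else 0
  | inr j => if `[< S x >] then 0 else g j x end).
split; first by rewrite card_sum mulnDl leq_add.
move=> f fN; have [c fc] := He f fN; have [d fd] := Hg f fN.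
exists (fun k => match k with inl i => c i | inr j => d j end) => x STx.
rewrite big_sumType /=; case: asboolP => Sx.
  by rewrite [X in _ + X]big1 ?addr0 ?fc// => j _; rewrite mulr0.
by rewrite big1 ?add0r => [|j _]; rewrite ?mulr0// fd//; case: STx.
Qed.

Lemma dimle_bigcup X (I : finType) (F : I -> set X) m :
  (forall i, dimle (F i) m) -> dimle (\bigcup_i F i) m.
Proof.
move=> FP; suff HS (s : seq I) : dimle (fun x => exists2 i, i \in s & F i x) m.
  by apply: dimle_sub (HS (enum I)) => x [i _ Fx]; exists i; rewrite ?mem_enum.
elim: s => [|i s IH]; first by apply: dimle_sub (dimle_set0 _ m) => x [].
apply: dimle_sub (dimleU (FP i) IH) => x [j]; rewrite inE => /orP[/eqP ->|js] Fx.
  by left.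
by right; exists j.
Qed.

(* Clears denominators: y parametrises the point x with coordinates F i y / g y. *)
Lemma poldeg_fraction X Y D (g : Y -> K) (F : cidx X -> Y -> K) N (f : X -> K) :
  poldeg D g -> (forall i, poldeg D (F i)) -> poldeg N f ->
  exists2 h, poldeg (N * D) h & forall x y,
    (forall i, g y * ccoord i x = F i y) -> g y ^+ N * f x = h y.
Proof.
move=> gD FD; elim=> {N f} [N c|N i|N f1 f2 _ [h1 h1P E1] _ [h2 h2P E2]
  |M N f1 f2 _ [h1 h1P E1] _ [h2 h2P E2]].
- exists (fun y => g y ^+ N * c) => //; rewrite -[X in poldeg X](addn0).
  by apply: poldeg_mul; [exact: poldeg_exp|exact: poldeg_cst].
- exists (fun y => g y ^+ N * F i y) => [|x y E]; last by rewrite exprSr -mulrA E.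
  by rewrite mulSn addnC; apply: poldeg_mul => //; exact: poldeg_exp.
- exists (fun y => h1 y + h2 y) => [|x y E]; first exact: poldeg_add.
  by rewrite mulrDr (E1 _ _ E) (E2 _ _ E).
- exists (fun y => h1 y * h2 y) => [|x y E].
    by rewrite mulnDl; exact: poldeg_mul.
  by rewrite exprD mulrACA (E1 _ _ E) (E2 _ _ E).
Qed.

Lemma ispol_uniform Y (I : finType) (F : I -> Y -> K) :
  (forall i, ispol (F i)) -> exists D, forall i, poldeg D (F i).
Proof.
move=> FP; have [N FN] := choice (FP : forall i, exists N, poldeg N (F i)).
exists (\max_i N i)%N => i.
exact: poldeg_leq (leq_bigmax i) (FN i).
Qed.

(** After a choice s of one parameter for each point of S, a polynomial of degree N on S is g^-N
    times a polynomial of degree N D at s x. The factor g^-N is common to all of them, and passing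
    from N to N D costs only the constant (D + 1)^m. *)
Lemma dimle_rational_image X Y (T : set Y) (S : set X) (g : Y -> K)
    (F : cidx X -> Y -> K) m :
  ispol g -> (forall i, ispol (F i)) -> dimle T m ->
  (forall x, S x -> exists2 y, T y & g y != 0 /\ forall i, g y * ccoord i x = F i y) ->
  dimle S m.
Proof.
move=> [D1 gD1] /ispol_uniform[D2 FD2] [C HC] ST.
(* y0 serves as the value of the choice function outside S. *)
have [->|/set0P[x0 /ST[y0 _ _]]] := eqVneq S set0; first exact: dimle_set0.
pose D := maxn D1 D2.
have gD : poldeg D g by apply: poldeg_leq gD1; rewrite leq_maxl.
have FD i : poldeg D (F i) by apply: poldeg_leq (FD2 i); rewrite leq_maxr.
have [s sP] : {s : X -> Y & forall x, S x ->
    T (s x) /\ (g (s x) != 0 /\ forall i, g (s x) * ccoord i x = F i (s x))}.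
  apply: (@choice _ _ (fun x y => S x -> T y /\ (g y != 0 /\ forall i, g y * ccoord i x = F i y))) => x.
  by have [/ST[y Ty gy]|nSx] := pselect (S x); [exists y|exists y0].
exists (C * D.+1 ^ m)%N => N; have [I [e [cI He]]] := HC (N * D)%N.
exists I, (fun i x => (g (s x) ^+ N)^-1 * e i (s x)); split.
  apply: (leq_trans cI); rewrite -mulnA -expnMn leq_mul2l; apply/orP; right.
  have [->|m0] := posnP m; first by rewrite !expn0.
  by rewrite leq_exp2r// mulnC mulSn; nia.
move=> f /(poldeg_fraction gD FD)[h /He[c hc] E]; exists c => x /sP[Tsx [gx /E]].
move=> /(congr1 (fun z => (g (s x) ^+ N)^-1 * z)).
rewrite mulKf ?expf_neq0// => ->; rewrite hc// mulr_sumr.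
by apply: eq_bigr => i _; rewrite mulrCA.
Qed.

Lemma dimle_image X Y (T : set Y) (S : set X) (F : Y -> X) m :
  (forall i, ispol (fun y => ccoord i (F y))) -> dimle T m ->
  (forall x, S x -> exists2 y, T y & x = F y) -> dimle S m.
Proof.
move=> FP Tm ST.
apply: (dimle_rational_image (ispol_cst Y 1) FP Tm) => x /ST[y Ty ->].
by exists y => //; split=> [|i]; rewrite ?oner_neq0 ?mul1r.
Qed.

Lemma dimle_point X (x : X) m : dimle [set x] m.
Proof.
exists 1%N => N; exists unit, (fun _ _ => 1); split.
  by rewrite card_unit mul1n expn_gt0.
by move=> f _; exists (fun=> f x) => _ ->; rewrite big_const card_unit /= mulr1 addr0.
Qed.

Lemma poldeg_prod_line X N (f : prod_space X (line_space K) -> K) :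
  poldeg N f -> exists P : X -> {poly K},
    [/\ forall x, (size (P x) <= N.+1)%N, forall j, poldeg N (fun x => (P x)`_j) &
      forall x s, f (x, s) = (P x).[s]].
Proof.
elim=> {N f} [N c|N [i|i]|N f g _ [P [P1 P2 P3]] _ [Q [Q1 Q2 Q3]]
  |M N f g _ [P [P1 P2 P3]] _ [Q [Q1 Q2 Q3]]].
- exists (fun=> c%:P); split=> [x|j|x s]; last by rewrite hornerC.
    by apply: (leq_trans (size_polyC_leq1 _)).
  exact: poldeg_cst.
- exists (fun x => (ccoord i x)%:P); split=> [x|j|x s]; last by rewrite hornerC.
    by apply: (leq_trans (size_polyC_leq1 _)).
  case: j => [|j]; last first.
    by apply: (@poldeg_ext _ _ _ (fun=> 0)) => [x|]; [rewrite coefC|exact: poldeg_cst].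
  by apply: poldeg_ext (poldeg_coord N i) => x; rewrite coefC.
- exists (fun=> 'X); split=> [x|j|x s]; last by rewrite hornerX.
    by rewrite size_polyX.
  exact: poldeg_cst.
- exists (fun x => P x + Q x); split=> [x|j|x s]; last by rewrite hornerD P3 Q3.
    by rewrite (leq_trans (size_polyD _ _))// geq_max P1 Q1.
  apply: (@poldeg_ext _ _ _ (fun x => (P x)`_j + (Q x)`_j)) => [x|].
    by rewrite coefD.
  exact: poldeg_add.
- exists (fun x => P x * Q x); split=> [x|j|x s]; last by rewrite hornerM P3 Q3.
    rewrite (leq_trans (size_polyMleq _ _))//; move: (P1 x) (Q1 x); lia.
  apply: (@poldeg_ext _ _ _ (fun x => \sum_(i < j.+1) (P x)`_i * (Q x)`_(j - i))).
    by move=> x; rewrite coefM.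
  by apply: poldeg_sum => i _; exact: poldeg_mul.
Qed.

(** Expansion along the line gives N + 1 powers of the new variable, each with a coefficient from
    the space of dimension O(N^m) on T. *)
Lemma dimle_prod_line X (T : set X) m :
  dimle T m -> dimle ([set p | T p.1] : set (prod_space X (line_space K))) m.+1.
Proof.
move=> [C HC]; exists C => N; have [I [e [cI He]]] := HC N.
exists (I * 'I_N.+1)%type, (fun (ij : I * 'I_N.+1) (p : X * K) => e ij.1 p.1 * p.2 ^+ ij.2); split.
  by rewrite card_prod card_ord expnSr mulnA leq_mul2r cI orbT.
move=> f /poldeg_prod_line[P [P1 P2 P3]].
have [c cP] := choice (fun j => He _ (P2 j)).
exists (fun ij : I * 'I_N.+1 => c ij.2 ij.1) => -[x s] /= Tx.
rewrite P3 (horner_coef_wide _ (P1 x)).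
transitivity (\sum_(j < N.+1) \sum_i c j i * (e i x * s ^+ j)).
  by apply: eq_bigr => j _; rewrite cP// mulr_suml; apply: eq_bigr => i _; rewrite mulrA.
by rewrite exchange_big /= pair_big.
Qed.

Lemma dimle_prod_rV X (T : set X) m n : dimle T m ->
  dimle ([set p | T p.1] : set (prod_space X (mx_space K 1 n))) (m + n).
Proof.
move=> Tm; elim: n => [|n IH].
  rewrite addn0; apply: (dimle_image (F := fun x => (x, 0) : prod_space X (mx_space K 1 0))) Tm _.
    by case=> [i|[_ []]//]; exact: ispol_coord.
  by move=> [x v] Tx; exists x => //; rewrite [v]thinmx0.
rewrite addnS; apply: (dimle_image (F := fun p : prod_space (prod_space X (mx_space K 1 n)) (line_space K) =>
   (p.1.1, \row_j (if unlift ord0 j is Some k then p.1.2 0 k else p.2))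
   : prod_space X (mx_space K 1 n.+1))) (dimle_prod_line IH) _.
  case=> [i|[i j]] /=.
    by apply: (@ispol_fst _ _ _ (fun p : prod_space X (mx_space K 1 n) => ccoord i p.1)); apply: ispol_fst; exact: ispol_coord.
  case: (unliftP ord0 j) => [k ->|->].
    apply: (@ispol_ext _ _ (fun p : prod_space (prod_space X (mx_space K 1 n)) (line_space K) => p.1.2 0 k)) => [p|].
      by rewrite mxE liftK.
    apply: (@ispol_fst _ _ _ (fun p : prod_space X (mx_space K 1 n) => p.2 0 k)).
    apply: (@ispol_snd _ _ _ (fun v : mx_space K 1 n => v 0 k)); exact: ispol_entry.
  apply: ispol_ext (@ispol_coord _ (prod_space (prod_space X (mx_space K 1 n)) (line_space K)) (inr tt)) => p.
  by rewrite mxE unlift_none.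
move=> [x v] Tx; exists ((x, \row_k v 0 (lift ord0 k)), v 0 ord0) => //=.
congr pair; apply/rowP => j; rewrite mxE.
by case: unliftP => [k ->|->]; rewrite ?mxE.
Qed.

Lemma dimle_prod_mx X (T : set X) m p q : dimle T m ->
  dimle ([set w | T w.1] : set (prod_space X (mx_space K p q))) (m + p * q).
Proof.
move=> Tm; apply: (dimle_image (F := fun w : prod_space X (mx_space K 1 (p * q)) =>
  (w.1, vec_mx w.2) : prod_space X (mx_space K p q))) (dimle_prod_rV (p * q) Tm) _.
  case=> [i|[i j]] /=; first by apply: ispol_fst; exact: ispol_coord.
  apply: (@ispol_ext _ _ (fun w : prod_space X (mx_space K 1 (p * q)) =>
    w.2 0 (mxvec_index i j))) => [w|]; first by rewrite mxE.
  by apply: (@ispol_snd _ _ _ (fun v : mx_space K 1 (p * q) => v 0 (mxvec_index i j))); exact: ispol_entry.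
by move=> [x A] Tx; exists (x, mxvec A) => //; rewrite mxvecK.
Qed.

Lemma dimle_point_space m : dimle (setT : set (point_space K)) m.
Proof. by apply: dimle_sub (dimle_point (tt : point_space K) m) => -[]. Qed.

Lemma dimle_mx p q (S : set (mx_space K p q)) : dimle S (p * q).
Proof.
apply: (dimle_image (F := fun w : prod_space (point_space K) (mx_space K p q) =>
  w.2 : mx_space K p q)) (dimle_prod_mx p q (dimle_point_space 0)) _ => [[i j]|A _].
  by apply: (@ispol_snd _ _ _ (fun v : mx_space K p q => v i j)); exact: ispol_entry.
by exists (tt, A).
Qed.

End Dimension.

(** * From Hilbert functions to chains of irreducible algebraic sets *)

Section Codimension.
Variable K : fieldType.
Implicit Types X Y : cspace K.

Definition indep_on X (A : finType) (g : A -> X -> K) (C : set X) :=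
  forall c : A -> K, (forall x, C x -> \sum_a c a * g a x = 0) -> forall a, c a = 0.

Definition prime_on X (C : set X) := forall f g : X -> K, ispol f -> ispol g ->
  (forall x, C x -> f x * g x = 0) ->
  (forall x, C x -> f x = 0) \/ (forall x, C x -> g x = 0).

(* A polynomial vanishing on C but not on the larger irreducible set C' is
   transcendental over any family which is independent on C. *)
Lemma indep_on_extend X (C C' : set X) (A : finType) (g : A -> X -> K) (f : X -> K) d :
  C `<=` C' -> prime_on C' -> ispol f -> (forall x, C x -> f x = 0) ->
  (exists2 x, C' x & f x != 0) -> (forall a, ispol (g a)) -> indep_on g C ->
  indep_on (fun (aj : A * 'I_d) x => g aj.1 x * f x ^+ aj.2) C'.
Proof.
move=> CC' C'prime fP fC [x0 C'x0 fx0] gP gC c cE.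
(* Coefficients are removed by increasing power of f: once those below j vanish, f^j divides the
   relation on C', primality cancels it, and on C only the terms of index j survive. *)
suff H (j : nat) (jd : (j < d)%N) a : c (a, Ordinal jd) = 0.
  by case=> a [j jd]; exact: H.
elim/ltn_ind: j jd a => j IH jd.
pose h (k : 'I_d) x := \sum_a c (a, k) * g a x.
pose G x := \sum_(k < d | (j <= k)%N) h k x * f x ^+ (k - j).
have hP k : ispol (h k).
  by apply: ispol_sum => a _; apply: ispolM => //; exact: ispol_cst.
have GP : ispol G by apply: ispol_sum => k _; apply: ispolM => //; exact: ispolX.
have fG x : C' x -> f x ^+ j * G x = 0.
  move=> C'x; rewrite -[RHS](cE x C'x).
  transitivity (\sum_a \sum_(k < d) c (a, k) * (g a x * f x ^+ k)); last first.
    by rewrite pair_bigA; apply: eq_bigr => -[].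
  rewrite exchange_big /=.
  rewrite [RHS](bigID (fun k : 'I_d => (j <= k)%N)) /= [X in _ = _ + X]big1 ?addr0.
    rewrite mulr_sumr; apply: eq_bigr => k jk.
    rewrite mulrCA -exprD subnKC// /h mulr_suml.
    by apply: eq_bigr => a _; rewrite mulrA.
  move=> k; rewrite -ltnNge => kj; apply: big1 => a _.
  suff -> : c (a, k) = 0 by rewrite mul0r.
  by rewrite -(IH k kj (ltn_ord k) a); congr (c (_, _)); exact: val_inj.
have [fj0|G0] := C'prime _ _ (ispolX j fP) GP fG.
  by have /eqP := fj0 _ C'x0; rewrite expf_eq0 (negPf fx0) andbF.
move=> a; apply: (gC (fun a => c (a, Ordinal jd))) => x Cx.
have := G0 _ (CC' _ Cx); rewrite /G (bigD1 (Ordinal jd)) //= subnn expr0 mulr1.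
rewrite big1 ?addr0// => k /andP[jk kj]; rewrite fC// expr0n subn_eq0.
by rewrite leqNgt ltn_neqAle jk eq_sym -(inj_eq val_inj) /= in kj *; rewrite kj /= mulr0.
Qed.

(** The expansion in [e] is available on S and the independence on C. The second hypothesis, true
    for C inside the Zariski closure of S and polynomial g, carries linear relations from S to C. *)
Lemma indep_on_card X (A I : finType) (g : A -> X -> K) (e : I -> X -> K)
    (S C : set X) (c : A -> I -> K) :
  (forall a x, S x -> g a x = \sum_i c a i * e i x) ->
  (forall u : A -> K, (forall x, S x -> \sum_a u a * g a x = 0) ->
    forall x, C x -> \sum_a u a * g a x = 0) ->
  indep_on g C -> (#|A| <= #|I|)%N.
Proof.
move=> gE SC gC; rewrite leqNgt; apply/negP => IA.
pose M := \matrix_(a < #|A|, i < #|I|) c (enum_val a) (enum_val i).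
have : kermx M != 0.
  by rewrite kermx_eq0 /row_free neq_ltn (leq_ltn_trans (rank_leq_col M) IA).
move=> /rowV0Pn[u /sub_kermxP uM /eqP[]]; apply/rowP => a; rewrite mxE.
rewrite -[a]enum_valK; apply: (gC (fun a => u 0 (enum_rank a))); apply: SC => x Sx.
rewrite (eq_bigr (fun a => \sum_i u 0 (enum_rank a) * (c a i * e i x))); last first.
  by move=> b _; rewrite gE// mulr_sumr.
rewrite exchange_big /= big1// => i _.
transitivity ((u *m M) 0 (enum_rank i) * e i x); last by rewrite uM mxE mul0r.
rewrite mxE mulr_suml [RHS](reindex (@enum_rank A)) /=; last first.
  by apply: onW_bij; exact: enum_rank_bij.
by apply: eq_bigr => b _; rewrite !mxE !enum_rankK mulrA.
Qed.

End Codimension.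

Section AlgebraicSets.
Import -(notations) mpoly.
Variable R : realType.
Variable n : nat.
Local Notation ev p := (fun x : 'rV[R]_n => mpoly.meval (fun i => x 0 i) p).

Lemma ispol_meval (p : mpoly.mpoly n R) : ispol (ev p : mx_space R 1 n -> R).
Proof.
have -> : ev p = (fun x : mx_space R 1 n => \sum_(m <- mpoly.msupp p)
  (mpoly.mcoeff m p * \prod_(i < n) x 0 i ^+ mpoly.fun_of_multinom m i)).
  by apply/funext => x; rewrite mpoly.mevalE.
apply: ispol_sum => m _; apply: ispolM; first exact: ispol_cst.
by apply: ispol_prod => i _; apply: ispolX; exact: ispol_entry.
Qed.

Lemma ispol_mpoly (f : mx_space R 1 n -> R) : ispol f -> exists p, f = ev p.
Proof.
move=> [N]; elim=> {N f} [N c|N [i j]|N f g _ [p ->] _ [q ->]|M N f g _ [p ->] _ [q ->]].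
- by exists (mpoly.mpolyC n c); apply/funext => x; rewrite mpoly.mevalC.
- exists (mpoly.mpolyX R (mpoly.mnm1 j)).
  by apply/funext => x; rewrite mpoly.mevalXU ord1.
- by exists (p + q); apply/funext => x; rewrite mpoly.mevalD.
- by exists (p * q); apply/funext => x; rewrite mpoly.mevalM.
Qed.

Lemma prime_on_irreducible (C : set 'rV[R]_n) :
  irreducible_algebraic_set C -> prime_on (C : set (mx_space R 1 n)).
Proof.
move=> [_ _ Cirr] f g /ispol_mpoly[p ->] /ispol_mpoly[q ->] fg.
have algp (r : mpoly.mpoly n R) : algebraic_set [set x | ev r x = 0].
  exists [set r]; apply/seteqP; split => x /= rx; first by move=> _ ->.
  by apply: rx.
case: (Cirr _ _ (algp p) (algp q)).
- by move=> x /fg/eqP; rewrite mulf_eq0 => /orP[]/eqP; [left|right].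
- by left.
- by right.
Qed.

(** Each inclusion of the chain supplies a polynomial vanishing on the smaller set but not on the
    larger one, and its powers up to d multiply the family by d + 1. D adds up the degrees of these
    polynomials and is therefore independent of d. *)
Lemma chain_indep (k : nat) (C : nat -> set 'rV[R]_n) :
  (forall i, (i <= k)%N -> irreducible_algebraic_set (C i)) ->
  (forall i, (i < k)%N -> C i `<` C i.+1) ->
  exists D, forall d, exists (A : finType) (g : A -> mx_space R 1 n -> R),
    [/\ #|A| = (d.+1 ^ k)%N, forall a, poldeg (D * d) (g a) & indep_on g (C k)].
Proof.
elim: k => [|k IH] Cirr Cprop.
  exists 0%N => d; exists unit, (fun _ _ => 1); split.
  - by rewrite card_unit.
  - by move=> _; exact: poldeg_cst.
  - move=> c; have [_ [x Cx] _] := Cirr 0%N isT.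
    by move=> /(_ x Cx); rewrite (bigD1 tt) //= big1 => [|[]//]; rewrite mulr1 addr0 => c0 [].
have [D HD] := IH (fun i ik => Cirr i (leqW ik)) (fun i ik => Cprop i (leqW ik)).
have [CC' /existsNP[x /not_implyP[C'x nCx]]] := Cprop k (ltnSn k).
have [[I CI] _ _] := Cirr k (leqnSn k).
move: nCx; rewrite CI => /existsNP[p /not_implyP[Ip /eqP px]].
have pC y : C k y -> ev p y = 0 by rewrite CI; apply.
have [E pE] := ispol_meval p.
exists (D + E)%N => d; have [A [g [cA gD gC]]] := HD d.
exists (A * 'I_d.+1)%type, (fun (aj : A * 'I_d.+1) y => g aj.1 y * ev p y ^+ aj.2); split.
- by rewrite card_prod card_ord cA expnSr.
- move=> [a j]; rewrite mulnDl; apply: poldeg_mul => //.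
  apply: poldeg_leq (poldeg_exp j pE); rewrite mulnC leq_mul2l -ltnS ltn_ord orbT//.
- apply: (@indep_on_extend _ (mx_space R 1 n) (C k)) => //.
  + by apply: prime_on_irreducible; exact: Cirr.
  + by exists E.
  + by exists x.
  + by move=> a; exists (D * d)%N.
Qed.

Theorem dimle_codim (S : set 'rV[R]_n) m c :
  dimle (S : set (mx_space R 1 n)) m -> (m + c <= n)%N ->
  exists Z : set 'rV[R]_n, [/\ algebraic_set Z, codim_ge c Z & S `<=` Z].
Proof.
move=> [B HB] mcn.
(* Z is the Zariski closure of S: a polynomial vanishing on S vanishes on every C k. *)
pose I := [set p : mpoly.mpoly n R | forall x, S x -> ev p x = 0].
exists [set x | forall p, I p -> ev p x = 0]; split.
- by exists I.
- move=> k C Cirr Cprop.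
  have [D HD] := chain_indep (fun i ik => (Cirr i ik).1) Cprop.
  rewrite (leq_trans _ mcn)// leq_add2r leqNgt; apply/negP => mk.
  (* Large enough for (d + 1)^(m + 1) to exceed B (D d + 1)^m, the bound on the functions of degree
     D d on S. *)
  pose d := (B * D.+1 ^ m)%N.
  have [A [g [cA gD gC]]] := HD d; have [J [e [cJ eP]]] := HB (D * d)%N.
  have [u uP] := choice (fun a => eP _ (gD a)).
  have : (#|A| <= #|J|)%N.
    apply: (indep_on_card uP _ gC) => v vS x Cx.
    have /ispol_mpoly[p pE] : ispol (fun x => \sum_a v a * g a x).
      by apply: ispol_sum => a _; apply: ispolM; [exact: ispol_cst|exists (D * d)%N].
    have {}pE y : \sum_a v a * g a y = ev p y by exact: (congr1 (fun h => h y) pE).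
    rewrite pE; apply: ((Cirr k (leqnn k)).2 x Cx p) => y Sy.
    by rewrite -[LHS]pE; exact: vS.
  rewrite cA => /leq_trans/(_ cJ); apply/negP; rewrite -ltnNge.
  apply: (@leq_ltn_trans (B * (D.+1 * d.+1) ^ m)).
    have [->|m0] := posnP m; first by rewrite !expn0.
    rewrite leq_mul2l leq_exp2r//; apply/orP; right; nia.
  rewrite expnMn mulnA -/d; apply: (@leq_trans (d.+1 ^ m.+1)).
    by rewrite expnS ltn_mul2r expn_gt0 ltnSn.
  by rewrite leq_pexp2l.
- by move=> x Sx p; apply.
Qed.

End AlgebraicSets.

(** * Polynomial parametrisation of kernels by Cramer's rule *)

Section KernelCharts.
Variable K : fieldType.

Lemma rowsub_span m n b (A : 'M[K]_(m, n)) : (\rank A <= b <= m)%N ->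
  exists h : {ffun 'I_b -> 'I_m}, (A <= rowsub h A)%MS.
Proof.
move=> /andP[rb bm].
(* The first [\rank A] indices pick a row basis and the others are padding, so that b can be fixed
   in advance. *)
exists [ffun i : 'I_b => if insub (val i) is Some j then maxrankfun A j
                         else widen_ord bm i].
rewrite -(eq_maxrowsub A); apply/row_subP => j.
apply: (eq_row_sub (widen_ord rb j)); apply/rowP => k; rewrite !mxE ffunE.
by rewrite insubT /= => [|lt]; rewrite ?ltn_ord//; congr (A (maxrankfun A _) k); exact: val_inj.
Qed.

Lemma minor_neq0 m n r (A : 'M[K]_(m, n)) : \rank A = r ->
  exists (f : {ffun 'I_r -> 'I_m}) (g : {ffun 'I_r -> 'I_n}), \det (mxsub f g A) != 0.
Proof.
move=> <-; pose f := maxrankfun A.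
have Af : row_full (rowsub f A)^T.
  by rewrite /row_full mxrank_tr eq_maxrowsub.
pose g := fullrankfun Af.
exists [ffun i => f i], [ffun i => g i].
have := fullrowsub_unit Af; rewrite -/g unitmxE unitfE -det_tr.
by congr (\det _ != 0); apply/matrixP => i j; rewrite !mxE !ffunE.
Qed.

(** Cramer's rule without division. On the left kernel of A it acts as multiplication by the minor;
    when the minor is nonzero and A has rank r, its row space is exactly that kernel. Its entries
    are polynomial in those of A. *)
Definition kernel_chart m n r (f : {ffun 'I_r -> 'I_m}) (g : {ffun 'I_r -> 'I_n})
    (A : 'M[K]_(m, n)) : 'M[K]_m :=
  (\det (mxsub f g A))%:M - colsub g A *m \adj (mxsub f g A) *m rowsub f 1%:M.

Lemma mul_kernel_chart m n r (f : {ffun 'I_r -> 'I_m}) (g : {ffun 'I_r -> 'I_n})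
    (A : 'M[K]_(m, n)) (v : 'rV[K]_m) :
  v *m kernel_chart f g A = \det (mxsub f g A) *: v -
    colsub g (v *m A) *m \adj (mxsub f g A) *m rowsub f 1%:M.
Proof.
rewrite mulmxBr mul_mx_scalar !mulmxA; congr (_ - _ *m _ *m _).
by apply/matrixP => i j; rewrite !mxE; apply: eq_bigr => k _; rewrite !mxE.
Qed.

Lemma rank_kernel_chart m n r (f : {ffun 'I_r -> 'I_m}) (g : {ffun 'I_r -> 'I_n})
    (A : 'M[K]_(m, n)) : \det (mxsub f g A) != 0 ->
  (\rank (kernel_chart f g A) <= m - r)%N.
Proof.
move=> dA; set N := kernel_chart f g A.
have NA : N *m colsub g A = 0.
  rewrite mulmxBl mul_scalar_mx -!mulmxA.
  have -> : rowsub f 1%:M *m colsub g A = mxsub f g A.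
    by rewrite mul_rowsub_mx mul1mx; apply/matrixP => i j; rewrite !mxE.
  by rewrite mul_adj_mx mul_mx_scalar subrr.
have rA : (r <= \rank (colsub g A))%N.
  have rE : \rank (mxsub f g A) = r by apply/mxrank_unit; rewrite unitmxE unitfE.
  have AE : mxsub f g A = rowsub f 1%:M *m colsub g A.
    by rewrite mul_rowsub_mx mul1mx; apply/matrixP => i j; rewrite !mxE.
  by rewrite -{1}rE AE; exact: mxrankM_maxr.
have : (N <= kermx (colsub g A))%MS by apply/sub_kermxP.
by move=> /mxrankS/leq_trans; apply; rewrite mxrank_ker leq_sub2l.
Qed.

Lemma kernel_chart_exists m n r (A : 'M[K]_(m, n)) : \rank A = r ->
  exists (f : {ffun 'I_r -> 'I_m}) (g : {ffun 'I_r -> 'I_n}) (h : {ffun 'I_(m - r) -> 'I_m}),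
    \det (mxsub f g A) != 0 /\ (kernel_chart f g A <= rowsub h (kernel_chart f g A))%MS.
Proof.
move=> /minor_neq0[f [g dA]]; exists f, g.
have [h hP] : exists h : {ffun 'I_(m - r) -> 'I_m},
    (kernel_chart f g A <= rowsub h (kernel_chart f g A))%MS.
  by apply: rowsub_span; rewrite rank_kernel_chart// leq_subr.
by exists h.
Qed.

Lemma ispolmx_kernel_chart (X : cspace K) m n r (f : {ffun 'I_r -> 'I_m})
    (g : {ffun 'I_r -> 'I_n}) (A : X -> 'M[K]_(m, n)) :
  ispolmx A -> ispolmx (fun x => kernel_chart f g (A x)).
Proof.
move=> AP; apply: ispolmxB.
  move=> i j; apply: (@ispol_ext _ _ (fun x => \det (mxsub f g (A x)) *+ (i == j))).
    by move=> x; rewrite mxE.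
  case: (i == j); last exact: ispol_cst.
  by apply: ispol_det; exact: ispolmx_sub.
apply: ispolmxM; last exact: ispolmx_cst.
by apply: ispolmxM; [|apply: ispolmx_adj]; exact: ispolmx_sub.
Qed.

End KernelCharts.

(** * Families of affine and linear spaces *)

Section Fibrations.
Variable K : fieldType.
Implicit Types X Y : cspace K.

Lemma ispolmx_proj2 X m n : ispolmx (fun p : prod_space X (mx_space K m n) => p.2).
Proof. exact: (@ispolmx_snd _ X (mx_space K m n) _ _ (fun A => A) (@ispolmx_id _ _ _)). Qed.

(** Finitely many strata, given by the rank r of M t and by a nonvanishing minor, cover S. On each
    of them the solutions of v *m M t = mu t are rational in t and in k - r free parameters, and r
    >= rho. *)
Lemma dimle_affine_fiber X (T : set X) a k l (M : X -> 'M[K]_(k, l)) (mu : X -> 'rV[K]_l) rho d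
    (S : set (prod_space X (mx_space K 1 k))) :
  dimle T a -> ispolmx M -> ispolmx mu -> (a + k <= d + rho)%N ->
  (forall t v, S (t, v) -> [/\ T t, v *m M t = mu t & (rho <= \rank (M t))%N]) ->
  dimle S d.
Proof.
move=> Ta MP muP akd SP.
apply: (@dimle_sub _ _ _ (\bigcup_(r : 'I_k.+1)
    \bigcup_(fgh : {ffun 'I_r -> 'I_k} * {ffun 'I_r -> 'I_l} * {ffun 'I_(k - r) -> 'I_k})
    [set p | S p /\ (\rank (M p.1) = r /\ (\det (mxsub fgh.1.1 fgh.1.2 (M p.1)) != 0 /\
      (kernel_chart fgh.1.1 fgh.1.2 (M p.1) <= rowsub fgh.2 (kernel_chart fgh.1.1 fgh.1.2 (M p.1)))%MS))])).
  move=> [t v] Sp; have rk : (\rank (M t) < k.+1)%N by rewrite ltnS rank_leq_row.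
  exists (Ordinal rk) => //.
  have [f [g [h [H1 H2]]]] := kernel_chart_exists (erefl (\rank (M t))).
  by exists (f, g, h).
apply: dimle_bigcup => r; apply: dimle_bigcup => -[[f g] h] /=.
have [rrho|rhor] := ltnP r rho.
  apply: dimle_sub (dimle_set0 _ _) => -[t v] /= [/SP[_ _ +] [rkM _]].
  by rewrite rkM leqNgt rrho.
have Tq := dimle_prod_rV (k - r) Ta.
have kr : (r <= k)%N by rewrite -ltnS.
apply: (@dimle_leq _ _ _ (a + (k - r))); first lia.
pose N t := kernel_chart f g (M t).
pose D t := \det (mxsub f g (M t)).
have DP : ispol D by apply: ispol_det; exact: ispolmx_sub.
pose Y := prod_space X (mx_space K 1 (k - r)).
refine (@dimle_rational_image _ (prod_space X (mx_space K 1 k)) Y _ _ (fun p => D p.1)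
  (fun i p => match i with
    | inl j => D p.1 * ccoord j p.1
    | inr ij => (p.2 *m rowsub h (N p.1) +
        colsub g (mu p.1) *m \adj (mxsub f g (M p.1)) *m rowsub f 1%:M) ij.1 ij.2 end)
  _ _ _ Tq _).
- exact: (@ispol_fst _ _ _ D).
- case=> [j|[i j]].
    by apply: ispolM; [exact: (@ispol_fst _ _ _ D)|exact: (@ispol_coord _ Y (inl j))].
  move: i j; apply: ispolmxD.
    apply: ispolmxM; first by exact: ispolmx_proj2.
    apply: (@ispolmx_fst _ _ _ _ _ (fun t => rowsub h (N t))).
    by apply: ispolmx_sub; exact: ispolmx_kernel_chart.
  apply: (@ispolmx_fst _ _ _ _ _ (fun t => colsub g (mu t) *m \adj (mxsub f g (M t)) *m rowsub f 1%:M)).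
  apply: ispolmxM; last exact: ispolmx_cst.
  by apply: ispolmxM; [|apply: ispolmx_adj]; exact: ispolmx_sub.
move=> [t v] /= [/SP[Tt vM _] [_ [D0 NP]]].
have /submxP[y yE] : (v *m N t <= rowsub h (N t))%MS.
  exact: submx_trans (submxMl _ _) NP.
exists (t, y) => //=; split => // -[j|[i j]] //=.
by rewrite -yE mul_kernel_chart vM subrK mxE.
Qed.

Lemma dimle_span_fiber X (T : set X) a b k l (N : X -> 'M[K]_(l, k))
    (S : set (prod_space X (mx_space K 1 k))) :
  dimle T a -> ispolmx N ->
  (forall t v, S (t, v) -> [/\ T t, (v <= N t)%MS & (\rank (N t) <= b)%N]) ->
  dimle S (a + b).
Proof.
move=> Ta NP SP.
apply: (@dimle_sub _ _ _ (\bigcup_(r : 'I_l.+1)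
    \bigcup_(h : {ffun 'I_r -> 'I_l})
    [set p | S p /\ (\rank (N p.1) = r /\ (N p.1 <= rowsub h (N p.1))%MS)])).
  move=> [t v] Sp; have rk : (\rank (N t) < l.+1)%N by rewrite ltnS rank_leq_row.
  exists (Ordinal rk) => //.
  have [h hP] : exists h : {ffun 'I_(\rank (N t)) -> 'I_l}, (N t <= rowsub h (N t))%MS.
    by apply: rowsub_span; rewrite leqnn rank_leq_row.
  by exists h.
apply: dimle_bigcup => r; apply: dimle_bigcup => h /=.
have [br|rb] := ltnP b r.
  apply: dimle_sub (dimle_set0 _ _) => -[t v] /= [/SP[_ _ +] [rkM _]].
  by rewrite rkM leqNgt br.
apply: (@dimle_leq _ _ _ (a + r)); first lia.
apply: (dimle_image (F := fun p : prod_space X (mx_space K 1 r) =>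
   (p.1, p.2 *m rowsub h (N p.1)) : prod_space X (mx_space K 1 k))) (dimle_prod_rV r Ta) _.
  case=> [j|[i j]]; first by apply: ispol_fst; exact: ispol_coord.
  move: i j; apply: ispolmxM; first by exact: ispolmx_proj2.
  by apply: (@ispolmx_fst _ _ _ _ _ (fun t => rowsub h (N t))); exact: ispolmx_sub.
move=> [t v] /= [/SP[Tt vN _] [_ Nh]].
by have /submxP[y ->] := submx_trans vN Nh; exists (t, y).
Qed.

End Fibrations.

Lemma card_ltn_pairs q : #|{: {ij : 'I_q * 'I_q | (ij.1 < ij.2)%N}}| = 'C(q, 2).
Proof.
rewrite card_sig -sum1_card -(pair_big_dep predT (fun i j : 'I_q => (i < j)%N) (fun _ _ => 1%N)) /=.
rewrite (exchange_big_dep predT) //= -bin2_sum big_mkord.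
apply: eq_bigr => j _.
by rewrite (big_ord_narrow (ltnW (ltn_ord j))) /= sum1_card card_ord.
Qed.

(** * Brackets of a kernel *)

Section Brackets.
Variables (K : fieldType) (r c : nat) (B : 'I_c -> 'M[K]_r).

Definition mxbr (x y : 'rV[K]_r) : 'rV[K]_c := \row_k (x *m B k *m y^T) 0 0.

Lemma mxbr_suml (I : finType) (a : I -> K) (x : I -> 'rV[K]_r) y :
  mxbr (\sum_i a i *: x i) y = \sum_i a i *: mxbr (x i) y.
Proof.
apply/rowP => k; rewrite mxE !mulmx_suml summxE summxE; apply: eq_bigr => i _.
by rewrite -!scalemxAl !mxE.
Qed.

Lemma mxbr_sumr (I : finType) (a : I -> K) (x : I -> 'rV[K]_r) y :
  mxbr y (\sum_i a i *: x i) = \sum_i a i *: mxbr y (x i).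
Proof.
apply/rowP => k; rewrite mxE linear_sum mulmx_sumr summxE summxE; apply: eq_bigr => i _.
by rewrite linearZ /= -scalemxAr !mxE.
Qed.

Lemma mxbrDl x1 x2 y : mxbr (x1 + x2) y = mxbr x1 y + mxbr x2 y.
Proof. by apply/rowP => k; rewrite [LHS]mxE !mulmxDl !mxE. Qed.

Lemma mxbrDr x1 x2 y : mxbr y (x1 + x2) = mxbr y x1 + mxbr y x2.
Proof. by apply/rowP => k; rewrite [LHS]mxE linearD mulmxDr !mxE. Qed.

Hypothesis mxbrxx : forall x, mxbr x x = 0.

Lemma mxbrC x y : mxbr x y = - mxbr y x.
Proof.
by apply/eqP; rewrite -addr_eq0; apply/eqP; have := mxbrxx (x + y);
  rewrite mxbrDl !mxbrDr !mxbrxx add0r addr0.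
Qed.

(* z lies in the span of the brackets of elements of ker M, expressed through
   the linear forms nu vanishing on these brackets. *)
Definition kernel_bracket l (M : 'M[K]_(r, l)) (x : 'rV[K]_r) (z : 'rV[K]_c) :=
  x *m M = 0 /\ forall nu : 'cV[K]_c,
    (forall v w : 'rV_r, v *m M = 0 -> w *m M = 0 -> mxbr v w *m nu = 0) ->
    z *m nu = 0.

Definition pair_brackets q (P : 'M[K]_(q, r)) :=
  \matrix_(p < #|{: {ij : 'I_q * 'I_q | (ij.1 < ij.2)%N}}|)
    mxbr (row (val (enum_val p)).1 P) (row (val (enum_val p)).2 P).

(** By duality it suffices that the columns of the cokernel of [pair_brackets P], as linear forms,
    kill z. They kill all brackets of combinations of rows of P, because bilinearity and skew
    symmetry reduce these to the pairs i < j. *)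
Lemma kernel_bracket_sub l (M : 'M[K]_(r, l)) q (P : 'M[K]_(q, r)) x z :
  (forall v : 'rV_r, v *m M = 0 -> (v <= P)%MS) -> kernel_bracket M x z ->
  (z <= pair_brackets P)%MS.
Proof.
move=> MP [_ zM]; rewrite submxE; apply/eqP; set G := pair_brackets P.
have brP i j : mxbr (row i P) (row j P) *m cokermx G = 0.
  wlog ij : i j / (i < j)%N.
    move=> H; have [/H//|/H ji|/val_inj ->] := ltngtP i j.
      by rewrite mxbrC mulNmx ji oppr0.
    by rewrite mxbrxx mul0mx.
  have -> : mxbr (row i P) (row j P) =
      row (enum_rank (exist (fun ij : 'I_q * 'I_q => (ij.1 < ij.2)%N) (i, j) ij)) G.
    by rewrite rowK enum_rankK.
  by rewrite -row_mul mulmx_coker row0.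
apply/rowP => k; rewrite [RHS]mxE.
have : z *m col k (cokermx G) = 0.
  apply: zM => v w /MP/submxP[a ->] /MP/submxP[b ->].
  rewrite (mulmx_sum_row a) (mulmx_sum_row b) mxbr_suml mulmx_suml big1// => i _.
  rewrite mxbr_sumr -scalemxAl mulmx_suml big1 ?scaler0// => j _.
  by rewrite -scalemxAl colE mulmxA brP mul0mx scaler0.
by rewrite colE mulmxA -colE => /colP/(_ 0); rewrite !mxE.
Qed.

Lemma ispolmx_mxbr (X : cspace K) (x y : X -> 'rV_r) :
  ispolmx x -> ispolmx y -> ispolmx (fun t => mxbr (x t) (y t)).
Proof.
move=> xP yP i k.
apply: (@ispol_ext _ _ (fun t => (x t *m B k *m (y t)^T) 0 0)) => [t|].
  by rewrite [RHS]mxE.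
suff H : ispolmx (fun t => x t *m B k *m (y t)^T) by exact: H.
apply: ispolmxM; last exact: ispolmx_tr.
by apply: ispolmxM => //; exact: ispolmx_cst.
Qed.

(** Two fibrations in succession: x moves in a kernel of dimension q <= r - rho, then z in the span
    of the 'C(q, 2) brackets of a spanning family of that kernel. *)
Lemma dimle_kernel_bracket (X : cspace K) (T : set X) a l (M : X -> 'M[K]_(r, l)) rho d
    (S : set (prod_space (prod_space X (mx_space K 1 r)) (mx_space K 1 c))) :
  dimle T a -> ispolmx M -> (a + (r - rho) + 'C(r - rho, 2) <= d)%N ->
  (forall t x z, S (t, x, z) ->
    [/\ T t, (rho <= \rank (M t))%N & kernel_bracket (M t) x z]) ->
  dimle S d.
Proof.
move=> Ta MP ad SP.
apply: (@dimle_sub _ _ _ (\bigcup_(k : 'I_r.+1)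
    \bigcup_(fgh : {ffun 'I_k -> 'I_r} * {ffun 'I_k -> 'I_l} * {ffun 'I_(r - k) -> 'I_r})
    [set p | S p /\ (\rank (M p.1.1) = k /\ (\det (mxsub fgh.1.1 fgh.1.2 (M p.1.1)) != 0 /\
      (kernel_chart fgh.1.1 fgh.1.2 (M p.1.1) <=
        rowsub fgh.2 (kernel_chart fgh.1.1 fgh.1.2 (M p.1.1)))%MS))])).
  move=> [[t x] z] Sp; have rk : (\rank (M t) < r.+1)%N by rewrite ltnS rank_leq_row.
  exists (Ordinal rk) => //.
  have [f [g [h [H1 H2]]]] := kernel_chart_exists (erefl (\rank (M t))).
  by exists (f, g, h).
apply: dimle_bigcup => k; apply: dimle_bigcup => -[[f g] h] /=.
have [krho|rhok] := ltnP k rho.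
  apply: dimle_sub (dimle_set0 _ _) => -[[t x] z] /= [/SP[_ + _] [rkM _]].
  by rewrite rkM leqNgt krho.
pose P t := rowsub h (kernel_chart f g (M t)).
have PP : ispolmx P by apply: ispolmx_sub; exact: ispolmx_kernel_chart.
have MPt t : \det (mxsub f g (M t)) != 0 ->
    (kernel_chart f g (M t) <= P t)%MS -> forall v : 'rV_r, v *m M t = 0 -> (v <= P t)%MS.
  move=> D0 NP v vM; rewrite -(eqmx_scale _ D0).
  have -> : \det (mxsub f g (M t)) *: v = v *m kernel_chart f g (M t).
    have v0 : colsub g (0 : 'rV[K]_l) = 0 by apply/matrixP => i j; rewrite !mxE.
    by rewrite mul_kernel_chart vM v0 !mul0mx subr0.
  exact: submx_trans (submxMl _ _) NP.
pose U : set (prod_space X (mx_space K 1 r)) := [set p | T p.1 /\ (p.2 <= P p.1)%MS].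
have Ud : dimle U (a + (r - k)).
  apply: (dimle_span_fiber (N := P)) Ta PP _ => t x [Tt xP].
  by split => //; exact: rank_leq_row.
apply: (@dimle_leq _ _ _ (a + (r - k) + 'C(r - k, 2))).
  apply: leq_trans ad; apply: leq_add; first lia.
  by apply: leq_bin2l; lia.
apply: (dimle_span_fiber (N := fun p : prod_space X (mx_space K 1 r) => pair_brackets (P p.1))) Ud _ _.
  apply: (@ispolmx_fst _ _ _ _ _ (fun t => pair_brackets (P t))) => p j.
  set i1 := (val (enum_val p)).1; set i2 := (val (enum_val p)).2.
  apply: (@ispol_ext _ _ (fun t => mxbr (row i1 (P t)) (row i2 (P t)) 0 j)) => [t|].
    by rewrite /pair_brackets [RHS]mxE.
  by apply: ispolmx_mxbr => i' j'; [apply: ispol_ext (PP i1 j')|apply: ispol_ext (PP i2 j')]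
    => t; rewrite [RHS]mxE.
move=> [t x] z /= [/SP[Tt _ xz] [_ [D0 NP]]]; split.
- by split => //; apply: MPt => //; case: xz.
- by apply: kernel_bracket_sub xz; exact: MPt.
- by rewrite (leq_trans (rank_leq_row _))// card_ltn_pairs.
Qed.

End Brackets.

(** * Rank bounds and skew matrices *)

Section Ranks.
Variable K : fieldType.

Lemma rank_ge_rowsub m n p (f : 'I_p -> 'I_m) (A : 'M[K]_(m, n)) :
  (forall u : 'rV_p, u *m rowsub f A = 0 -> u = 0) -> (p <= \rank A)%N.
Proof.
move=> H; have : row_free (rowsub f A).
  by rewrite -kermx_eq0; apply/rowV0P => u /sub_kermxP /H.
rewrite /row_free => /eqP <-; apply: mxrankS; apply/row_subP => i.
by rewrite row_rowsub row_sub.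
Qed.

Lemma rank_ge2 m n (A : 'M[K]_(m, n)) i j :
  (forall a b, (forall k, a * A i k + b * A j k = 0) -> a = 0 /\ b = 0) ->
  (2 <= \rank A)%N.
Proof.
move=> H; apply: (@rank_ge_rowsub _ _ 2 (fun s => nth i [:: i; j] s)) => u uA.
have [] := H (u 0 ord0) (u 0 (lift ord0 ord0)).
  move=> k; have /rowP/(_ k) := uA.
  by rewrite !mxE !big_ord_recl big_ord0 !mxE /= addr0.
move=> u0 u1; apply/rowP; case=> [[|[|s]] hs]; rewrite mxE //.
  by rewrite -[RHS]u0; congr (u 0 _); exact: val_inj.
by rewrite -[RHS]u1; congr (u 0 _); exact: val_inj.
Qed.

Lemma rank_ge3 m n (A : 'M[K]_(m, n)) i j l :
  (forall a b c, (forall k, a * A i k + b * A j k + c * A l k = 0) ->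
    [/\ a = 0, b = 0 & c = 0]) ->
  (3 <= \rank A)%N.
Proof.
move=> H; apply: (@rank_ge_rowsub _ _ 3 (fun s => nth i [:: i; j; l] s)) => u uA.
have [] := H (u 0 ord0) (u 0 (lift ord0 ord0)) (u 0 (lift ord0 (lift ord0 ord0))).
  move=> k; have /rowP/(_ k) := uA.
  by rewrite !mxE !big_ord_recl big_ord0 !mxE /= addr0 addrA.
move=> u0 u1 u2; apply/rowP; case=> [[|[|[|s]]] hs]; rewrite mxE //.
- by rewrite -[RHS]u0; congr (u 0 _); exact: val_inj.
- by rewrite -[RHS]u1; congr (u 0 _); exact: val_inj.
- by rewrite -[RHS]u2; congr (u 0 _); exact: val_inj.
Qed.

Lemma rank_row_mx_ltn k l (u : 'cV[K]_k) (N : 'M[K]_(k, l)) (v : 'rV[K]_k) :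
  v *m N = 0 -> v *m u != 0 -> (\rank N < \rank (row_mx u N))%N.
Proof.
move=> vN vu; rewrite -mxrank_tr -[X in (_ < X)%N]mxrank_tr tr_row_mx.
apply: rank_ltmx; rewrite /ltmx col_mx_sub submx_refl andbT -addsmxE addsmxSr /=.
apply: contra vu => /submxP[y uE].
by rewrite -[u]trmxK uE trmx_mul trmxK mulmxA vN mul0mx.
Qed.

Definition skew r (w : 'M[K]_r) := forall i j, w j i = - w i j /\ w i i = 0.

Lemma skewZ r (w : 'M[K]_r) a : skew w -> skew (a *: w).
Proof. by move=> H i j; have [wji wii] := H i j; rewrite !mxE wji wii mulrN mulr0. Qed.

Lemma skewD r (w w' : 'M[K]_r) : skew w -> skew w' -> skew (w + w').
Proof.
move=> H H' i j; have [wji wii] := H i j; have [wji' wii'] := H' i j.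
by rewrite !mxE wji wji' wii wii' opprD addr0.
Qed.

Lemma skew_sum r (I : finType) (a : I -> K) (w : I -> 'M[K]_r) :
  (forall i, skew (w i)) -> skew (\sum_i a i *: w i).
Proof.
move=> H; apply: (big_ind (@skew r)).
- by move=> i j; rewrite !mxE oppr0.
- by move=> *; exact: skewD.
- by move=> i _; exact: skewZ.
Qed.

Lemma skew_form0 r (w : 'M[K]_r) (a : 'rV_r) : 2%:R != 0 :> K -> skew w -> a *m w *m a^T = 0.
Proof.
move=> two_neq0 H; have wT : w^T = - w.
  by apply/matrixP => i j; rewrite !mxE; have [->] := H i j.
have E : (a *m w *m a^T)^T = a *m w *m a^T by apply/matrixP => i j; rewrite !mxE !ord1.
have : a *m w *m a^T = - (a *m w *m a^T).
  by rewrite -{1}E !trmx_mul trmxK wT mulNmx mulmxN mulmxA.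
move=> /eqP; rewrite -addr_eq0 -mulr2n -scaler_nat scaler_eq0 (negPf two_neq0) /=.
by move=> /eqP.
Qed.

Lemma skew_rank_ge2 r (w : 'M[K]_r) : skew w -> w != 0 -> (2 <= \rank w)%N.
Proof.
move=> H w0; have [i [j wij]] : exists i, exists j, w i j != 0.
  apply: contrapT => H'; case/negP: w0; apply/eqP/matrixP => i j; rewrite mxE.
  by apply/eqP; apply: contrapT => /negP wij; apply: H'; exists i, j.
apply: (@rank_ge2 _ _ _ i j) => a b ab.
have [wji wii] := H i j; have [_ wjj] := H j i.
have := ab i; rewrite wii wji mulr0 add0r mulrN => /eqP.
rewrite oppr_eq0 mulf_eq0 (negPf wij) orbF => /eqP b0.
have := ab j; rewrite b0 mul0r addr0 => /eqP.
by rewrite mulf_eq0 (negPf wij) orbF => /eqP a0.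
Qed.

Definition pfaffian4 r (w : 'M[K]_r) i j k l :=
  w i j * w k l - w i k * w j l + w i l * w j k.

(** If w i j is nonzero, the rows i, j, k are independent: combining the entries i, j, l of a
    relation with the weights w j l, - w i l, w i j leaves c times the Pfaffian. Permuting the
    indices changes the Pfaffian only by a sign, so any nonzero entry of row i will do. *)
Lemma pfaffian4_rank_ge3 r (w : 'M[K]_r) i j k l : skew w -> pfaffian4 w i j k l != 0 ->
  (3 <= \rank w)%N.
Proof.
move=> H.
have main i' j' k' l' : w i' j' != 0 -> pfaffian4 w i' j' k' l' != 0 -> (3 <= \rank w)%N.
  move=> wij pf; apply: (@rank_ge3 _ _ _ i' j' k') => a b c abc.
  have [ji ii] := H i' j'; have [ki _] := H i' k'; have [kj jj] := H j' k'.
  have c0 : c = 0.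
    apply/eqP; have /eqP : c * pfaffian4 w i' j' k' l' = 0.
      rewrite /pfaffian4; have := abc i'; have := abc j'; have := abc l'.
      rewrite ji ii ki kj jj => el ej ei.
      have -> : c * (w i' j' * w k' l' - w i' k' * w j' l' + w i' l' * w j' k') =
        w i' j' * (a * w i' l' + b * w j' l' + c * w k' l')
        - w i' l' * (a * w i' j' + b * 0 + c * - w j' k')
        + w j' l' * (a * 0 + b * - w i' j' + c * - w i' k') by ring.
      by rewrite el ej ei !mulr0 subrr addr0.
    by rewrite mulf_eq0 (negPf pf) orbF.
  have := abc i'; have := abc j'; rewrite c0 ii jj ji !mul0r !mulr0 !addr0 add0r mulrN.
  move=> /eqP; rewrite mulf_eq0 (negPf wij) orbF => /eqP a0 /eqP.
  by rewrite oppr_eq0 mulf_eq0 (negPf wij) orbF => /eqP b0.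
move=> pf; have [wij|/eqP wij] := eqVneq (w i j) 0; last by apply: main pf; apply/eqP.
have [wik|wik] := eqVneq (w i k) 0; last first.
  apply: (main i k j l wik); apply: contra pf => /eqP pf; apply/eqP.
  rewrite -[RHS]oppr0 -pf /pfaffian4; have [-> _] := H j k; ring.
have [wil|wil] := eqVneq (w i l) 0; last first.
  apply: (main i l j k wil); apply: contra pf => /eqP pf; apply/eqP.
  rewrite -[RHS]pf /pfaffian4; have [-> _] := H k l; have [-> _] := H j l; ring.
by move: pf; rewrite /pfaffian4 wij wik wil !mul0r subr0 addr0 eqxx.
Qed.

End Ranks.

(** * Projections that forget parameters *)

Section Forget.
Variable K : fieldType.

Lemma dimle_forget (X Y Z : cspace K) (S' : set (prod_space (prod_space X Y) Z))
    (S : set (prod_space Y Z)) d :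
  dimle S' d -> (forall y z, S (y, z) -> exists t, S' (t, y, z)) -> dimle S d.
Proof.
move=> S'd SS'.
apply: (dimle_image (F := fun p : prod_space (prod_space X Y) Z => (p.1.2, p.2) : prod_space Y Z)) S'd _.
  case=> i; last by apply: ispol_ext (@ispol_coord _ (prod_space (prod_space X Y) Z) (inr i)).
  by apply: ispol_ext (@ispol_coord _ (prod_space (prod_space X Y) Z) (inl (inr i))).
by move=> [y z] /SS'[t Stz]; exists (t, y, z).
Qed.

Lemma dimle_forget1 (X Y : cspace K) (S' : set (prod_space X Y)) (S : set Y) d :
  dimle S' d -> (forall y, S y -> exists t, S' (t, y)) -> dimle S d.
Proof.
move=> S'd SS'.
apply: (dimle_image (F := fun p : prod_space X Y => p.2)) S'd _.
  by move=> i; exact: (@ispol_coord _ (prod_space X Y) (inr i)).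
by move=> y /SS'[t Sty]; exists (t, y).
Qed.

Lemma dimle_affine k l (M : 'M[K]_(k, l)) (mu : 'rV_l) rho d (S : set (mx_space K 1 k)) :
  (k <= d + rho)%N -> (rho <= \rank M)%N -> (forall v, S v -> v *m M = mu) -> dimle S d.
Proof.
move=> kd rM SM.
apply: (@dimle_forget1 (point_space K) (mx_space K 1 k) [set p | S p.2]); last first.
  by move=> v Sv; exists tt.
apply: (@dimle_affine_fiber K (point_space K) setT 0 k l (fun=> M) (fun=> mu) rho).
- exact: dimle_point_space.
- exact: ispolmx_cst.
- exact: ispolmx_cst.
- by rewrite add0n.
- by move=> t v /= /SM.
Qed.

End Forget.

(** * The abnormal variety of a family of skew forms *)

Section AbnormalVariety.
Variables (K : realFieldType) (r c : nat) (B : 'I_c -> 'M[K]_r).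
Hypothesis skewB : forall k, skew (B k).

Definition omega (la : 'rV[K]_c) : 'M[K]_r := \sum_k la 0 k *: B k.

Lemma skew_omega la : skew (omega la).
Proof. exact: skew_sum. Qed.

Lemma omegaZ a la : omega (a *: la) = a *: omega la.
Proof. by rewrite scaler_sumr; apply: eq_bigr => k _; rewrite mxE scalerA. Qed.

Lemma omegaD la mu : omega (la + mu) = omega la + omega mu.
Proof. by rewrite -big_split; apply: eq_bigr => k _; rewrite mxE scalerDl. Qed.

Lemma ispolmx_omega : ispolmx (fun la : mx_space K 1 c => omega la).
Proof.
apply: ispolmx_sum => k _.
by apply: (@ispolmxZ _ (mx_space K 1 c)); [exact: ispol_entry|exact: ispolmx_cst].
Qed.

Lemma mxbrxx x : mxbr B x x = 0.
Proof.
apply/rowP => k; rewrite !mxE; have two_neq0 : 2%:R != 0 :> K by rewrite pnatr_eq0.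
by have /matrixP/(_ 0 0) := skew_form0 x two_neq0 (skewB k); rewrite !mxE.
Qed.

Lemma mxbr_omega v w la : mxbr B v w *m la^T = v *m omega la *m w^T.
Proof.
rewrite mulmx_sumr mulmx_suml; apply/matrixP => i j; rewrite !ord1 [LHS]mxE summxE.
apply: eq_bigr => k _; rewrite -scalemxAr -scalemxAl [RHS]mxE.
by rewrite [mxbr _ _ _ _ _]mxE [la^T _ _]mxE mulrC.
Qed.

Lemma kernel_bracket_mono l l' (M : 'M[K]_(r, l)) (M' : 'M[K]_(r, l')) x z :
  (forall v : 'rV_r, v *m M = 0 -> v *m M' = 0) -> kernel_bracket B M x z ->
  kernel_bracket B M' x z.
Proof.
move=> MM' [xM zM]; split; first exact: MM'.
by move=> nu H; apply: zM => v w /MM' v0 /MM' w0; exact: H.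
Qed.

(* The union over la in T of K + [K, K], where K is the kernel of omega la. *)
Definition abn (T : set 'rV[K]_c) : set (prod_space (mx_space K 1 r) (mx_space K 1 c)) :=
  [set p | exists2 la, T la & kernel_bracket B (omega la) p.1 p.2].

Lemma abn_form0 la x z : kernel_bracket B (omega la) x z -> z *m la^T = 0.
Proof. by move=> [_]; apply => v w v0 _; rewrite mxbr_omega v0 mul0mx. Qed.

(** The kernel of omega depends on la only up to scaling, so la may be restricted to representatives
    of projective points, which saves one dimension. *)
Lemma abn_cover (T T' : set 'rV[K]_c) :
  (forall la, T la -> exists2 s, s != 0 & T' (s *: la)) -> abn T `<=` abn T'.
Proof.
move=> TT' p [la /TT'[s s0 T's] kb]; exists (s *: la) => //.
by apply: kernel_bracket_mono kb => v v0; rewrite omegaZ -scalemxAr v0 scaler0.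
Qed.

Lemma dimle_abn_kernel (T : set (mx_space K 1 c)) a rho :
  dimle T a -> (forall la, T la -> (rho <= \rank (omega la))%N) ->
  dimle [set p : prod_space (mx_space K 1 c) (mx_space K 1 r) | T p.1 /\ p.2 *m omega p.1 = 0]
    (a + (r - rho)).
Proof.
move=> Ta Trho.
apply: (@dimle_affine_fiber K (mx_space K 1 c) T a r r omega (fun=> 0) rho) Ta _ _ _ _.
- exact: ispolmx_omega.
- exact: ispolmx_cst.
- lia.
- by move=> la x [Tla xla]; split => //; exact: Trho.
Qed.

(** The bracket part is bounded here by the hyperplane la = 0 of the center, which is the better
    estimate when c is small; [dimle_abn_bracket] counts pairs of kernel vectors instead. *)
Lemma dimle_abn_form (T : set (mx_space K 1 c)) a rho :
  dimle T a -> (forall la, T la -> la != 0 /\ (rho <= \rank (omega la))%N) ->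
  dimle (abn T) (a + (r - rho) + (c - 1)).
Proof.
move=> Ta Trho; have Ud := dimle_abn_kernel Ta (fun la Tla => (Trho la Tla).2).
pose S' : set (prod_space (prod_space (mx_space K 1 c) (mx_space K 1 r)) (mx_space K 1 c)) :=
  [set p | (T p.1.1 /\ p.1.2 *m omega p.1.1 = 0) /\ p.2 *m p.1.1^T = 0].
apply: (@dimle_forget _ _ _ _ S'); last first.
  move=> x z [la Tla kb]; exists la; split; last exact: abn_form0 kb.
  by split => //; case: kb.
apply: (@dimle_affine_fiber K (prod_space (mx_space K 1 c) (mx_space K 1 r)) _ _ c 1
  (fun p => p.1^T) (fun=> 0) 1) Ud _ _ _ _.
- by apply: (@ispolmx_fst _ _ _ _ _ (fun la : mx_space K 1 c => la^T)); apply: ispolmx_tr; exact: ispolmx_id.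
- exact: ispolmx_cst.
- lia.
- move=> [la x] z [[Tla xla] zla]; split => //.
  by rewrite mxrank_tr lt0n mxrank_eq0; case: (Trho la Tla).
Qed.

Lemma dimle_abn_commuting (T : set (mx_space K 1 c)) a rho :
  dimle T a -> (forall la, T la -> (rho <= \rank (omega la))%N) ->
  (forall la v w, T la -> v *m omega la = 0 -> w *m omega la = 0 -> mxbr B v w = 0) ->
  dimle (abn T) (a + (r - rho)).
Proof.
move=> Ta Trho Tcomm; have Ud := dimle_abn_kernel Ta Trho.
apply: (dimle_image (F := fun p : prod_space (mx_space K 1 c) (mx_space K 1 r) =>
  (p.2, 0) : prod_space (mx_space K 1 r) (mx_space K 1 c))) Ud _.
  case=> [i|[i j]]; first exact: (@ispol_coord _ (prod_space _ (mx_space K 1 r)) (inr i)).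
  by apply: (@ispol_ext _ _ (fun=> 0)) => [p|]; [rewrite /= mxE|exact: ispol_cst].
move=> [x z] [la Tla [xla zla]]; exists (la, x) => //=; congr pair.
apply/rowP => k; have /matrixP/(_ 0 0) : z *m delta_mx k (0 : 'I_1) = 0.
  by apply: zla => v w v0 w0; rewrite (Tcomm la)// mul0mx.
by rewrite -colE !mxE.
Qed.

Lemma dimle_abn_bracket (T : set (mx_space K 1 c)) a rho :
  dimle T a -> (forall la, T la -> (rho <= \rank (omega la))%N) ->
  dimle (abn T) (a + (r - rho) + 'C(r - rho, 2)).
Proof.
move=> Ta Trho.
pose S' : set (prod_space (prod_space (mx_space K 1 c) (mx_space K 1 r)) (mx_space K 1 c)) :=
  [set p | T p.1.1 /\ kernel_bracket B (omega p.1.1) p.1.2 p.2].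
apply: (@dimle_forget _ _ _ _ S'); last first.
  by move=> x z [la Tla kb]; exists la.
apply: (dimle_kernel_bracket mxbrxx Ta ispolmx_omega (leqnn _)) => la x z [Tla kb].
by split => //; exact: Trho.
Qed.

(** If all forms have rank at most two, polarising the Pfaffians gives omega la /\ omega mu = 0 for
    every mu. Contracting with v and then with w, both in the kernel of omega la, leaves omega mu
    (v, w) = 0. *)
Lemma pfaffian4_abelian la v w :
  (forall mu i j k l, pfaffian4 (omega mu) i j k l = 0) -> omega la != 0 ->
  v *m omega la = 0 -> w *m omega la = 0 -> mxbr B v w = 0.
Proof.
move=> pf0 la0 v0 w0.
have [i [j Lij]] : exists i, exists j, omega la i j != 0.
  apply: contrapT => H'; case/negP: la0; apply/eqP/matrixP => i j; rewrite mxE.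
  by apply/eqP; apply: contrapT => /negP wij; apply: H'; exists i, j.
suff H mu : v *m omega mu *m w^T = 0.
  apply/rowP => k; have := H (delta_mx 0 k); rewrite -mxbr_omega trmx_delta -colE.
  by move=> /matrixP/(_ 0 0); rewrite !mxE.
set L := omega la in v0 w0 Lij *; set M := omega mu.
have skL : skew L by exact: skew_omega.
have skM : skew M by exact: skew_omega.
(* The mixed term of the Pfaffian of L + M. *)
have polar k l : L i j * M k l + L k l * M i j - L i k * M j l - L j l * M i k
    + L i l * M j k + L j k * M i l = 0.
  have := pf0 (la + mu) i j k l; rewrite omegaD /pfaffian4 !mxE -/L -/M.
  have := pf0 la i j k l; have := pf0 mu i j k l; rewrite /pfaffian4 -/L -/M.
  move=> e1 e2 e3; rewrite -[RHS](subrr 0) -{1}e3 -(addr0 0) -{1}e1 -e2; ring.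
(* Contraction of [polar] with v in the index k; the terms containing v *m L drop out. *)
have E : L i j *: (v *m M) + (v *m M) 0 i *: row j L - (v *m M) 0 j *: row i L = 0.
  apply/rowP => l.
  have vLl k : \sum_s v 0 s * L s k = 0.
    by have /rowP/(_ k) := v0; rewrite !mxE.
  transitivity (\sum_k v 0 k * (L i j * M k l + L k l * M i j - L i k * M j l - L j l * M i k
    + L i l * M j k + L j k * M i l)); last by rewrite mxE big1// => k _; rewrite polar mulr0.
  transitivity (L i j * (\sum_k v 0 k * M k l) + (\sum_k v 0 k * L k l) * M i j
     + (\sum_k v 0 k * L k i) * M j l + (\sum_k v 0 k * M k i) * L j l
     - (\sum_k v 0 k * M k j) * L i l - (\sum_k v 0 k * L k j) * M i l).
    rewrite !vLl !mxE; ring.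
  rewrite mulr_sumr !mulr_suml -!sumrN -!big_split /=; apply: eq_bigr => k _.
  have [-> _] := skL i k; have [-> _] := skL j k.
  have [-> _] := skM i k; have [-> _] := skM j k; ring.
have Lw : L *m w^T = 0.
  apply: trmx_inj; rewrite trmx_mul trmxK trmx0.
  have -> : L^T = - L by apply/matrixP => a b; rewrite !mxE; have [->] := skL a b.
  by rewrite mulmxN w0 oppr0.
have := congr1 (fun y => y *m w^T) E; rewrite mulmxBl mulmxDl mul0mx -!scalemxAl -!row_mul Lw.
rewrite !row0 !scaler0 addr0 subr0 => /eqP; rewrite scaler_eq0 (negPf Lij) /= => /eqP.
by [].
Qed.

Lemma dimle_chart (k : 'I_c) : dimle ([set la | la 0 k = 1] : set (mx_space K 1 c)) (c - 1).
Proof.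
apply: (@dimle_affine _ _ _ (delta_mx k (0 : 'I_1)) (const_mx 1) 1).
- lia.
- by rewrite mxrank_delta.
- by move=> v vk; apply/matrixP => i j; rewrite !ord1 -colE !mxE.
Qed.

Lemma rV_neq0 (la : 'rV[K]_c) : la != 0 -> exists k, la 0 k != 0.
Proof.
move=> la0; apply: contrapT => H; case/negP: la0; apply/eqP/rowP => k; rewrite mxE.
by apply/eqP; apply: contrapT => /negP lak; apply: H; exists k.
Qed.

Hypothesis omega_inj : forall la, omega la = 0 -> la = 0.

Lemma omega_neq0 la : la != 0 -> omega la != 0.
Proof. by apply: contra => /eqP/omega_inj ->. Qed.

Lemma omega_rank_ge2 la : la != 0 -> (2 <= \rank (omega la))%N.
Proof. by move=> /omega_neq0; apply: skew_rank_ge2; exact: skew_omega. Qed.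

End AbnormalVariety.

(** * Two-sheeted covers *)

Section Root.
Variable K : fieldType.

(* Multiplication by t acts on (1, t) through the companion matrix of
   t^2 - be t - ga, so every polynomial in t reduces to degree one. *)
Lemma dimle_quadratic_root (X : cspace K) (T : set X) a (be ga : X -> K)
    (S : set (prod_space X (line_space K))) :
  dimle T a -> ispol be -> ispol ga ->
  (forall x t, S (x, t) -> T x /\ t ^+ 2 = be x * t + ga x) -> dimle S a.
Proof.
move=> [C HC] [D1 beD] [D2 gaD] SP.
(* At least 1, since the coordinates of X must also fit into degree N D. *)
pose D := maxn 1 (maxn D1 D2).
have D1D : (1 <= D)%N by rewrite leq_maxl.
have {}beD : poldeg D be by apply: poldeg_leq beD; rewrite /D; lia.
have {}gaD : poldeg D ga by apply: poldeg_leq gaD; rewrite /D; lia.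
pose vec (t : K) : 'cV[K]_2 := \col_i t ^+ i.
have red N (f : prod_space X (line_space K) -> K) : poldeg N f ->
    exists2 G : X -> 'M[K]_2, forall i j, poldeg (N * D) (fun x => G x i j) &
      forall x t, t ^+ 2 = be x * t + ga x -> f (x, t) *: vec t = G x *m vec t.
  elim=> {N f} [N b|N [i|i]|N f g _ [F FN FE] _ [G GN GE]|M N f g _ [F FN FE] _ [G GN GE]].
  - exists (fun=> b%:M) => [i j|x t _]; last by rewrite mul_scalar_mx.
    exact: poldeg_cst.
  - exists (fun x => (ccoord i x)%:M) => [k j|x t _]; last by rewrite mul_scalar_mx.
    apply: (@poldeg_ext _ _ _ (fun x => if k == j then ccoord i x else 0)).
      by move=> x; rewrite mxE; case: (k == j).
    case: (k == j); last exact: poldeg_cst.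
    by apply: poldeg_leq (poldeg_coord 0 i); rewrite muln_gt0.
  - exists (fun x => \matrix_(i, j) (if i == ord0 then (if j == ord0 then 0 else 1)
                       else (if j == ord0 then ga x else be x))) => [k j|x t tE].
      apply: (@poldeg_ext _ _ _ (fun x => if k == ord0 then (if j == ord0 then 0 else 1)
                       else (if j == ord0 then ga x else be x))) => [x|]; first by rewrite mxE.
      have DN : (D <= N.+1 * D)%N by rewrite leq_pmull.
      by case: eqP => _; case: eqP => _; try exact: poldeg_cst; apply: (poldeg_leq DN).
    apply/colP => -[[|[|//]] hs]; rewrite !mxE big_ord_recl big_ord1 !mxE /=.
      by rewrite mul0r mul1r add0r expr0 expr1 mulr1.
    by rewrite -expr2 !expr1 expr0 mulr1 tE addrC.
  - exists (fun x => F x + G x) => [i j|x t tE].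
      apply: (@poldeg_ext _ _ _ (fun x => F x i j + G x i j)) => [x|]; first by rewrite mxE.
      exact: poldeg_add.
    by rewrite mulmxDl scalerDl FE ?GE.
  - exists (fun x => F x *m G x) => [i j|x t tE].
      apply: (@poldeg_ext _ _ _ (fun x => \sum_k F x i k * G x k j)) => [x|]; first by rewrite mxE.
      by apply: poldeg_sum => k _; rewrite mulnDl; exact: poldeg_mul.
    by rewrite -mulmxA -GE// -scalemxAr -FE// scalerA mulrC.
exists (2 * C * D.+1 ^ a)%N => N; have [I [e [cI He]]] := HC (N * D)%N.
exists (I * bool)%type, (fun (ib : I * bool) (p : X * K) => e ib.1 p.1 * p.2 ^+ ib.2); split.
  rewrite card_prod card_bool mulnC -!mulnA leq_mul2l /= (leq_trans cI)//.
  rewrite leq_mul2l -expnMn; apply/orP; right.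
  have [->|a0] := posnP a; first by rewrite !expn0.
  by rewrite leq_exp2r//; nia.
move=> f /red[G GN GE].
have [u uE] := He _ (GN ord0 ord0); have [v vE] := He _ (GN ord0 (lift ord0 ord0)).
exists (fun ib : I * bool => if ib.2 then v ib.1 else u ib.1) => -[x t] /SP[Tx tE].
have /colP/(_ ord0) := GE x t tE; rewrite !mxE big_ord_recl big_ord1 !mxE /= expr0 !mulr1 => ->.
rewrite uE// vE// expr1 -(pair_bigA _ (fun i (b : bool) => (if b then v i else u i) * (e i x * t ^+ b))) /=.
rewrite mulr_suml -big_split; apply: eq_bigr => i _.
by rewrite big_bool /= expr1 expr0 mulr1 addrC mulrA.
Qed.

End Root.

(** * Center of dimension at most three *)

Section SmallCenter.
Variable K : realFieldType.

(** K need not contain square roots, so roots are picked only if they exist, with possible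
    repetition; three distinct ones would force all coefficients to vanish. *)
Lemma quadratic_roots (a b g : K) : ~~ [&& a == 0, b == 0 & g == 0] ->
  exists t1 t2, forall t, a + b * t + g * t ^+ 2 = 0 -> t = t1 \/ t = t2.
Proof.
move=> abg; pose P t := a + b * t + g * t ^+ 2 = 0.
have [[t1 P1]|noP] := pselect (exists t, P t); last first.
  by exists 0, 0 => t Pt; case: noP; exists t.
have [[t2 [P2 t12]]|noP] := pselect (exists t, P t /\ t != t1); last first.
  exists t1, t1 => t Pt; left; apply/eqP; apply: contrapT => /negP tt1.
  by apply: noP; exists t.
exists t1, t2 => t Pt; apply: contrapT => /not_orP[/eqP tt1 /eqP tt2].
case/negP: abg; move: Pt P1 P2; rewrite /P => Pt P1 P2.
have E1 : b + g * (t2 + t1) = 0.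
  have /eqP : (t2 - t1) * (b + g * (t2 + t1)) = 0 by rewrite -[RHS](subrr 0) -{1}P2 -P1; ring.
  by rewrite mulf_eq0 subr_eq0 (negPf t12) => /eqP.
have E2 : b + g * (t + t1) = 0.
  have /eqP : (t - t1) * (b + g * (t + t1)) = 0 by rewrite -[RHS](subrr 0) -{1}Pt -P1; ring.
  by rewrite mulf_eq0 subr_eq0 (negPf tt1) => /eqP.
have g0 : g = 0.
  have /eqP : (t - t2) * g = 0 by rewrite -[RHS](subrr 0) -{1}E2 -E1; ring.
  by rewrite mulf_eq0 subr_eq0 (negPf tt2) => /eqP.
have b0 : b = 0 by move: E1; rewrite g0 mul0r addr0.
have a0 : a = 0 by move: P1; rewrite g0 b0 !mul0r !addr0.
by rewrite a0 b0 g0 eqxx.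
Qed.

Variables (r c : nat) (B : 'I_c -> 'M[K]_r).
Hypothesis skewB : forall k, skew (B k).
Hypothesis omega_inj : forall la, omega B la = 0 -> la = 0.

Let abn_all := abn B [set la | la != 0].

Lemma abn_charts : abn_all `<=` \bigcup_k abn B [set la | la 0 k = 1].
Proof.
move=> p [la la0 kb]; have [k lak] := rV_neq0 la0; exists k => //.
apply: (@abn_cover K r c B [set la : 'rV[K]_c]); last by exists la.
by move=> _ ->; exists (la 0 k)^-1; rewrite ?invr_eq0//= mxE mulVf.
Qed.

Lemma chart_neq0 (la : 'rV[K]_c) k : la 0 k = 1 -> la != 0.
Proof. by move=> lak; apply/eqP => la0; move: lak; rewrite la0 mxE => /esym/eqP; rewrite oner_eq0. Qed.

Lemma dimle_abn_center1 : c = 1%N -> dimle abn_all (r - 2).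
Proof.
move=> c1; apply: dimle_sub abn_charts _; apply: dimle_bigcup => k.
apply: (@dimle_leq _ _ _ (c - 1 + (r - 2) + (c - 1))); first by rewrite c1 addn0.
apply: (@dimle_abn_form K r c B [set la | la 0 k = 1] _ 2 (dimle_chart K k)) => la lak; have la0 := chart_neq0 lak.
by split => //; exact: omega_rank_ge2.
Qed.

(** If all Pfaffians vanish identically, kernels commute and the count is 2 + 2. Otherwise one of
    them is a nonzero quadratic form q on the space of la: off the conic q = 0 the rank is at least
    three and the count is 2 + 1 + 0, on the conic it is 1 + 2 + 1. *)
Lemma dimle_abn_center3 : c = 3%N -> r = 4%N -> dimle abn_all 4.
Proof.
move=> c3 r4.
have [pf0|] := pselect (forall la i j k l, pfaffian4 (omega B la) i j k l = 0).
  apply: dimle_sub abn_charts _; apply: dimle_bigcup => k.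
  apply: (@dimle_leq _ _ _ (c - 1 + (r - 2))); first by rewrite c3 r4.
  apply: (@dimle_abn_commuting K r c B [set la | la 0 k = 1] _ 2 (dimle_chart K k)) => [la lak|la v w lak]; have la0 := chart_neq0 lak.
    exact: omega_rank_ge2.
  by apply: pfaffian4_abelian => //; exact: omega_neq0.
move=> /existsNP[la0] /existsNP[i] /existsNP[j] /existsNP[k] /existsNP[l] /eqP pf0.
pose q la := pfaffian4 (omega B la) i j k l.
pose bil la mu := omega B la i j * omega B mu k l + omega B la k l * omega B mu i j
  - omega B la i k * omega B mu j l - omega B la j l * omega B mu i k
  + omega B la i l * omega B mu j k + omega B la j k * omega B mu i l.
have qE (mu : 'rV[K]_c) t : q (mu + t *: la0) = q mu + t * bil mu la0 + t ^+ 2 * q la0.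
  by rewrite /q /bil omegaD omegaZ /pfaffian4 !mxE; ring.
have qZ t (mu : 'rV[K]_c) : q (t *: mu) = t ^+ 2 * q mu.
  by rewrite /q omegaZ /pfaffian4 !mxE; ring.
have la00 : la0 != 0.
  apply: contra pf0 => /eqP ->; rewrite /pfaffian4 (_ : omega B 0 = 0) ?mxE; last first.
    by rewrite -(scale0r (0 : 'rV[K]_c)) omegaZ scale0r.
  by rewrite !mul0r subrr addr0.
have [m la0m] := rV_neq0 la00.
(* The conic q = 0 is parametrised by projecting from la0, which is not on it. *)
pose T m' : set (mx_space K 1 c) := [set la | q la = 0 /\ (la != 0 /\
  exists (mu : 'rV[K]_c) (t : K), [/\ la = mu + t *: la0, mu 0 m = 0 & mu 0 m' = 1])].
have cover : abn_all `<=` (\bigcup_k abn B [set la : 'rV[K]_c | la 0 k = 1 /\ q la != 0])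
    `|` \bigcup_(m' in [set m' | m' != m]) abn B (T m').
  move=> p [la la_neq0 kb]; have [qla|qla] := eqVneq (q la) 0; last first.
    left; have [s las] := rV_neq0 la_neq0; exists s => //.
    apply: (@abn_cover K r c B [set la : 'rV[K]_c]); last by exists la.
    move=> _ ->; exists (la 0 s)^-1; rewrite ?invr_eq0//= mxE mulVf//; split => //.
    by rewrite qZ mulf_neq0// expf_neq0// invr_eq0.
  right; pose t := la 0 m / la0 0 m; pose mu := la - t *: la0.
  have mum : mu 0 m = 0 by rewrite !mxE divfK// subrr.
  have laE : la = mu + t *: la0 by rewrite subrK.
  have mu0 : mu != 0.
    apply/eqP => mu0; have := qla; rewrite laE mu0 add0r qZ => /eqP.
    rewrite mulf_eq0 (negPf pf0) orbF expf_eq0 /= => /eqP t0.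
    by case/eqP: la_neq0; rewrite laE mu0 t0 scale0r addr0.
  have [m' mum'] := rV_neq0 mu0; exists m'.
    by rewrite /=; apply: contraNneq mum' => ->; rewrite mum.
  apply: (@abn_cover K r c B [set la : 'rV[K]_c]); last by exists la.
  move=> _ ->; exists (mu 0 m')^-1; rewrite ?invr_eq0//; split; first by rewrite qZ qla mulr0.
  split; first by rewrite scaler_eq0 invr_eq0 negb_or mum'.
  exists ((mu 0 m')^-1 *: mu), ((mu 0 m')^-1 * t); split.
  - by rewrite {1}laE scalerDr scalerA.
  - by rewrite mxE mum mulr0.
  - by rewrite mxE mulVf.
apply: dimle_sub cover _; apply: dimleU.
  apply: dimle_bigcup => s.
  have Ts : dimle ([set la : 'rV[K]_c | la 0 s = 1 /\ q la != 0] : set (mx_space K 1 c)) 2.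
    apply: dimle_sub (_ : dimle ([set la : 'rV[K]_c | la 0 s = 1] : set (mx_space K 1 c)) 2); first by move=> la [].
    by apply: dimle_leq (dimle_chart K s); rewrite c3.
  apply: (@dimle_leq _ _ _ (2 + (r - 3) + 'C(r - 3, 2))); first by rewrite r4.
  apply: (dimle_abn_bracket skewB (rho := 3) Ts) => la [_ qla].
  by apply: pfaffian4_rank_ge3 qla; exact: skew_omega.
apply: (@dimle_sub _ _ _ (\bigcup_m' abn B ((T m' : set 'rV[K]_c) `&` [set _ | m' != m]))).
  by move=> p [m' m'm [la Tla kb]]; exists m' => //; exists la.
apply: dimle_bigcup => m'.
case: (pselect (m' = m)) => [m'm|/eqP m'm].
  by apply: dimle_sub (dimle_set0 _ _) => p [la [_ /=]]; rewrite m'm eqxx.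
pose V : set (mx_space K 1 c) := [set mu | mu 0 m = 0 /\ mu 0 m' = 1].
have Vd : dimle V 1.
  apply: (@dimle_affine _ _ _ (row_mx (delta_mx m' (0 : 'I_1)) (delta_mx m (0 : 'I_1)))
    (row_mx (const_mx 1) 0) 2).
  - by rewrite c3.
  - apply: (leq_ltn_trans _ (rank_row_mx_ltn (v := delta_mx 0 m') _ _)).
    + by rewrite mxrank_delta.
    + by rewrite mul_delta_mx_0.
    + by rewrite mul_delta_mx; apply/eqP => /matrixP/(_ 0 0); rewrite !mxE !eqxx => /eqP; rewrite oner_eq0.
  - move=> mu [mum mum']; rewrite mul_mx_row -!colE; congr row_mx; apply/matrixP => a b.
      by rewrite !ord1 !mxE.
    by rewrite !ord1 !mxE.
have entryP a b : ispol (fun mu : mx_space K 1 c => omega B mu a b).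
  exact: (ispolmx_omega B).
(* Over the affine line V, q (mu + t *: la0) is a quadratic polynomial in t with the constant
   leading coefficient q la0, so the conic is a two-sheeted cover of V. *)
pose S' : set (prod_space (mx_space K 1 c) (line_space K)) :=
  [set p | V p.1 /\ q (p.1 + (p.2 : K) *: la0) = 0].
have S'd : dimle S' 1.
  apply: (dimle_quadratic_root (be := fun mu : mx_space K 1 c => - (q la0)^-1 * bil mu la0)
    (ga := fun mu : mx_space K 1 c => - (q la0)^-1 * q mu) Vd).
  - apply: ispolM; first exact: ispol_cst.
    rewrite /bil; by repeat first [exact: ispol_cst | exact: entryP | apply: ispolD | apply: ispolN | apply: ispolM].
  - apply: ispolM; first exact: ispol_cst.
    by rewrite /q /pfaffian4; repeat first [exact: entryP | apply: ispolD | apply: ispolN | apply: ispolM].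
  move=> mu t [Vmu /=]; rewrite qE => E; split => //.
  have -> : t ^+ 2 = (q la0)^-1 * (t ^+ 2 * q la0) by rewrite mulrCA mulVf ?mulr1.
  have -> : t ^+ 2 * q la0 = - q mu - t * bil mu la0.
    by rewrite -[RHS]addr0 -E; ring.
  ring.
have Td : dimle (T m' `&` [set _ | m' != m] : set (mx_space K 1 c)) 1.
  apply: (dimle_image (F := fun p : prod_space (mx_space K 1 c) (line_space K) =>
     (p.1 + (p.2 : K) *: la0 : mx_space K 1 c))) S'd _ => [[a b]|la [[qla [_ [mu [t [laE mum mum']]]]] _]].
    apply: (@ispol_ext _ _ (fun p : prod_space (mx_space K 1 c) (line_space K) => p.1 a b + p.2 * la0 a b)).
      by move=> p; rewrite /= !mxE.
    apply: ispolD; first exact: (@ispol_coord _ (prod_space (mx_space K 1 c) (line_space K)) (inl (a, b))).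
    apply: ispolM; last exact: ispol_cst.
    exact: (@ispol_coord _ (prod_space (mx_space K 1 c) (line_space K)) (inr tt)).
  by exists (mu, t) => //; split; rewrite /= -?laE.
apply: (@dimle_leq _ _ _ (1 + (r - 2) + 'C(r - 2, 2))); first by rewrite r4.
apply: (dimle_abn_bracket skewB (rho := 2) Td).
by move=> la [[_ [la_neq0 _]] _]; exact: omega_rank_ge2.
Qed.

End SmallCenter.

(** * Center of dimension two *)

Section Center2.
Variables (K : realFieldType).

(** One representative for each point of the projective line: an affine chart and the point at
    infinity. *)
Definition proj_line : set 'rV[K]_2 := [set s : 'rV[K]_2 | s 0 ord0 = 1] `|` [set delta_mx 0 ord_max].

Lemma rV2_ext (s s' : 'rV[K]_2) : s 0 ord0 = s' 0 ord0 -> s 0 ord_max = s' 0 ord_max -> s = s'.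
Proof.
move=> e0 e1; apply/rowP => -[[|[|//]] hk]; [move: e0|move: e1];
  by congr (s 0 _ = s' 0 _); exact: val_inj.
Qed.

Lemma proj_line_cover (s : 'rV[K]_2) : s != 0 -> exists2 t, t != 0 & proj_line (t *: s).
Proof.
move=> s0; have [s00|s00] := eqVneq (s 0 ord0) 0; last first.
  by exists (s 0 ord0)^-1; rewrite ?invr_eq0//; left; rewrite /= mxE mulVf.
have s01 : s 0 ord_max != 0.
  by apply: contra s0 => /eqP s01; apply/eqP/rV2_ext; rewrite mxE.
exists (s 0 ord_max)^-1; rewrite ?invr_eq0//; right; apply: rV2_ext; rewrite !mxE /=.
  by rewrite s00 mulr0.
by rewrite mulVf.
Qed.

Lemma proj_line_neq0 s : proj_line s -> s != 0.
Proof.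
move=> [s0|->]; first exact: chart_neq0 s0.
by apply/eqP => /rowP/(_ ord_max); rewrite !mxE /= => /eqP; rewrite oner_eq0.
Qed.

Lemma dimle_proj_line : dimle (proj_line : set (mx_space K 1 2)) 1.
Proof. by apply: dimleU; [exact: (dimle_chart K ord0)|exact: dimle_point]. Qed.

Variables (r : nat) (B : 'I_2 -> 'M[K]_r).
Hypothesis skewB : forall k, skew (B k).
Hypothesis omega_inj : forall la, omega B la = 0 -> la = 0.

(** Three ways to reach r - 1: all forms of rank two, 1 + (r - 2) with commuting kernels; rank at
    least three, 1 + (r - 3) + 1; and finitely many points of rank two, 0 + (r - 2) + 1. *)
Lemma dimle_abn_center2 : (2 <= r)%N -> dimle (abn B [set la | la != 0]) (r - 1).
Proof.
move=> r2; apply: dimle_sub (abn_cover (@proj_line_cover)) _.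
have [pf0|] := pselect (forall la i j k l, pfaffian4 (omega B la) i j k l = 0).
  have -> : (r - 1 = 1 + (r - 2))%N by lia.
  apply: (@dimle_abn_commuting K r 2 B proj_line 1 2 dimle_proj_line) => [la /proj_line_neq0 la0|la v w /proj_line_neq0 la0].
    exact: omega_rank_ge2.
  by apply: pfaffian4_abelian => //; exact: omega_neq0.
move=> /existsNP[la0] /existsNP[i] /existsNP[j] /existsNP[k] /existsNP[l] /eqP pf0.
pose q la := pfaffian4 (omega B la) i j k l.
pose e0 : 'rV[K]_2 := delta_mx 0 ord0; pose e1 : 'rV[K]_2 := delta_mx 0 ord_max.
pose bb := q (e0 + e1) - q e0 - q e1.
have qE s t : q (s *: e0 + t *: e1) = s ^+ 2 * q e0 + s * t * bb + t ^+ 2 * q e1.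
  rewrite /bb /q !omegaD !omegaZ /pfaffian4 !mxE; ring.
have laE (la : 'rV[K]_2) : la = la 0 ord0 *: e0 + la 0 ord_max *: e1.
  by apply: rV2_ext; rewrite !mxE /= ?mulr1 ?mulr0 ?addr0 ?add0r.
have [t1 [t2 roots]] : exists t1 t2, forall t, q e0 + bb * t + q e1 * t ^+ 2 = 0 -> t = t1 \/ t = t2.
  apply: quadratic_roots; apply: contra pf0 => /and3P[/eqP a0 /eqP b0 /eqP g0].
  by rewrite -/(q la0) (laE la0) qE a0 b0 g0 !mulr0 !addr0.
pose good : set 'rV[K]_2 := [set la | proj_line la /\ (3 <= \rank (omega B la))%N].
(* Rank two forces q = 0: in the affine chart at most two roots, to which the point at infinity is
   added. *)
pose bad : set 'rV[K]_2 := [set e0 + t1 *: e1] `|` [set e0 + t2 *: e1] `|` [set e1].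
have cover : proj_line `<=` good `|` bad `&` [set la | la != 0].
  move=> la Tla; have la_neq0 := proj_line_neq0 Tla.
  have [rk|rk] := leqP 3 (\rank (omega B la)); [by left|right; split => //].
  have qla : q la = 0.
    apply/eqP/negP => /negP qla; move: rk; rewrite ltnNge.
    by rewrite (pfaffian4_rank_ge3 (skew_omega skewB la) qla).
  case: Tla => [la1|->]; last by right.
  rewrite /= in la1; move: qla; rewrite (laE la) qE la1 expr1n !mul1r scale1r => qla.
  have /roots[->|->] : q e0 + bb * la 0 ord_max + q e1 * la 0 ord_max ^+ 2 = 0.
  - by rewrite -[RHS]qla; ring.
  - by left; left.
  - by left; right.
apply: (@dimle_sub _ _ _ (abn B good `|` abn B (bad `&` [set la | la != 0]))).
  move=> p [la /cover[gla|bla] kb]; [left|right]; by exists la.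
apply: dimleU.
  have gd : dimle (good : set (mx_space K 1 2)) 1.
    by apply: dimle_sub dimle_proj_line => la [].
  (* For r = 2 the truncated r - 3 would spoil the count, but then no form has rank three. *)
  have [r3|r3] := leqP 3 r; last first.
    apply: dimle_sub (dimle_set0 _ _) => p [la [_ rk] _].
    by move: (leq_trans rk (rank_leq_row _)); rewrite leqNgt r3.
  apply: dimle_leq _ (dimle_abn_form (B := B) (rho := 3) gd _); first by lia.
  by move=> la [/proj_line_neq0].
have bd : dimle (bad `&` [set la | la != 0] : set (mx_space K 1 2)) 0.
  apply: (@dimle_sub _ _ _ (bad : set (mx_space K 1 2))) => [la []//|].
  by apply: dimleU; [apply: dimleU|]; exact: dimle_point.
apply: dimle_leq _ (dimle_abn_form (B := B) (rho := 2) bd _); first by lia.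
by move=> la [_ /= la_neq0]; split => //; exact: omega_rank_ge2.
Qed.

End Center2.

(** * Decomposable forms and pencils *)

Section Gauge.
Variable K : realFieldType.

(** An affine chart of the Grassmannian of p-dimensional subspaces of K^r, hence the number p (r -
    p). *)
Lemma dimle_identity_rows r p (f : 'I_p -> 'I_r) :
  dimle ([set A | rowsub f A = 1%:M] : set (mx_space K r p)) (p * (r - p)).
Proof.
have [[A0 A01]|noA] := pselect (exists A0 : 'M[K]_(r, p), rowsub f A0 = 1%:M); last first.
  by apply: dimle_sub (dimle_set0 _ _) => A A1; apply: noA; exists A.
pose F : 'M[K]_(p, r) := rowsub f 1%:M.
have FA n (A : 'M[K]_(r, n)) : F *m A = rowsub f A by rewrite mul_rowsub_mx mul1mx.
have rF : (p <= \rank F)%N.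
  by rewrite -[X in (X <= _)%N](mxrank1 K) -A01 -FA mxrankM_maxl.
pose N := row_base (kermx F^T).
have rN : (\rank (kermx F^T) <= r - p)%N by rewrite mxrank_ker mxrank_tr leq_sub2l.
apply: (@dimle_leq _ _ _ (p * \rank (kermx F^T))); first by rewrite leq_mul2l rN orbT.
apply: (dimle_image (F := fun Y : mx_space K p (\rank (kermx F^T)) =>
   (A0 + (Y *m N)^T : mx_space K r p))) (dimle_mx setT) _ => [[i j]|A /= A1].
  suff H : ispolmx (fun Y : mx_space K p (\rank (kermx F^T)) => A0 + (Y *m N)^T) by exact: H.
  apply: ispolmxD; first exact: ispolmx_cst.
  by apply: ispolmx_tr; apply: ispolmxM; [exact: ispolmx_id|exact: ispolmx_cst].
have /submxP[Y YE] : ((A - A0)^T <= N)%MS.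
  by rewrite eq_row_base; apply/sub_kermxP; rewrite -trmx_mul FA linearB /= A1 A01 subrr trmx0.
by exists Y => //; rewrite -YE trmxK addrC subrK.
Qed.

(** Three independent combinations of the columns of w, normalised by inverting a 3 x 3 block. The
    kernel of w only grows, and the choice is now a point of a Grassmannian chart. *)
Lemma three_columns r m (w : 'M[K]_(r, m)) : (3 <= \rank w)%N ->
  exists (f : {ffun 'I_3 -> 'I_r}) (A : 'M[K]_(r, 3)), rowsub f A = 1%:M /\
    forall v : 'rV_r, v *m w = 0 -> v *m A = 0.
Proof.
move=> w3; pose P := (pid_mx 3 : 'M[K]_(3, \rank w^T)) *m row_base w^T.
have rP : \rank P^T = 3%N.
  by rewrite mxrank_tr mxrankMfree ?row_base_free// rank_pid_mx// mxrank_tr.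
have Pfull : row_full P^T by rewrite /row_full rP.
pose f := fullrankfun Pfull; have uf := fullrowsub_unit Pfull.
exists [ffun i => f i], (P^T *m invmx (rowsub f P^T)); split.
  rewrite -[RHS](mulmxV uf) -mul_rowsub_mx; congr (_ *m _).
  by apply/matrixP => i j; rewrite !mxE ffunE.
move=> v vw; rewrite mulmxA; suff -> : v *m P^T = 0 by rewrite mul0mx.
have /submxP[Y ->] : (P <= w^T)%MS by rewrite -(eq_row_base w^T) submxMl.
by rewrite trmx_mul trmxK mulmxA vw mul0mx.
Qed.

Definition gauge_mx r (i j : 'I_r) l (N : 'M[K]_(r, l)) :=
  row_mx (delta_mx j (0 : 'I_1)) (row_mx (delta_mx i (0 : 'I_1)) N).

(* Each plane on which the coordinates i and j are independent has exactly one
   basis (a, b) of this form. *)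
Definition gauge_rows r (i j : 'I_r) (a b : 'rV[K]_r) :=
  [/\ a 0 i = 1, a 0 j = 0, b 0 i = 0 & b 0 j = 1].

Lemma mul_gauge_mx r (i j : 'I_r) l (N : 'M[K]_(r, l)) (v : 'rV[K]_r) x y :
  v 0 j = x -> v 0 i = y -> v *m N = 0 ->
  v *m gauge_mx i j N = row_mx (const_mx x) (row_mx (const_mx y) 0).
Proof.
move=> vj vi vN; rewrite !mul_mx_row -!colE vN; congr (row_mx _ (row_mx _ _));
  by apply/matrixP => s t; rewrite !ord1 !mxE.
Qed.

Lemma mul_delta1 r (v : 'rV[K]_r) i : v *m delta_mx i (0 : 'I_1) = const_mx (v 0 i).
Proof. by apply/matrixP => s t; rewrite !ord1 -colE !mxE. Qed.

Lemma const_mx1_neq0 : const_mx 1 != 0 :> 'M[K]_1.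
Proof. by apply/eqP => /matrixP/(_ 0 0)/eqP; rewrite !mxE oner_eq0. Qed.

(** Each added column raises the rank: a is killed by N but not by e_i, and b is killed by N and e_i
    but not by e_j. *)
Lemma rank_gauge_mx r (i j : 'I_r) l (N : 'M[K]_(r, l)) a b :
  gauge_rows i j a b -> a *m N = 0 -> b *m N = 0 ->
  (\rank N + 2 <= \rank (gauge_mx i j N))%N.
Proof.
move=> [ai aj bi bj] aN bN; rewrite addn2.
have c0 : const_mx 0 = 0 :> 'M[K]_1 by apply/matrixP => s t; rewrite !mxE.
apply: (@leq_ltn_trans (\rank (row_mx (delta_mx i (0 : 'I_1)) N))).
  by apply: (rank_row_mx_ltn (v := a)) => //; rewrite mul_delta1 ai const_mx1_neq0.
apply: (rank_row_mx_ltn (v := b)); last by rewrite mul_delta1 bj const_mx1_neq0.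
by rewrite mul_mx_row mul_delta1 bi bN c0 row_mx0.
Qed.

Lemma ispolmx_gauge_mx (X : cspace K) r (i j : 'I_r) l (N : X -> 'M[K]_(r, l)) :
  ispolmx N -> ispolmx (fun x => gauge_mx i j (N x)).
Proof.
move=> NP; apply: ispolmx_row; first exact: ispolmx_cst.
by apply: ispolmx_row => //; exact: ispolmx_cst.
Qed.

Lemma gauge_rows_delta r (i j : 'I_r) : i != j -> gauge_rows i j (delta_mx 0 i) (delta_mx 0 j).
Proof.
by move=> ij; split; rewrite !mxE ?eqxx//= ?[j == i]eq_sym (negPf ij).
Qed.

Lemma gauge_rows_neq r (i j : 'I_r) a b : gauge_rows i j a b -> i != j.
Proof.
move=> [ai aj _ _]; apply/eqP => ij; move: ai; rewrite ij aj => /esym/eqP.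
by rewrite oner_eq0.
Qed.

Lemma dimle_gauge_fiber r (i j : 'I_r) l (N : 'rV[K]_r -> 'M[K]_(r, l)) (U : set (mx_space K 1 r))
    m rho d (S : set (prod_space (mx_space K 1 r) (mx_space K 1 r))) :
  dimle U m -> ispolmx (N : mx_space K 1 r -> _) -> (m + r <= d + (rho + 2))%N ->
  (forall a b, S (a, b) -> [/\ U a, gauge_rows i j a b, a *m N a = 0,
     b *m N a = 0 & (rho <= \rank (N a))%N]) -> dimle S d.
Proof.
move=> Um NP md SP.
apply: (@dimle_affine_fiber K (mx_space K 1 r) U m r _ (fun a => gauge_mx i j (N a))
  (fun=> row_mx (const_mx 1) (row_mx (const_mx 0) 0)) (rho + 2)) Um _ _ md _.
- exact: ispolmx_gauge_mx.
- exact: ispolmx_cst.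
move=> a b /SP[Ua gab aN bN rk]; split => //; first by apply: mul_gauge_mx => //; case: gab.
by apply: leq_trans (rank_gauge_mx gab aN bN); rewrite leq_add2r.
Qed.

Lemma dimle_gauge_free r (i j : 'I_r) : i != j ->
  dimle ([set a : 'rV[K]_r | a 0 i = 1 /\ a 0 j = 0] : set (mx_space K 1 r)) (r - 2).
Proof.
move=> ij; apply: (@dimle_affine _ _ _ (gauge_mx i j (0 : 'M[K]_(r, 1)))
  (row_mx (const_mx 0) (row_mx (const_mx 1) 0)) 2).
- lia.
- by have := rank_gauge_mx (gauge_rows_delta ij) (mulmx0 1 (delta_mx 0 i)) (mulmx0 1 _); rewrite mxrank0.
- by move=> a [ai aj]; apply: mul_gauge_mx => //; rewrite mulmx0.
Qed.

Lemma dimle_gauge_kernel r (i : 'I_r) l (N : 'M[K]_(r, l)) rho (U : set (mx_space K 1 r)) :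
  (rho <= \rank N)%N -> (forall a, U a -> a 0 i = 1 /\ a *m N = 0) -> dimle U (r - rho.+1).
Proof.
move=> rk UP; have [->|/set0P[a0 Ua0]] := eqVneq U set0; first exact: dimle_set0.
apply: (@dimle_affine _ _ _ (row_mx (delta_mx i (0 : 'I_1)) N) (row_mx (const_mx 1) 0) rho.+1).
- lia.
- have [a0i a0N] := UP _ Ua0; apply: leq_ltn_trans rk _.
  by apply: (rank_row_mx_ltn (v := a0)) => //; rewrite mul_delta1 a0i const_mx1_neq0.
- by move=> a /UP[ai aN]; rewrite mul_mx_row mul_delta1 ai aN.
Qed.

Let two_neq0 : 2%:R != 0 :> K. Proof. by rewrite pnatr_eq0. Qed.

(** A chart of the planes isotropic for all the W k, of expected dimension 2 (r - 2) - d. *)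
Definition gauge_pairs r (i j : 'I_r) d (W : 'I_d -> 'M[K]_r) :
    set (prod_space (mx_space K 1 r) (mx_space K 1 r)) :=
  [set p | gauge_rows i j p.1 p.2 /\ forall k, p.1 *m W k *m p.2^T = 0].

Lemma mul_row_form r (W : 'M[K]_r) (a b : 'rV[K]_r) : a *m W *m b^T = 0 -> b *m (a *m W)^T = 0.
Proof. by move=> ab; apply: trmx_inj; rewrite trmx_mul trmxK ab trmx0. Qed.

(** Generically a has r - 2 parameters and b has r - 3. If a lies in the kernel of W 0, b gains one
    parameter, but a loses at least one. *)
Lemma dimle_gauge_pairs1 r (i j : 'I_r) (W : 'I_1 -> 'M[K]_r) :
  (3 <= r)%N -> skew (W 0) -> W 0 != 0 -> dimle (gauge_pairs i j W) (2 * r - 5).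
Proof.
move=> r3 skW W0; have rW := skew_rank_ge2 skW W0.
have [ij|ij] := eqVneq i j.
  by apply: dimle_sub (dimle_set0 _ _) => p [/gauge_rows_neq/eqP].
pose S1 := gauge_pairs i j W `&` [set p | p.1 *m W 0 != 0].
pose S2 := gauge_pairs i j W `&` [set p | p.1 *m W 0 = 0].
apply: (@dimle_sub _ _ _ (S1 `|` S2)).
  by move=> p Wp; have [H|H] := eqVneq (p.1 *m W 0) 0; [right|left].
apply: dimleU.
  apply: (@dimle_gauge_fiber r i j 1 (fun a => (a *m W 0)^T) _ _ 1 _ _ (dimle_gauge_free ij)).
  - by apply: ispolmx_tr; apply: ispolmxM; [exact: ispolmx_id|exact: ispolmx_cst].
  - lia.
  move=> a b [[gab ab] /= aW]; split => //.
  - by case: gab.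
  - by apply: mul_row_form; exact: skew_form0.
  - by apply: mul_row_form; exact: ab.
  - by rewrite mxrank_tr lt0n mxrank_eq0.
have U2 : dimle ([set a : 'rV[K]_r | a 0 i = 1 /\ a *m W 0 = 0] : set (mx_space K 1 r)) (r - 3).
  exact: (dimle_gauge_kernel (i := i) rW).
apply: (@dimle_gauge_fiber r i j 1 (fun a => 0) _ _ 0 _ _ U2).
- exact: ispolmx_cst.
- lia.
by move=> a b [[gab ab] /= aW]; split; rewrite ?mulmx0//; case: gab.
Qed.

End Gauge.

(** * Planes isotropic for a pencil of skew forms *)

Section Pencil.
Variables (K : realFieldType) (r : nat) (W : 'I_2 -> 'M[K]_r).
Hypothesis skewW : forall k, skew (W k).
Hypothesis W_inj : forall s, omega W s = 0 -> s = 0.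

Let two_neq0 : 2%:R != 0 :> K. Proof. by rewrite pnatr_eq0. Qed.

Lemma omega2E s : omega W s = s 0 ord0 *: W ord0 + s 0 ord_max *: W ord_max.
Proof.
by rewrite /omega big_ord_recl big_ord1; congr (_ + s 0 _ *: W _); exact: val_inj.
Qed.

(** If the common kernel had codimension at most two, both forms would come from a quotient of
    dimension at most two, on which skew forms are proportional. *)
Lemma pencil_rank_ge3 : (3 <= \rank (row_mx (W ord0) (W ord_max)))%N.
Proof.
have W0 : W ord0 != 0.
  apply/eqP => W0; have : omega W (delta_mx 0 ord0) = 0.
    by rewrite omega2E !mxE /= W0 scaler0 scale0r addr0.
  by move=> /W_inj /rowP/(_ ord0)/eqP; rewrite !mxE eqxx oner_eq0.
have [k [l wkl]] : exists k, exists l, W ord0 k l != 0.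
  apply: contrapT => H'; case/negP: W0; apply/eqP/matrixP => i j; rewrite mxE.
  by apply/eqP; apply: contrapT => /negP wij; apply: H'; exists i, j.
rewrite leqNgt; apply/negP => rk.
have [wlk wkk] := skewW ord0 k l; have [_ wll] := skewW ord0 l k.
have dep m : exists ab : K * K, forall d n, W d m n = ab.1 * W d k n + ab.2 * W d l n.
  apply: contrapT => nodep; move: rk; rewrite ltnNge => /negP; apply.
  apply: (@rank_ge3 _ _ _ _ k l m) => a b c abc.
  have abc0 n : a * W ord0 k n + b * W ord0 l n + c * W ord0 m n = 0.
    by have := abc (lshift r n); rewrite !row_mxEl.
  have abc1 n : a * W ord_max k n + b * W ord_max l n + c * W ord_max m n = 0.
    by have := abc (rshift r n); rewrite !row_mxEr.
  have c0 : c = 0.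
    apply: contrapT => /eqP c0; apply: nodep; exists (- a / c, - b / c) => d n /=.
    have : a * W d k n + b * W d l n + c * W d m n = 0.
      by case: d => -[|[|//]] hd; [move: (abc0 n)|move: (abc1 n)];
        congr (_ * W _ _ _ + _ * W _ _ _ + _ * W _ _ _ = _); exact: val_inj.
    move=> E; apply: (mulfI c0).
    have -> : c * W d m n = - (a * W d k n) - b * W d l n by rewrite -[LHS]subr0 -E; ring.
    by field.
  move: (abc0 k) (abc0 l); rewrite c0 wkk wll wlk !mul0r !addr0 !mulr0 add0r addr0 mulrN.
  move=> /eqP; rewrite oppr_eq0 mulf_eq0 (negPf wkl) orbF => /eqP -> /eqP.
  by rewrite mulf_eq0 (negPf wkl) orbF => /eqP ->.
have [ab abE] := choice dep.
have WE d m n : W d m n = ((ab m).1 * (ab n).2 - (ab m).2 * (ab n).1) * W d k l.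
  rewrite abE; have [-> _] := skewW d n k; have [-> _] := skewW d n l.
  rewrite !(abE n); have [-> _] := skewW d k l.
  have [_ ->] := skewW d k k; have [_ ->] := skewW d l l; ring.
(* Both forms are the same matrix times their entry (k, l), so this combination cancels. *)
pose s : 'rV[K]_2 := \row_i (if i == ord0 then W ord_max k l else - W ord0 k l).
have /W_inj/rowP/(_ ord_max)/eqP : omega W s = 0.
  apply/matrixP => m n; rewrite omega2E !mxE /= (WE ord0 m n) (WE ord_max m n); ring.
by rewrite !mxE /= oppr_eq0 (negPf wkl).
Qed.

Variables (i j : 'I_r).

Definition bad (s : 'rV[K]_2) := forall k l, k != j -> l != j -> omega W s k l = 0.

(** For such s the equations a_j = 0 and a *m omega W s = 0 impose at least three conditions; for a
    bad form they impose at most two. *)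
Lemma not_bad_rank s : ~ bad s -> (3 <= \rank (row_mx (delta_mx j (0%R : 'I_1)) (omega W s)))%N.
Proof.
move=> /existsNP[k] /existsNP[l] /not_implyP[kj] /not_implyP[lj /eqP wkl].
have skw : skew (omega W s) by exact: skew_omega.
have [wlk wkk] := skw k l; have [_ wll] := skw l k.
apply: (@rank_ge3 _ _ _ _ j k l) => a b c abc.
have a0 : a = 0.
  have := abc (lshift r 0); rewrite !row_mxEl !mxE !eqxx (negPf kj) (negPf lj) /=.
  by rewrite mulr1 !mulr0 !addr0.
have := abc (rshift 1 k); have := abc (rshift 1 l); rewrite !row_mxEr a0 wkk wll wlk.
rewrite !mul0r !mulr0 !addr0 !add0r mulrN => /eqP.
rewrite mulf_eq0 (negPf wkl) orbF => /eqP b0 /eqP.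
by rewrite oppr_eq0 mulf_eq0 (negPf wkl) orbF => /eqP c0.
Qed.

(* A bad form is e_j /\ c for some c. *)
Lemma bad_kernel s a b : bad s -> gauge_rows i j a b -> a *m omega W s *m b^T = 0 ->
  a *m omega W s = 0.
Proof.
move=> bs [_ aj _ bj] ab; have skw : skew (omega W s) by exact: skew_omega.
have aE l : l != j -> (a *m omega W s) 0 l = 0.
  move=> lj; rewrite mxE big1// => k _; have [->|kj] := eqVneq k j.
    by rewrite aj mul0r.
  by rewrite bs ?mulr0.
apply/rowP => l; rewrite [RHS]mxE; have [->|/aE//] := eqVneq l j.
move/matrixP: ab => /(_ 0 0); rewrite mxE (bigD1 j) //= big1 => [|l' /aE ->]; last by rewrite mul0r.
by rewrite !mxE bj mulr1 addr0.
Qed.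

Let N (a : 'rV[K]_r) := row_mx (a *m W ord0)^T (a *m W ord_max)^T.

(** The columns of N a are the conditions on b. When they are dependent, a lies in the kernel of a
    member of the pencil. *)
Lemma pencil_strata a : (2 <= \rank (N a))%N \/ N a = 0 \/
  N a != 0 /\ exists2 s, proj_line s & a *m omega W s = 0.
Proof.
have [rk|rk] := leqP 2 (\rank (N a)); [by left|right].
have [Na|Na] := eqVneq (N a) 0; [by left|right; split => //].
have : kermx (N a)^T != 0.
  by rewrite kermx_eq0 /row_free mxrank_tr neq_ltn rk.
move=> /rowV0Pn[u /sub_kermxP uN /proj_line_cover[t t0 lu]]; exists (t *: u) => //.
rewrite omegaZ -scalemxAr omega2E mulmxDr -!scalemxAr.
suff -> : u 0 ord0 *: (a *m W ord0) + u 0 ord_max *: (a *m W ord_max) = 0 by rewrite scaler0.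
have : u *m (N a)^T = 0 by [].
rewrite tr_row_mx !trmxK.
have {1}-> : u = row_mx (const_mx (u 0 ord0) : 'M[K]_1) (const_mx (u 0 ord_max) : 'M[K]_1).
  apply/rowP => -[[|[|//]] hs]; rewrite mxE; case: splitP => t' //= ht; rewrite ?mxE;
    try (by congr (u 0 _); exact: val_inj); by case: t' ht => -[|//].
rewrite mul_row_col => <-; congr (_ + _);
  by apply/rowP => l; rewrite !mxE big_ord1 !mxE.
Qed.

(** The strata of N a of rank two, zero and one contribute (r - 2) + (r - 4), (r - 4) + (r - 2) and
    (r - 3) + (r - 3). The delicate point is that a has only r - 3 parameters in the last one. *)
Lemma dimle_gauge_pairs2 : (4 <= r)%N -> dimle (gauge_pairs i j W) (2 * r - 6).
Proof.
move=> r4; have [ij|ij] := eqVneq i j.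
  by apply: dimle_sub (dimle_set0 _ _) => p [/gauge_rows_neq/eqP].
have NP : ispolmx (N : mx_space K 1 r -> _).
  by apply: ispolmx_row; apply: ispolmx_tr; apply: ispolmxM; (exact: ispolmx_id || exact: ispolmx_cst).
have gN a b : gauge_pairs i j W (a, b) -> a *m N a = 0 /\ b *m N a = 0.
  move=> [_ /= ab]; rewrite !mul_mx_row; split.
    by rewrite !mul_row_form ?row_mx0//; exact: skew_form0.
  by rewrite !mul_row_form ?row_mx0.
pose G := gauge_pairs i j W.
pose S2 := G `&` [set p | (2 <= \rank (N p.1))%N].
pose S0 := G `&` [set p | N p.1 = 0].
pose S1 := G `&` [set p | N p.1 != 0 /\ exists2 s, proj_line s & p.1 *m omega W s = 0].
apply: (@dimle_sub _ _ _ (S2 `|` S0 `|` S1)).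
  move=> p Gp; have [H|[H|H]] := pencil_strata p.1; by [left; left|left; right|right].
apply: dimleU; first apply: dimleU.
- apply: (@dimle_gauge_fiber _ r i j _ N _ _ 2 _ _ (dimle_gauge_free K ij) NP); first lia.
  move=> a b [Gab rk]; have [aN bN] := gN _ _ Gab; case: Gab => gab _.
  by split => //; case: gab.
- have U0 : dimle ([set a : 'rV[K]_r | a 0 i = 1 /\ N a = 0] : set (mx_space K 1 r)) (r - 4).
    apply: (dimle_gauge_kernel (i := i) pencil_rank_ge3) => a [ai Na]; split => //.
    move: Na; rewrite /N mul_mx_row -[0](row_mx0 _ r 1 1) => /eq_row_mx[e0 e1].
    by rewrite -[a *m _]trmxK e0 -[a *m W ord_max]trmxK e1 !trmx0 row_mx0.
  apply: (@dimle_gauge_fiber _ r i j _ N _ _ 0 _ _ U0 NP); first lia.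
  move=> a b [Gab Na]; have [aN bN] := gN _ _ Gab; case: Gab => gab _.
  by split => //; split => //; case: gab.
pose U1 : set (mx_space K 1 r) := [set a | exists2 b, G (a, b) & S1 (a, b)].
have U1d : dimle U1 (r - 3); last first.
  apply: (@dimle_gauge_fiber _ r i j _ N _ _ 1 _ _ U1d NP); first lia.
  move=> a b S1ab; have [Gab [Na _]] := S1ab; have [aN bN] := gN _ _ Gab; split => //.
  - by exists b.
  - by case: Gab.
  - by rewrite lt0n mxrank_eq0.
(* For each s that is not bad, a satisfies four independent conditions, so one parameter for s and r
   - 4 for a. *)
pose Ugood : set (mx_space K 1 r) :=
  [set a : 'rV[K]_r | (a 0 i = 1 /\ a 0 j = 0) /\ exists2 s, (proj_line s /\ ~ bad s) & a *m omega W s = 0].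
have Ugoodd : dimle Ugood (r - 3).
  pose S' : set (prod_space (mx_space K 1 2) (mx_space K 1 r)) :=
    [set p | ((proj_line p.1 /\ ~ bad p.1) /\ p.2 *m omega W p.1 = 0) /\ (p.2 0 i = 1 /\ p.2 0 j = 0)].
  apply: (@dimle_forget1 _ _ _ S'); last by move=> a [aij [s ls aw]]; exists s.
  have Ld : dimle ([set s | proj_line s /\ ~ bad s] : set (mx_space K 1 2)) 1.
    by apply: dimle_sub (dimle_proj_line K) => s [].
  apply: (@dimle_affine_fiber _ (mx_space K 1 2) _ _ r _ (fun s => row_mx (delta_mx i (0 : 'I_1))
    (row_mx (delta_mx j (0 : 'I_1)) (omega W s)))
    (fun=> row_mx (const_mx 1) (row_mx (const_mx 0) 0)) 4 _ _ Ld).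
  - apply: ispolmx_row; first exact: ispolmx_cst.
    by apply: ispolmx_row; [exact: ispolmx_cst|exact: ispolmx_omega].
  - exact: ispolmx_cst.
  - lia.
  move=> s a [[[ls nbs] /= aw] [ai aj]]; split => //.
    by rewrite !mul_mx_row !mul_delta1 ai aj aw.
  apply: leq_ltn_trans (not_bad_rank nbs) _; apply: (rank_row_mx_ltn (v := a)).
    rewrite mul_mx_row mul_delta1 aj aw (_ : const_mx 0 = 0) ?row_mx0//.
  by rewrite mul_delta1 ai const_mx1_neq0.
(* A single bad s0 already settles the stratum: isotropy then puts a in the fixed kernel of omega W
   s0, whichever member of the pencil kills a. *)
have [[s0 [ls0 bs0]]|nobad] := pselect (exists s, proj_line s /\ bad s); last first.
  apply: dimle_sub Ugoodd => a [b [gab ab] [_ [_ [s ls aw]]]]; split; first by case: gab.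
  by exists s => //; split => // bs; apply: nobad; exists s.
have U0d : dimle ([set a : 'rV[K]_r | a 0 i = 1 /\ a *m omega W s0 = 0] : set (mx_space K 1 r)) (r - 3).
  apply: (dimle_gauge_kernel (i := i) (N := omega W s0) (rho := 2)) => //.
  by apply: omega_rank_ge2 => //; exact: proj_line_neq0.
apply: dimle_sub U0d => a [b [gab /= ab] _]; split; first by case: gab.
have ab' s' : a *m omega W s' *m b^T = 0.
  by rewrite omega2E mulmxDr mulmxDl -!scalemxAr -!scalemxAl !ab !scaler0 addr0.
exact: bad_kernel bs0 gab (ab' s0).
Qed.

End Pencil.

(** * Center of codimension at most two in the second exterior power *)

Section LargeCenter.
Variables (K : realFieldType) (r c : nat) (B : 'I_c -> 'M[K]_r).
Hypothesis skewB : forall k, skew (B k).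

(** la has too many parameters here, so it is replaced by three covectors vanishing on its kernel,
    that is by 3 (r - 3) parameters. *)
Lemma dimle_abn_rank3 : dimle (abn B [set la | (3 <= \rank (omega B la))%N])
  (3 * (r - 3) + (r - 3) + 'C(r - 3, 2)).
Proof.
pose S f : set (prod_space (mx_space K 1 r) (mx_space K 1 c)) :=
  [set p | exists A : 'M[K]_(r, 3), rowsub f A = 1%:M /\ kernel_bracket B A p.1 p.2].
apply: (@dimle_sub _ _ _ (\bigcup_(f : {ffun 'I_3 -> 'I_r}) S f)).
  move=> p [la /three_columns[f [A [A1 kA]]] kb]; exists f => //; exists A; split => //.
  exact: kernel_bracket_mono kb.
apply: dimle_bigcup => f.
pose S' : set (prod_space (prod_space (mx_space K r 3) (mx_space K 1 r)) (mx_space K 1 c)) :=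
  [set p | rowsub f p.1.1 = 1%:M /\ kernel_bracket B p.1.1 p.1.2 p.2].
apply: (@dimle_forget _ _ _ _ S'); last by move=> x z [A [A1 kb]]; exists A.
refine (@dimle_kernel_bracket _ _ _ _ (mxbrxx skewB) (mx_space K r 3) _ _ _ (fun A => A)
  3 _ S' (dimle_identity_rows K f) (@ispolmx_id _ _ _) (leqnn _) _) => A x z [A1 kb]; split => //.
by rewrite -[X in (X <= _)%N](mxrank1 K) -A1 -[A in rowsub _ A]mul1mx -mul_rowsub_mx mxrankM_maxr.
Qed.

Lemma dimle_abn_rank2 d (W : 'I_d -> 'M[K]_r) m :
  (forall i j, dimle (gauge_pairs i j W) m) ->
  (forall la (a b : 'rV[K]_r) s k, s != 0 -> omega B la = s *: (a^T *m b - b^T *m a) ->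
    a *m W k *m b^T = 0) ->
  dimle (abn B [set la | omega B la != 0 /\ (\rank (omega B la) < 3)%N])
    (m + (r - 2) + 'C(r - 2, 2)).
Proof.
move=> Wm WB.
pose S (ij : 'I_r * 'I_r) : set (prod_space (mx_space K 1 r) (mx_space K 1 c)) :=
  [set p | exists ab, gauge_pairs ij.1 ij.2 W ab /\
    kernel_bracket B (row_mx ab.1^T ab.2^T) p.1 p.2].
apply: (@dimle_sub _ _ _ (\bigcup_ij S ij)).
  move=> p [la [la0 rk] kb].
  have [i [j wij]] : exists i, exists j, omega B la i j != 0.
    apply: contrapT => H'; case/negP: la0; apply/eqP/matrixP => i j; rewrite mxE.
    by apply/eqP; apply: contrapT => /negP wij; apply: H'; exists i, j.
  have skw : skew (omega B la) by exact: skew_omega.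
  have pf k l : pfaffian4 (omega B la) i j k l = 0.
    apply/eqP/negP => /negP pf; move: rk; rewrite ltnNge => /negP; apply.
    exact: pfaffian4_rank_ge3 pf.
  set w := omega B la in wij skw pf kb rk *.
  (* The basis of the row space of w in the gauge (i, j); the vanishing Pfaffians say that w is w i
     j times a /\ b. *)
  pose a := \row_k (w k j / w i j); pose b := \row_k (w i k / w i j).
  have wE : w = w i j *: (a^T *m b - b^T *m a).
    apply/matrixP => k l; rewrite !mxE !big_ord1 !mxE.
    have := pf k l; rewrite /pfaffian4; have [-> _] := skw k j; have [-> _] := skw l j.
    move=> E; apply: (mulfI wij).
    have -> : w i j * w k l = w i l * w k j - w i k * w l j by rewrite -[LHS]subr0 -E; ring.
    by field.
  exists (i, j) => //; exists (a, b); split.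
    split => [|k]; last exact: (WB la _ _ (w i j)).
    split; rewrite mxE ?divff//; first by have [_ ->] := skw j j; rewrite mul0r.
    by have [_ ->] := skw i i; rewrite mul0r.
  apply: kernel_bracket_mono kb => v vw.
  have vwk k : \sum_s v 0 s * w s k = 0 by have /rowP/(_ k) := vw; rewrite !mxE.
  rewrite mul_mx_row -[0](row_mx0 _ 1 1 1); congr row_mx; apply/matrixP => s t;
    rewrite !ord1 !mxE.
    transitivity ((\sum_s v 0 s * w s j) / w i j); last by rewrite vwk mul0r.
    by rewrite mulr_suml; apply: eq_bigr => k _; rewrite !mxE mulrA.
  transitivity (- (\sum_s v 0 s * w s i) / w i j); last by rewrite vwk oppr0 mul0r.
  rewrite -sumrN mulr_suml; apply: eq_bigr => k _; rewrite !mxE.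
  by have [-> _] := skw k i; rewrite mulrA mulrN.
apply: dimle_bigcup => -[i j].
pose X := prod_space (mx_space K 1 r) (mx_space K 1 r).
pose S' : set (prod_space (prod_space X (mx_space K 1 r)) (mx_space K 1 c)) :=
  [set p | gauge_pairs i j W p.1.1 /\ kernel_bracket B (row_mx p.1.1.1^T p.1.1.2^T) p.1.2 p.2].
apply: (@dimle_forget _ _ _ _ S'); last by move=> x z [ab [gab kb]]; exists ab.
apply: (@dimle_kernel_bracket _ _ _ _ (mxbrxx skewB) X _ m _ (fun ab : X => row_mx ab.1^T ab.2^T)
  2 _ _ (Wm i j) _ (leqnn _)).
  apply: ispolmx_row; apply: ispolmx_tr.
    exact: (@ispolmx_fst _ (mx_space K 1 r) (mx_space K 1 r) _ _ _ (@ispolmx_id _ _ _)).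
  exact: ispolmx_proj2.
move=> [a b] x z [Gab kb]; split => //; case: Gab => [[/= ai aj bi bj] _].
apply: (@leq_ltn_trans (\rank b^T)).
  by rewrite mxrank_tr lt0n mxrank_eq0; apply/eqP => b0; move: bj;
    rewrite b0 mxE => /esym/eqP; rewrite oner_eq0.
apply: (rank_row_mx_ltn (v := delta_mx 0 i)).
  by rewrite -rowE; apply/matrixP => s t; rewrite !ord1 !mxE bi.
by rewrite -rowE; apply/eqP => /matrixP/(_ 0 0)/eqP; rewrite !mxE ai oner_eq0.
Qed.

Hypothesis omega_inj : forall la, omega B la = 0 -> la = 0.

(* The forms W k span the annihilator of the span of the B k for the pairing of
   w with a /\ b given by a *m w *m b^T. *)
Lemma annihilator_exists d : (d + c = 'C(r, 2))%N ->
  exists W : 'I_d -> 'M[K]_r, [/\ forall k, skew (W k),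
    forall s, omega W s = 0 -> s = 0 &
    forall la (a b : 'rV[K]_r) s k, s != 0 -> omega B la = s *: (a^T *m b - b^T *m a) ->
      a *m W k *m b^T = 0].
Proof.
move=> dc; pose P : finType := {ij : 'I_r * 'I_r | (ij.1 < ij.2)%N}.
pose pr (p : 'I_#|P|) : 'I_r * 'I_r := val (enum_val p).
pose Bm := \matrix_(k < c, p < #|P|) B k (pr p).1 (pr p).2.
have BmE (la : 'rV[K]_c) p : (la *m Bm) 0 p = omega B la (pr p).1 (pr p).2.
  by rewrite mxE summxE; apply: eq_bigr => k _; rewrite !mxE.
have prP (i j : 'I_r) : (i < j)%N -> exists p, pr p = (i, j).
  move=> ij; exists (enum_rank (exist (fun ij : 'I_r * 'I_r => (ij.1 < ij.2)%N) (i, j) ij)).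
  by rewrite /pr enum_rankK.
have freeB : row_free Bm.
  rewrite -kermx_eq0; apply/rowV0P => la /sub_kermxP laB; apply: omega_inj.
  have skw : skew (omega B la) by exact: skew_omega.
  have up (i j : 'I_r) : (i < j)%N -> omega B la i j = 0.
    by move=> /prP[p pE]; have := BmE la p; rewrite laB mxE pE.
  apply/matrixP => i j; rewrite mxE; have [/up//|ji|/val_inj ->] := ltngtP i j.
    by have [-> _] := skw j i; rewrite up ?oppr0.
  by have [_] := skw j j.
have rk : \rank (kermx Bm^T) = d.
  by rewrite mxrank_ker mxrank_tr (eqP freeB) card_ltn_pairs -dc addnK.
move: (row_base (kermx Bm^T)) (row_base_free (kermx Bm^T)) (eq_row_base (kermx Bm^T)).
rewrite rk => Y freeY YB.
have {}YB : Y *m Bm^T = 0 by apply/sub_kermxP; rewrite YB.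
(* The standard basis e_i /\ e_j of skew matrices; the rows of Y, orthogonal to those of Bm, are the
   coordinates of the W k. *)
pose D p : 'M[K]_r := delta_mx (pr p).1 (pr p).2 - delta_mx (pr p).2 (pr p).1.
pose W k := \sum_p Y k p *: D p.
have skW k : skew (W k).
  apply: skew_sum => p i j; rewrite !mxE; split; last by rewrite andbC subrr.
  by rewrite opprB [(j == _) && _]andbC [(j == _) && _]andbC.
exists W; split => //.
- move=> s sW; suff sY : s *m Y = 0.
    by move: freeY; rewrite -kermx_eq0 => /rowV0P; apply; apply/sub_kermxP.
  have sWE : omega W s = \sum_p (s *m Y) 0 p *: D p.
    rewrite /omega; under eq_bigr do rewrite scaler_sumr; rewrite exchange_big.
    apply: eq_bigr => p _; rewrite mxE scaler_suml.
    by apply: eq_bigr => k _; rewrite scalerA.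
  apply/rowP => p; rewrite [RHS]mxE.
  have := congr1 (fun w : 'M[K]_r => w (pr p).1 (pr p).2) sWE; rewrite sW mxE summxE => ->.
  have prlt q : ((pr q).1 < (pr q).2)%N by exact: (valP (enum_val q)).
  rewrite (bigD1 p) //= big1 ?addr0 => [|q qp].
    rewrite !mxE !eqxx /= (_ : (_ == (pr p).2) && _ = false) ?subr0 ?mulr1//.
    by apply/negbTE; rewrite negb_and neq_ltn prlt.
  rewrite !mxE (_ : (_ == (pr q).1) && _ = false); last first.
    apply: contraNF qp => /andP[/eqP e1 /eqP e2]; apply/eqP/enum_val_inj/val_inj.
    by rewrite -/(pr q) -/(pr p) [pr q]surjective_pairing [pr p]surjective_pairing e1 e2.
  rewrite (_ : (_ == (pr q).2) && _ = false) ?subrr ?mulr0//.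
  apply/negbTE/negP => /andP[/eqP e1 /eqP e2].
  by have := prlt p; rewrite e1 e2 ltnNge ltnW// prlt.
move=> la a b s k s0 laE; apply: (scalerI s0); rewrite scaler0.
transitivity (row k (Y *m (la *m Bm)^T)); last first.
  by rewrite trmx_mul mulmxA YB mul0mx row0.
have E (i j : 'I_r) : a *m delta_mx i j *m b^T = const_mx (a 0 i * b 0 j).
  have -> : delta_mx i j = delta_mx i (0 : 'I_1) *m delta_mx (0 : 'I_1) j :> 'M[K]_r.
    by rewrite mul_delta_mx.
  rewrite mulmxA -mulmxA mul_delta1 -rowE; apply/matrixP => s' t.
  by rewrite !ord1 !mxE big_ord1 !mxE.
have DE p : a *m D p *m b^T = const_mx (a 0 (pr p).1 * b 0 (pr p).2 - a 0 (pr p).2 * b 0 (pr p).1).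
  by rewrite mulmxBr mulmxBl !E; apply/matrixP => s' t; rewrite !mxE.
apply/matrixP => i j; rewrite !ord1.
rewrite mulmx_sumr mulmx_suml scaler_sumr summxE [RHS]mxE [RHS]mxE; apply: eq_bigr => p _.
rewrite -scalemxAr -scalemxAl DE [(_^T) _ _]mxE BmE laE !mxE !big_ord1 !mxE; ring.
Qed.

Lemma dimle_abn_large d : (d = 1 \/ d = 2)%N -> (d + c = 'C(r, 2))%N -> (2 + d <= r)%N ->
  exists2 m, dimle (abn B [set la | la != 0]) m & (m + 3 <= r + c)%N.
Proof.
move=> d12 dc dr.
have [W [skW W_inj WB]] := annihilator_exists dc.
have gd i j : dimle (gauge_pairs i j W) (2 * r - 4 - d).
  case: d12 => dE; move: W skW W_inj {WB}; rewrite dE => W skW W_inj.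
    have -> : (2 * r - 4 - 1 = 2 * r - 5)%N by lia.
    apply: dimle_gauge_pairs1 => //; first by lia.
    apply/eqP => W0; have : omega W (const_mx 1) = 0.
      by rewrite /omega big_ord1 W0 scaler0.
    by move=> /W_inj /rowP/(_ 0)/eqP; rewrite !mxE oner_eq0.
  have -> : (2 * r - 4 - 2 = 2 * r - 6)%N by lia.
  by apply: dimle_gauge_pairs2 => //; lia.
have d2 := dimle_abn_rank2 gd WB; have d3 := dimle_abn_rank3.
(* With r + c = 'C(r + 1, 2) - d the first term is r + c - 3 and the second r + c - 6 + d. *)
exists (maxn (2 * r - 4 - d + (r - 2) + 'C(r - 2, 2)) (3 * (r - 3) + (r - 3) + 'C(r - 3, 2))).
  apply: (@dimle_sub _ _ _ (abn B [set la | (3 <= \rank (omega B la))%N] `|`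
    abn B [set la | omega B la != 0 /\ (\rank (omega B la) < 3)%N])).
    move=> p [la la0 kb]; have [rk|rk] := leqP 3 (\rank (omega B la)).
      by left; exists la.
    by right; exists la => //; split => //; exact: omega_neq0.
  by apply: dimleU; [apply: dimle_leq d3|apply: dimle_leq d2]; rewrite ?leq_maxl ?leq_maxr.
have [s rE] : exists s, r = s.+3 by exists (r - 3)%N; lia.
have -> : (2 * r - 4 - d = 2 * s + 2 - d)%N by lia.
have -> : (r - 2 = s.+1)%N by lia.
have -> : (r - 3 = s)%N by lia.
by move: dc; rewrite rE !binS !bin1 !bin0; lia.
Qed.

Theorem dimle_abnormal : (0 < c)%N ->
  ((r + c = r + 1 \/ r + c = r + 2)%N \/
   (r + c = (r ^ 2 + r) %/ 2 - 1 \/ r + c = (r ^ 2 + r) %/ 2 - 2)%N \/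
   (r = 4%N /\ r + c = 7)%N) ->
  exists2 m, dimle (abn B [set la | la != 0]) m & (m + 3 <= r + c)%N.
Proof.
move=> c0 rc.
have r2 : (2 <= r)%N.
  have la0 : const_mx 1 != 0 :> 'rV[K]_c.
    by apply/eqP => /rowP/(_ (Ordinal c0))/eqP; rewrite !mxE oner_eq0.
  exact: leq_trans (omega_rank_ge2 skewB omega_inj la0) (rank_leq_row _).
(* Centers of dimension one and two are settled in every case; they exhaust (i) and the values of r
   in (ii) too small for [dimle_abn_large]. *)
have [c1|c1] := eqVneq c 1%N.
  by exists (r - 2)%N; [exact: dimle_abn_center1|lia].
have [c2|c2] := eqVneq c 2%N.
  exists (r - 1)%N; last by lia.
  by move: B skewB omega_inj; rewrite c2 => B' skB' injB'; exact: dimle_abn_center2.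
case: rc => [|[rc|[r4 rc]]]; first by lia.
  have rE : ((r ^ 2 + r) %/ 2 = 'C(r, 2) + r)%N.
    have := bin2 r.+1; rewrite binS bin1 /= => ->.
    by rewrite -divn2; congr (_ %/ _)%N; lia.
  rewrite rE in rc.
  have r3 : r <> 2%N by move=> rE2; move: rc; rewrite rE2 (_ : 'C(2, 2) = 1)%N//; lia.
  case: rc => rc; first by apply: (@dimle_abn_large 1); [left|lia|lia].
  have r4 : r <> 3%N by move=> rE3; move: rc; rewrite rE3 (_ : 'C(3, 2) = 3)%N//; lia.
  by apply: (@dimle_abn_large 2); [right|lia|lia].
exists 4%N; last by lia.
by apply: dimle_abn_center3 => //; lia.
Qed.

End LargeCenter.

(** * Absolutely continuous curves *)

Section AbsoluteContinuity.
Variable R : realType.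
Implicit Types f g : R -> R.

Definition ac01 f := forall eps : R, 0 < eps -> exists2 delta : R, 0 < delta &
  forall (k : nat) (a b : 'I_k -> R),
    (forall i, 0 <= a i /\ a i <= b i /\ b i <= 1) ->
    (forall i j, i != j -> b i <= a j \/ b j <= a i) ->
    \sum_(i < k) (b i - a i) < delta -> \sum_(i < k) `|f (b i) - f (a i)| < eps.

Lemma is_derive_modulus f (t d : R) : is_derive t 1 f d -> forall e : R, 0 < e ->
  exists2 r : R, 0 < r & forall x, `|x - t| < r -> `|f x - f t - d * (x - t)| <= e * `|x - t|.
Proof.
move=> [fd fE] e e0.
have /cvgrPdist_le/(_ _ e0)[r /= r0 rP] : h^-1 *: ((f \o shift t) (h *: 1) - f t) @[h --> 0^'] --> d.
  by rewrite -fE; exact: fd.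
exists r => // x xt; have [->|xnt] := eqVneq x t; first by rewrite !subrr mulr0 subrr normr0 mulr0.
have h0 : x - t != 0 by rewrite subr_eq0.
have := rP (x - t); rewrite /ball_ /= sub0r normrN => /(_ xt h0).
rewrite -[_ *: 1]/(_ * 1) mulr1 subrK -[_ *: _]/(_ * _) => H.
have -> : f x - f t - d * (x - t) = - ((d - (x - t)^-1 * (f x - f t)) * (x - t)) by field.
by rewrite normrN normrM ler_pM2r// normr_gt0.
Qed.

(** The intervals are listed from right to left, so cutting V at the left end of the head separates
    it from the tail. *)
Lemma sum_length_le (s : seq (R * R)) (V : set R) : measurable V ->
  (forall p, p \in s -> p.1 <= p.2) ->
  pairwise (fun p q : R * R => q.2 <= p.1) s ->
  (forall p, p \in s -> `]p.1, p.2] `<=` V) ->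
  ((\sum_(p <- s) (p.2 - p.1))%:E <= @lebesgue_measure R V)%E.
Proof.
elim: s V => [|[x y] s IH] V mV sP; first by rewrite big_nil measure_ge0.
rewrite pairwise_cons => /andP[/allP /= sx ps] sV.
have xy : x <= y by apply: (sP (x, y)); rewrite mem_head.
have VE : V = (V `&` `]-oo, x]) `|` (V `&` `]x, +oo[).
  rewrite -setIUr (_ : _ `|` _ = setT) ?setIT//; apply/seteqP; split => // z _ /=.
  by rewrite !in_itv /= andbT; case: leP; [left|right].
have mV1 : measurable (V `&` `]-oo, x]) by apply: measurableI.
have mV2 : measurable (V `&` `]x, +oo[) by apply: measurableI.
have -> : @lebesgue_measure R V = (@lebesgue_measure R (V `&` `]-oo, x]) +
    @lebesgue_measure R (V `&` `]x, +oo[))%E.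
  rewrite {1}VE measureU//; apply/seteqP; split => // z [[_ /=] + [_ /=]].
  by rewrite !in_itv /= andbT => zx xz; have := le_lt_trans zx xz; rewrite ltxx.
rewrite big_cons /= addrC EFinD; apply: leeD.
  apply: IH => // [p ps'|p ps' z /= zp]; first by apply: sP; rewrite inE ps' orbT.
  split; first by apply: (sV p); rewrite ?inE ?ps' ?orbT.
  by move: zp; rewrite /= !in_itv /= => /andP[_ zp]; apply: le_trans zp (sx _ ps').
have -> : (y - x)%:E = @lebesgue_measure R `]x, y].
  by rewrite lebesgue_measure_itv /= lte_fin; case: ltgtP xy => // -> _; rewrite subrr.
apply: le_measure; rewrite ?inE// => z zxy; split; first by apply: (sV (x, y)); rewrite ?mem_head.
by move: zxy; rewrite /= !in_itv /= andbT => /andP[].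
Qed.

Lemma null_open_cover (N : set R) (d : R) : 0 < d -> (@lebesgue_measure R).-negligible N ->
  exists U : set R, [/\ open U, N `<=` U & (@lebesgue_measure R U < d%:E)%E].
Proof.
move=> d0 /negligible_outer_measure N0.
have d2 : 0 < d / 2 by rewrite divr_gt0.
have [U [oU NU mU]] := outer_measure_open_le N d2; exists U; split => //.
apply: (le_lt_trans mU); rewrite [X in (X + _)%E](_ : _ = 0%E)//.
by rewrite add0e lte_fin ltr_pdivrMr// ltr_pMr// ltr1n.
Qed.

(* A sup argument replaces Vitali's covering theorem: points where f' = 0 move the
   supremum at small slope, the others lie in an open set of small measure. *)
Lemma ac01_derive0_const f : ac01 f ->
  {ae @lebesgue_measure R, forall t : R, 0 <= t <= 1 -> is_derive t 1 f 0} ->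
  forall T, 0 <= T <= 1 -> f T = f 0.
Proof.
move=> fac [N0 [mN0 N00 N0P]] T /andP[T0 T1].
suff H (e : R) : 0 < e -> `|f T - f 0| <= 2 * e.
  apply/eqP; rewrite -subr_eq0 -normr_eq0 eq_le normr_ge0 andbT; apply/ler_addgt0Pl => e e0.
  rewrite addr0 (le_trans (H (e / 2) _)) ?divr_gt0//; lra.
move=> e0; have [delta d0 dP] := fac e e0.
have [U [oU N0U mU]] : exists U, [/\ open U, N0 `<=` U & (@lebesgue_measure R U < delta%:E)%E].
  by apply: null_open_cover => //; exists N0; split.
have good (t : R) : 0 <= t <= 1 -> ~ U t -> is_derive t 1 f 0.
  by move=> t01 nUt; apply: contrapT => H; apply/nUt/N0U/N0P => /(_ t01).
(* Points reached from 0 with slope at most e, except on finitely many non-overlapping intervals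
   inside U. *)
pose G c := (0 <= c <= T) /\ exists s : seq (R * R),
  [/\ forall p, p \in s -> [/\ 0 <= p.1, p.1 <= p.2, p.2 <= c & `[p.1, p.2] `<=` U],
      pairwise (fun p q : R * R => q.2 <= p.1) s &
      `|f c - f 0| <= e * c + \sum_(p <- s) `|f p.2 - f p.1| ].
have G0 : G 0.
  split; first by rewrite lexx.
  by exists [::]; split => //; rewrite subrr normr0 big_nil mulr0 addr0.
have Gsup : has_sup G.
  split; first by exists 0.
  by exists T => c [/andP[]].
pose s := sup G.
have s0 : 0 <= s by apply: (ub_le_sup Gsup.2).
have sT : s <= T by apply: (ge_sup Gsup.1) => c [/andP[]].
have s01 : 0 <= s <= 1 by rewrite s0 (le_trans sT).
(* G passes across the supremum s: if s is in U, the interval [x, y] is added to the list; otherwise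
   the derivative at s is zero and the slope bound applies. *)
have [r r0 rP] : exists2 r : R, 0 < r & forall x y, 0 <= x -> x <= s -> s <= y -> y <= T ->
    s - x < r -> y - s < r -> G x -> G y.
  have [Us|nUs] := pselect (U s).
    have [r /= r0 rU] := (nbhs_ballP _ _).1 (open_nbhs_nbhs (conj oU Us)).
    exists r => // x y x0 xs sy yT xr yr [_ [l [lP lpw lf]]]; split; first by rewrite (le_trans s0).
    exists ((x, y) :: l); split.
    - move=> p; rewrite inE => /orP[/eqP ->/=|/lP[p1 p2 p3 p4]]; last first.
        by split => //; rewrite (le_trans p3)// (le_trans xs).
      split => // [|z]; first exact: le_trans sy.
      rewrite /= in_itv /= => /andP[xz zy]; apply: rU; rewrite /ball /= ltr_norml.
      by apply/andP; split; lra.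
    - by rewrite pairwise_cons lpw andbT; apply/allP => p /lP[].
    - rewrite big_cons /=; apply: (le_trans (ler_distD (f x) _ _)).
      have := lf; have : e * x <= e * y by rewrite ler_pM2l// (le_trans xs).
      lra.
  have [r r0 rP] := is_derive_modulus (good _ s01 nUs) e0.
  exists r => // x y x0 xs sy yT xr yr [_ [l [lP lpw lf]]]; split; first by rewrite (le_trans s0).
  exists l; split => //.
    by move=> p /lP[p1 p2 p3 p4]; split => //; rewrite (le_trans p3)// (le_trans xs).
  have := rP x; have := rP y; rewrite !mul0r !subr0.
  rewrite [`|y - s|]ger0_norm ?subr_ge0// => /(_ yr) fy.
  rewrite [`|x - s|]distrC [`|s - x|]ger0_norm ?subr_ge0// => /(_ xr) fx.
  apply: (le_trans (ler_distD (f x) _ _)); have := lf.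
  have := ler_distD (f s) (f y) (f x); rewrite [`|f s - f x|]distrC.
  have : e * (y - s) + e * (s - x) = e * y - e * x by ring.
  lra.
have GT : G T.
  have [x Gx xs] : exists2 x, G x & s - r < x by apply: sup_adherent.
  have xs' : x <= s by apply: (ub_le_sup Gsup.2).
  pose y := Num.min T (s + r / 2).
  have sy : s <= y by rewrite le_min sT /=; lra.
  have yT : y <= T by rewrite ge_min lexx.
  have yr : y <= s + r / 2 by rewrite ge_min lexx orbT.
  have Gy : G y.
    apply: (rP x) => //; [by case: Gx => /andP[]|lra|lra].
  have ys : y <= s by apply: (ub_le_sup Gsup.2).
  suff <- : y = T by [].
  apply/eqP; rewrite eq_le yT /=; rewrite leNgt; apply/negP => yT'.
  have [h|h] := leP T (s + r / 2).
    by move: yT'; rewrite /y min_l// ltxx.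
  by move: ys; rewrite /y min_r ?(ltW h)//; lra.
have [_ [l [lP lpw lf]]] := GT.
pose a (i : 'I_(size l)) := (nth (0, 0) l i).1; pose b (i : 'I_(size l)) := (nth (0, 0) l i).2.
have li (i : 'I_(size l)) : nth (0, 0) l i \in l by rewrite mem_nth.
have sumE (F : R * R -> R) : \sum_(p <- l) F p = \sum_(i < size l) F (nth (0, 0) l i).
  by rewrite (big_nth (0, 0)) big_mkord.
(* The intervals of l have total length below delta, being inside U, so absolute continuity
   applies. *)
suff : \sum_(p <- l) `|f p.2 - f p.1| < e.
  have : e * T <= e by rewrite ler_piMr// ltW.
  lra.
rewrite sumE; apply: (dP _ a b) => [i|i j ij|].
- by have [p1 p2 p3 _] := lP _ (li i); split; [|split; [|exact: le_trans p3 T1]].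
- have lpwP (i' j' : 'I_(size l)) : (i' < j')%N -> b j' <= a i'.
    by move=> ij'; apply: (pairwiseP (0, 0) lpw); rewrite ?inE.
  by move: ij; rewrite neq_ltn => /orP[/lpwP|/lpwP]; [right|left].
- rewrite -(sumE (fun p => p.2 - p.1)) -lte_fin; apply: le_lt_trans mU.
  apply: sum_length_le => //; first exact: measurable_realfun.open_measurable.
    by move=> p /lP[].
  by move=> p /lP[_ _ _ pU] z zp; apply: pU; move: z zp; exact: subset_itv_oc_cc.
Qed.

End AbsoluteContinuity.

(** * Closure properties and primitives of absolutely continuous functions *)

Section AbsoluteContinuityTheory.
Variable R : realType.
Implicit Types f g h : R -> R.

Lemma ac01_dom f g h (L : R) : ac01 f -> ac01 g ->
  (forall x y, 0 <= x <= 1 -> 0 <= y <= 1 ->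
    `|h y - h x| <= L * (`|f y - f x| + `|g y - g x|)) -> ac01 h.
Proof.
move=> fac gac hP eps e0.
pose M := 1 + `|L|; have M0 : 0 < M by rewrite /M; have := normr_ge0 L; lra.
have e1 : 0 < eps / (M * 2) by rewrite divr_gt0// mulr_gt0.
have [d1 d10 D1] := fac _ e1; have [d2 d20 D2] := gac _ e1.
exists (Num.min d1 d2); first by rewrite lt_min d10.
move=> k a b ab01 ab_disj; rewrite lt_min => /andP[sd1 sd2].
have s1 := D1 k a b ab01 ab_disj sd1; have s2 := D2 k a b ab01 ab_disj sd2.
apply: (@le_lt_trans _ _ (M * (\sum_(i < k) `|f (b i) - f (a i)| + \sum_(i < k) `|g (b i) - g (a i)|))).
  rewrite -big_split mulr_sumr; apply: ler_sum => i _.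
  have [a0 [ab b1]] := ab01 i.
  apply: le_trans (hP (a i) (b i) _ _) _.
  - by rewrite a0 (le_trans ab).
  - by rewrite b1 (le_trans a0).
  - apply: ler_wpM2r; first by rewrite addr_ge0.
    by rewrite /M; have := ler_norm L; lra.
have -> : eps = M * (eps / (M * 2) + eps / (M * 2)).
  by field; rewrite gt_eqF.
by rewrite ltr_pM2l// ltrD.
Qed.

Lemma ac01_lipschitz h (L : R) :
  (forall x y, 0 <= x <= 1 -> 0 <= y <= 1 -> `|h y - h x| <= L * `|y - x|) -> ac01 h.
Proof.
move=> hP; have idac : ac01 (@id R).
  move=> eps e0; exists eps => // k a b ab01 _ abs.
  by rewrite (eq_bigr (fun i => b i - a i))// => i _; rewrite ger0_norm// subr_ge0; case: (ab01 i) => _ [].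
apply: (@ac01_dom id id h `|L|) => // x y x01 y01.
apply: (le_trans (hP x y x01 y01)); apply: (@le_trans _ _ (`|L| * `|y - x|)).
  by rewrite ler_wpM2r// ler_norm.
by rewrite ler_wpM2l// lerDl.
Qed.

Lemma ac01_cst (c : R) : ac01 (fun=> c).
Proof. by apply: (@ac01_lipschitz _ 0) => x y _ _; rewrite subrr normr0 mul0r. Qed.

Lemma ac01D f g : ac01 f -> ac01 g -> ac01 (fun t => f t + g t).
Proof.
move=> fac gac; apply: (ac01_dom (L := 1) fac gac) => x y _ _.
by rewrite mul1r opprD addrACA ler_normD.
Qed.

Lemma ac01Z (k : R) f : ac01 f -> ac01 (fun t => k * f t).
Proof.
move=> fac; apply: (ac01_dom (L := `|k|) fac fac) => x y _ _.
by rewrite -mulrBr normrM ler_wpM2l// lerDl.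
Qed.

Lemma ac01_sum (I : finType) (F : I -> R -> R) :
  (forall i, ac01 (F i)) -> ac01 (fun t => \sum_i F i t).
Proof.
move=> Fac; elim: (index_enum I) => [|i s IH].
  by under eq_fun do rewrite big_nil; exact: ac01_cst.
by under eq_fun do rewrite big_cons; exact: (ac01D (Fac i) IH).
Qed.

(** Retraction of the line onto [0,1], used to extend a function known there to a continuous
    function on R. *)
Definition clamp (t : R) := Num.max 0 (Num.min 1 t).

Lemma clamp01 t : 0 <= clamp t <= 1.
Proof. by rewrite le_max lexx /= ge_max ler01 ge_min lexx. Qed.

Lemma clamp_id t : 0 <= t <= 1 -> clamp t = t.
Proof. by move=> /andP[t0 t1]; rewrite /clamp min_r// max_r. Qed.

Lemma clamp_dist x y : `|clamp y - clamp x| <= `|y - x|.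
Proof.
have clampP t : [\/ t <= 0 /\ clamp t = 0, 0 <= t <= 1 /\ clamp t = t | 1 <= t /\ clamp t = 1].
  have [t0|t0] := leP t 0.
    by apply: Or31; rewrite /clamp max_l// ge_min t0 orbT.
  have [t1|t1] := leP t 1.
    have t01 : 0 <= t <= 1 by apply/andP; split => //; exact: ltW.
    by apply: Or32; split; [rewrite (ltW t0)|exact: clamp_id].
  by apply: Or33; split; [exact: ltW|rewrite /clamp min_l ?(ltW t1)// max_r].
have := ler_norm (y - x); have := ler_norm (- (y - x)); rewrite normrN ler_norml.
by case: (clampP x) => -[+ ->]; case: (clampP y) => -[+ ->]; move=> *; apply/andP; split; lra.
Qed.

Lemma ac01_close f : ac01 f -> forall e : R, 0 < e -> exists2 d : R, 0 < d &
  forall x y, 0 <= x <= 1 -> 0 <= y <= 1 -> `|y - x| < d -> `|f y - f x| < e.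
Proof.
move=> fac e e0; have [d d0 dP] := fac e e0; exists d => // x y x01 y01.
wlog xy : x y x01 y01 / x <= y.
  move=> H; have [xy|/ltW yx] := leP x y; first exact: H.
  by rewrite [`|f y - f x|]distrC [`|y - x|]distrC; exact: H.
rewrite ger0_norm ?subr_ge0// => yx.
have := dP 1%N (fun=> x) (fun=> y); rewrite !big_ord1; apply => //.
- by move=> _; split; [case/andP: x01|split => //; case/andP: y01].
- by move=> i j; rewrite !ord1.
Qed.

Lemma ac01_clamp_continuous f : ac01 f -> continuous (fun t => f (clamp t)).
Proof.
move=> fac t; apply/cvgrPdist_lt => e e0.
have [d d0 dP] := ac01_close fac e0.
apply/nbhs_ballP; exists d => // s ts; rewrite /= distrC; apply: dP; rewrite ?clamp01//.
by apply: le_lt_trans (clamp_dist _ _) _; rewrite distrC.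
Qed.

Lemma ac01_bounded f : ac01 f -> exists M : R, forall t, 0 <= t <= 1 -> `|f t| <= M.
Proof.
move=> /ac01_clamp_continuous fc.
have [c _ cP] : exists2 c, c \in `[0:R, 1] & forall t, t \in `[0:R, 1] -> `|f (clamp t)| <= `|f (clamp c)|.
  apply: (@EVT_max R (fun t => `|f (clamp t)|)) => //.
  apply: continuous_subspaceT => t.
  by apply: (@continuous_comp _ _ _ (fun t => f (clamp t)) (fun z : R => `|z|)); [exact: fc|exact: norm_continuous].
exists `|f (clamp c)| => t t01; rewrite -{1}(clamp_id t01); apply: cP.
by rewrite in_itv.
Qed.

Lemma ac01M f g : ac01 f -> ac01 g -> ac01 (fun t => f t * g t).
Proof.
move=> fac gac; have [M MP] := ac01_bounded fac; have [N NP] := ac01_bounded gac.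
apply: (ac01_dom (L := `|M| + `|N|) fac gac) => x y x01 y01.
have -> : f y * g y - f x * g x = (f y - f x) * g y + f x * (g y - g x) by ring.
apply: (le_trans (ler_normD _ _)); rewrite !normrM.
rewrite mulrDr; apply: lerD; rewrite ?[`|f y - f x| * _]mulrC ler_wpM2r//.
  by apply: le_trans (NP y y01) (le_trans (ler_norm N) _); rewrite lerDr.
by apply: le_trans (MP x x01) (le_trans (ler_norm M) _); rewrite lerDl.
Qed.

Lemma rV_norm_coord n (v : 'rV[R]_n) i : `|v 0 i| <= `|v|.
Proof. by rewrite [`|v|]mx_normrE; apply: le_trans (le_bigmax _ _ (0, i)). Qed.

Lemma rV_norm_le_sum n (v : 'rV[R]_n) : `|v| <= \sum_i `|v 0 i|.
Proof.
rewrite [`|v|]mx_normrE; apply: bigmax_le => [|[i j] _ /=]; first exact: sumr_ge0.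
by rewrite ord1 (bigD1 j) //= lerDl sumr_ge0.
Qed.

Lemma abs_continuous_coord n (f : R -> 'rV[R]_n) :
  abs_continuous01 f <-> forall i, ac01 (fun t => f t 0 i).
Proof.
split=> [fac i eps e0|fac eps e0].
  have [d d0 dP] := fac eps e0; exists d => // k a b ab01 abd abs.
  apply: le_lt_trans (dP k a b ab01 abd abs); apply: ler_sum => j _.
  by have := rV_norm_coord (f (b j) - f (a j)) i; rewrite !mxE.
have e1 : 0 < eps / n.+1%:R by rewrite divr_gt0.
have Hd (i : 'I_n) : exists d : R, 0 < d /\ forall (k : nat) (a b : 'I_k -> R),
      (forall i, 0 <= a i /\ a i <= b i /\ b i <= 1) ->
      (forall i j, i != j -> b i <= a j \/ b j <= a i) ->
      \sum_(i < k) (b i - a i) < d -> \sum_(j < k) `|f (b j) 0 i - f (a j) 0 i| < eps / n.+1%:R.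
  by have [d d0 dP] := fac i _ e1; exists d.
have [d dP] := choice Hd.
(* Positive and at most every d i, also when n = 0. *)
pose D := (1 + \sum_i (d i)^-1)^-1.
have D0 : 0 < D by rewrite invr_gt0 ltr_pwDl// sumr_ge0// => i _; rewrite invr_ge0 ltW//; case: (dP i).
have Dd i : D <= d i.
  rewrite -[d i]invrK lef_pV2 ?posrE ?invr_gt0//; last by case: (dP i).
    rewrite (bigD1 i) //= addrCA lerDl addr_ge0// sumr_ge0// => j _.
    by rewrite invr_ge0 ltW//; case: (dP j).
  by rewrite -[X in 0 < X]invrK invr_gt0.
exists D => // k a b ab01 abd abs.
apply: (@le_lt_trans _ _ (\sum_i \sum_(j < k) `|f (b j) 0 i - f (a j) 0 i|)).
  rewrite exchange_big; apply: ler_sum => j _.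
  by apply: le_trans (rV_norm_le_sum _) _; apply: ler_sum => i _; rewrite !mxE.
apply: (@le_lt_trans _ _ (\sum_(i < n) eps / n.+1%:R)).
  by apply: ler_sum => i _; have [_ H] := dP i; apply/ltW/H => //; exact: lt_le_trans abs (Dd i).
rewrite sumr_const card_ord -[X in X < _]mulr_natr mulrAC ltr_pdivrMr// ltr_pM2l//.
by rewrite ltr_nat.
Qed.

Lemma is_derive_coord n (f : R -> 'rV[R]_n) (t : R) d :
  is_derive t 1 f d <-> forall i, is_derive t 1 (fun s => f s 0 i) (d 0 i).
Proof.
split=> [[fd fE] i|H].
  have fdi : forall i j, derivable (fun x => f x i j) t 1 by apply/derivable_mxP.
  split; first exact: fdi.
  by rewrite -fE derive_mx// mxE.
have fd : derivable f t 1 by apply/derivable_mxP => i j; rewrite ord1; case: (H j).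
split => //; rewrite derive_mx//; apply/matrixP => i j; rewrite mxE ord1.
by case: (H j).
Qed.

Lemma is_derive_mulmx n m (f : R -> 'rV[R]_n) (t : R) d (A : 'M[R]_(n, m)) :
  is_derive t 1 f d -> is_derive t 1 (fun s => f s *m A) (d *m A).
Proof.
move=> /is_derive_coord H; apply/is_derive_coord => i.
have -> : (fun s => (f s *m A) 0 i) = \sum_(k < n) (A k i \*: (fun s => f s 0 k)).
  apply/funext => s; rewrite mxE fct_sumE; apply: eq_bigr => k _.
  by rewrite mulrC.
have -> : (d *m A) 0 i = \sum_(k < n) A k i *: d 0 k.
  by rewrite mxE; apply: eq_bigr => k _; rewrite mulrC.
by apply: is_derive_sum => k; apply: is_deriveZ.
Qed.

Lemma ac01_mulmx n m (f : R -> 'rV[R]_n) (A : 'M[R]_(n, m)) :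
  abs_continuous01 f -> abs_continuous01 (fun t => f t *m A).
Proof.
move=> /abs_continuous_coord fac; apply/abs_continuous_coord => i.
under eq_fun do rewrite mxE; apply: (@ac01_sum _ (fun k t => f t 0 k * A k i)) => k.
by under eq_fun do rewrite mulrC; exact: (ac01Z (A k i) (fac k)).
Qed.

Lemma continuous_antiderivative f : continuous f ->
  (* The integral starts at -1, so that the derivative at 0 is two-sided. *)
  exists F : R -> R, forall t : R, -1 < t -> is_derive t 1 F (f t).
Proof.
move=> fc; exists (fun y => \int[lebesgue_measure]_(t in [set` `[-1, y]]) f t)%R => t t1.
have tt1 : t < t + 1 by rewrite ltrDl.
have fi : lebesgue_measure.-integrable `[-1, t + 1] (EFin \o f).
  apply: continuous_compact_integrable; first exact: segment_compact.
  exact: continuous_subspaceT.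
have [dF F'] := continuous_FTC1_closed tt1 fi t1 (fc t).
by split => //; rewrite -derive1E.
Qed.

End AbsoluteContinuityTheory.

(** * Controls and curves in step two *)

Section Controls.
Variables (R : realType) (n : nat) (V1 : {vspace 'rV[R]_n}).

Let leb := @leb01 R.
Let p1 : (1 <= 2%:E :> \bar R)%E. Proof. by rewrite lee_fin ler1n. Qed.

Lemma L2_control_lin (a : R) (v w : R -> 'rV[R]_n) :
  L2_control V1 v -> L2_control V1 w -> L2_control V1 (fun t => a *: v t + w t).
Proof.
move=> [v1 v2] [w1 w2]; split=> [t t01|i].
  by rewrite memvD ?memvZ ?v1 ?w1.
have [_ H] := @Lfun_submod_closed _ _ _ leb _ p1.
have -> : (fun t => (a *: v t + w t) 0 i) = a *: (fun t => v t 0 i) + (fun t => w t 0 i).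
  by apply/funext => t; rewrite !mxE.
exact: H (v2 i) (w2 i).
Qed.

Lemma L2_control0 : L2_control V1 (fun=> 0).
Proof.
split=> [t _|i]; first exact: mem0v.
have [H _] := @Lfun_submod_closed _ _ _ leb _ p1.
by have -> : (fun t : R => (0 : 'rV[R]_n) 0 i) = 0 by apply/funext => t; rewrite mxE.
Qed.

Definition step (b t : R) : R := (0 <= t <= b)%R%:R.

Lemma step_Lfun b : step b \in Lfun leb 2%:E.
Proof.
have -> : step b = \1_(`[0, b]).
  apply/funext => t; rewrite /step indicE; congr (_%:R); congr nat_of_bool.
  by apply/idP/idP; rewrite in_setE /= in_itv.
rewrite inE; apply/andP; split; rewrite inE /=.
  exact: measurable_realfun.measurable_indic.
rewrite /finite_norm unlock /Lnorm poweR_lty//.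
under eq_integral => x _.
  rewrite /= (_ : `|\1_(`[0, b]) x| `^ 2 = \1_(`[0, b]) x)%R; last first.
    by rewrite indicE; case: (_ \in _); rewrite /= ?normr1 ?normr0 ?powR1 ?powR0.
  over.
rewrite integral_indic//= setIT.
apply: (@le_lt_trans _ _ (@lebesgue_measure R `[0, 1])).
  by rewrite /leb /leb01 /= /mrestr le_measure// ?inE//; exact: measurableI.
by rewrite lebesgue_measure_itv /=; case: ifP => _; rewrite ltry.
Qed.

Lemma L2_control_step b v : v \in V1 -> L2_control V1 (fun t => step b t *: v).
Proof.
move=> vV; split=> [t _|i]; first exact: memvZ.
have [H0 H] := @Lfun_submod_closed _ _ _ leb _ p1.
have -> : (fun t => (step b t *: v) 0 i) = v 0 i *: step b + 0.
  by apply/funext => t; rewrite addr0 !mxE mulrC.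
exact: H (step_Lfun b) H0.
Qed.

(** Homogeneity passes through [fine] because the norm of a step is finite. *)
Lemma L2_norm_step b (v : 'rV[R]_n) (e : R) :
  L2_norm (fun t => e *: (step b t *: v)) = `|e| * L2_norm (fun t => step b t *: v).
Proof.
have normE (k : R) : ('N[leb]_2%:E[(fun t => `|k *: (step b t *: v)|%R%:E)] =
    (`|k| * `|v|)%:E * 'N[leb]_2%:E[EFin \o step b])%E.
  have := @LnormZ _ _ _ leb _ p1 (Lfun_Sub p1 (step_Lfun b)) (`|k| * `|v|).
  rewrite /= normrM !normr_id => <-; apply: eq_Lnorm => t /=.
  rewrite !normrZ mulrA mulrAC; congr (_ * _)%:E.
  by rewrite ger0_norm// /step ler0n.
have := normE 1; under eq_fun do rewrite scale1r; rewrite normr1 mul1r => normE1.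
rewrite /L2_norm normE normE1 EFinM -muleA fineM//.
have : ('N[leb]_2%:E[EFin \o step b] < +oo)%E.
  by have := step_Lfun b; rewrite inE => /andP[_]; rewrite inE.
by move=> fin; rewrite fin_numM// ge0_fin_numE// Lnorm_ge0.
Qed.

End Controls.

(** * Annihilators and coordinates *)

Section LinearForms.
Variables (K : fieldType) (n : nat).

(** A matrix of maximal rank among those with rows in I spans I; a nonzero column of its cokernel is
    the form. *)
Lemma proper_subspace_form (I : set 'rV[K]_n) : I 0 ->
  (forall a v w, I v -> I w -> I (a *: v + w)) -> ~ (forall v, I v) ->
  exists2 nu : 'cV[K]_n, nu != 0 & forall v, I v -> v *m nu = 0.
Proof.
move=> I0 Ilin Iprop.
have Isub m (A : 'M[K]_(m, n)) : (forall i, I (row i A)) -> forall v : 'rV_n, (v <= A)%MS -> I v.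
  move=> IA v /submxP[u ->]; rewrite mulmx_sum_row.
  by elim/big_ind: _ => // [x y Ix Iy|i _]; [rewrite -[x]scale1r; exact: Ilin|rewrite -[_ *: _]addr0; exact: Ilin].
pose P k := `[< exists A : 'M[K]_n, (forall i, I (row i A)) /\ \rank A = k >].
have exP : exists k, P k.
  by exists 0%N; apply/asboolP; exists 0; split => [i|]; rewrite ?row0 ?mxrank0.
have ubP k : P k -> (k <= n)%N by move=> /asboolP[A [_ <-]]; exact: rank_leq_row.
case: (ex_maxnP exP ubP) => k /asboolP[A [IA rA]] kmax.
have [Afull|Anfull] := boolP (row_full A).
  by case: Iprop => v; apply: (Isub _ A) => //; exact: submx_full.
have : cokermx A != 0.
  by rewrite -mxrank_eq0 mxrank_coker subn_eq0 -ltnNge ltn_neqAle Anfull rank_leq_col.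
move=> cA; have [j cAj] : exists j, col j (cokermx A) != 0.
  apply: contrapT => H; case/negP: cA; apply/eqP/matrixP => i j.
  have [/colP/(_ i)|Hj] := eqVneq (col j (cokermx A)) 0; first by rewrite !mxE.
  by case: H; exists j.
exists (col j (cokermx A)) => // v Iv.
suff vA : (v <= A)%MS by rewrite colE mulmxA (_ : v *m _ = 0) ?mul0mx//; apply/eqP; rewrite -submxE.
have : P (\rank (A + v)%MS).
  apply/asboolP; exists (A + v)%MS; split => // i.
  have /sub_addsmxP[[u w] /= ->] : (row i (A + v)%MS <= A + v)%MS by exact: row_sub.
  rewrite -[u *m A]scale1r; apply: Ilin; first by apply: (Isub _ A) => //; exact: submxMl.
  apply: (Isub _ v); last exact: submxMl.
  by move=> i'; rewrite (_ : row i' v = v)//; apply/rowP => j'; rewrite mxE ord1.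
move=> /kmax; rewrite -rA => rk; have := mxrank_leqif_sup (addsmxSl A v).
move=> [le12]; have -> : \rank A == \rank (A + v)%MS by rewrite eqn_leq le12.
by move=> /esym; rewrite addsmx_sub => /andP[].
Qed.

End LinearForms.

Section Coordinates.
Variables (K : fieldType) (n : nat).

Definition vs_mx (V : {vspace 'rV[K]_n}) : 'M[K]_(\dim V, n) := \matrix_i (vbasis V)`_i.

Lemma vs_mx_mem (V : {vspace 'rV[K]_n}) (a : 'rV[K]_(\dim V)) : a *m vs_mx V \in V.
Proof.
rewrite mulmx_sum_row memv_suml// => i _; rewrite memvZ// rowK.
by apply: vbasis_mem; rewrite mem_nth// size_tuple.
Qed.

Lemma vs_mxP (V : {vspace 'rV[K]_n}) v : v \in V -> exists a, v = a *m vs_mx V.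
Proof.
move=> vV; exists (\row_i coord (vbasis V) i v).
rewrite [LHS](coord_vbasis vV) mulmx_sum_row; apply: eq_bigr => i _.
by rewrite rowK mxE.
Qed.

Lemma vs_mx_inj (V : {vspace 'rV[K]_n}) (a : 'rV[K]_(\dim V)) : a *m vs_mx V = 0 -> a = 0.
Proof.
move=> aV; apply/rowP => i; rewrite mxE.
have /freeP := basis_free (vbasisP V); apply; rewrite -[RHS]aV mulmx_sum_row.
by apply: eq_bigr => j _; rewrite rowK.
Qed.

Lemma splitting_coordinates (V1 V2 : {vspace 'rV[K]_n}) :
  (V1 + V2 = fullv)%VS -> (V1 :&: V2 = 0)%VS ->
  exists (Q1 : 'M[K]_(n, \dim V1)) (Q2 : 'M[K]_(n, \dim V2)),
    [/\ forall v : 'rV[K]_n, v = v *m Q1 *m vs_mx V1 + v *m Q2 *m vs_mx V2,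
        forall v, v \in V1 -> v *m Q2 = 0, forall v, v \in V2 -> v *m Q1 = 0,
        vs_mx V1 *m Q1 = 1%:M & vs_mx V2 *m Q2 = 1%:M].
Proof.
move=> V12 V12_0; pose M := col_mx (vs_mx V1) (vs_mx V2).
have freeM : row_free M.
  rewrite -kermx_eq0; apply/rowV0P => u /sub_kermxP.
  rewrite -[u]hsubmxK mul_row_col => /eqP; rewrite addr_eq0 => /eqP e.
  have u1V : lsubmx u *m vs_mx V1 \in (V1 :&: V2)%VS.
    by rewrite memv_cap vs_mx_mem e -mulNmx vs_mx_mem.
  rewrite V12_0 memv0 in u1V; move/eqP: u1V => u1; rewrite (vs_mx_inj u1).
  have u2 : rsubmx u *m vs_mx V2 = 0 by apply/eqP; rewrite -oppr_eq0 -e u1.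
  by rewrite (vs_mx_inj u2) row_mx0.
have subM (v : 'rV[K]_n) : (v <= M)%MS.
  have : v \in fullv by exact: memvf.
  rewrite -V12 => /memv_addP[v1 /vs_mxP[a ->] [v2 /vs_mxP[b ->] ->]].
  by rewrite -mul_row_col submxMl.
pose Q := pinvmx M.
have MQ : M *m Q = 1%:M by exact: mulmxVp.
have QM (v : 'rV[K]_n) : v *m Q *m M = v by exact: mulmxKpV (subM v).
have [e1 e2] : vs_mx V1 *m Q = row_mx 1%:M 0 /\ vs_mx V2 *m Q = row_mx 0 1%:M.
  by move: MQ; rewrite mul_col_mx scalar_mx_block block_mxEv => /eq_col_mx.
have QE v : v *m Q = row_mx (v *m lsubmx Q) (v *m rsubmx Q) by rewrite -mul_mx_row hsubmxK.
exists (lsubmx Q), (rsubmx Q); split.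
- by move=> v; rewrite -{1}[v]QM QE mul_row_col.
- by move=> v /vs_mxP[a ->]; rewrite -mulmxA; move: e1; rewrite -[Q in _ *m Q]hsubmxK mul_mx_row => /eq_row_mx[_ ->]; rewrite mulmx0.
- by move=> v /vs_mxP[a ->]; rewrite -mulmxA; move: e2; rewrite -[Q in _ *m Q]hsubmxK mul_mx_row => /eq_row_mx[-> _]; rewrite mulmx0.
- by move: e1; rewrite -[Q in _ *m Q]hsubmxK mul_mx_row => /eq_row_mx[].
- by move: e2; rewrite -[Q in _ *m Q]hsubmxK mul_mx_row => /eq_row_mx[].
Qed.

End Coordinates.

(** * Brackets and left translations in step two *)

Section Stratification.
Variables (R : realType) (n : nat) (br : 'rV[R]_n -> 'rV[R]_n -> 'rV[R]_n).
Variables (V1 V2 : {vspace 'rV[R]_n}).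
Hypothesis hG : step2_stratification br V1 V2.

Let brl := lie_linearl (strat_lie hG).
Let brr := lie_linearr (strat_lie hG).

Lemma br0l x : br 0 x = 0.
Proof. by have := brl (-1) 0 0 x; rewrite scaler0 addr0 scaleN1r addNr. Qed.

Lemma br0r x : br x 0 = 0.
Proof. by have := brr (-1) 0 0 x; rewrite scaler0 addr0 scaleN1r addNr. Qed.

Lemma brZl a x y : br (a *: x) y = a *: br x y.
Proof. by have := brl a x 0 y; rewrite br0l !addr0. Qed.

Lemma brZr a x y : br x (a *: y) = a *: br x y.
Proof. by have := brr a y 0 x; rewrite br0r !addr0. Qed.

Lemma brDl x y z : br (x + y) z = br x z + br y z.
Proof. by have := brl 1 x y z; rewrite !scale1r. Qed.

Lemma brDr x y z : br z (x + y) = br z x + br z y.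
Proof. by have := brr 1 x y z; rewrite !scale1r. Qed.

Lemma brC x y : br x y = - br y x.
Proof.
apply/eqP; rewrite -addr_eq0; have := lie_alternating (strat_lie hG) (x + y).
by rewrite brDl !brDr !(lie_alternating (strat_lie hG)) add0r addr0 => ->.
Qed.

Lemma br_suml (I : finType) (a : I -> R) (x : I -> 'rV[R]_n) y :
  br (\sum_i a i *: x i) y = \sum_i a i *: br (x i) y.
Proof.
by elim/big_rec2: _ => [|i z z' _ <-]; rewrite ?br0l// brDl brZl.
Qed.

Lemma br_sumr (I : finType) (a : I -> R) (x : I -> 'rV[R]_n) y :
  br y (\sum_i a i *: x i) = \sum_i a i *: br y (x i).
Proof.
by elim/big_rec2: _ => [|i z z' _ <-]; rewrite ?br0r// brDr brZr.
Qed.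

Definition ad_mx (v : 'rV[R]_n) : 'M[R]_n := \matrix_i br v (delta_mx 0 i).

Lemma ad_mxE v h : br v h = h *m ad_mx v.
Proof.
rewrite {1}[h]row_sum_delta br_sumr mulmx_sum_row.
by apply: eq_bigr => i _; rewrite rowK.
Qed.

Lemma br_bracket_space (A C : {vspace 'rV[R]_n}) a c :
  a \in A -> c \in C -> br a c \in bracket_space br A C.
Proof.
move=> aA cC; rewrite (coord_vbasis aA) (coord_vbasis cC) br_suml memv_suml// => i _.
rewrite memvZ// br_sumr memv_suml// => j _; rewrite memvZ//.
apply: memv_span; apply/allpairsP; exists ((vbasis A)`_i, (vbasis C)`_j) => /=.
by rewrite !mem_nth// size_tuple.
Qed.

Lemma br_V1V1 v w : v \in V1 -> w \in V1 -> br v w \in V2.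
Proof. by rewrite (strat_generated hG); exact: br_bracket_space. Qed.

Lemma br_V2V1 z w : z \in V2 -> w \in V1 -> br z w = 0.
Proof.
by move=> zV wV; apply/eqP; rewrite -memv0 -(strat_step2 hG); exact: br_bracket_space.
Qed.

Lemma br_V1V2 z w : z \in V2 -> w \in V1 -> br w z = 0.
Proof. by move=> zV wV; rewrite brC (br_V2V1 zV wV) oppr0. Qed.

Lemma br_V1 x w : w \in V1 -> br x w \in V2.
Proof.
move=> wV; have : x \in fullv by exact: memvf.
rewrite -(strat_sum hG) => /memv_addP[v1 v1V [v2 v2V ->]].
by rewrite brDl (br_V2V1 v2V wV) addr0 br_V1V1.
Qed.

Lemma mulmxr_continuous (L : 'M[R]_n) : continuous (mulmxr L : 'rV[R]_n -> 'rV[R]_n).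
Proof.
apply/linear_bounded_continuous/linear_boundedP.
pose k := \sum_i \sum_j `|L j i|.
near=> s => h; apply: (@le_trans _ _ (k * `|h|)); last first.
  by rewrite ler_wpM2r//; near: s; apply: nbhs_pinfty_ge; rewrite num_real.
apply: le_trans (rV_norm_le_sum _) _; rewrite mulr_suml; apply: ler_sum => i _.
rewrite mxE (le_trans (ler_norm_sum _ _ _))// mulr_suml; apply: ler_sum => j _.
by rewrite normrM mulrC ler_wpM2l// rV_norm_coord.
Unshelve. all: by end_near. Qed.

Lemma diff_carnot_mul g v : 'd (carnot_mul br g) 0 v = v + 2^-1 *: br g v.
Proof.
pose L := 1%:M + 2^-1 *: ad_mx g.
have -> : carnot_mul br g = cst g + (mulmxr L : 'rV[R]_n -> 'rV[R]_n).
  by apply/funext => h; rewrite /carnot_mul -[RHS]/(g + h *m L) mulmxDr mulmx1 -scalemxAr -ad_mxE addrA.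
have Lc : continuous (mulmxr L : 'rV[R]_n -> 'rV[R]_n) by exact: mulmxr_continuous.
have e1 : 'd (cst g : 'rV[R]_n -> 'rV[R]_n) 0 v = 0 by rewrite diff_cst.
have e2 : 'd (mulmxr L : 'rV[R]_n -> 'rV[R]_n) 0 v = v *m L by rewrite (diff_lin 0 Lc).
have := @diffD _ _ _ (cst g) (mulmxr L : 'rV[R]_n -> 'rV[R]_n) 0 (differentiable_cst g 0)
  (linear_differentiable 0 Lc).
move=> /(congr1 (fun f => f v)) H; apply: (eq_trans H).
apply: (@eq_trans _ _ (0 + v *m L)); first exact: (f_equal2 _ e1 e2).
by rewrite add0r mulmxDr mulmx1 -scalemxAr -ad_mxE.
Qed.

End Stratification.

Section AlmostEverywhere.
Variable R : realType.
Implicit Types P Q S : R -> Prop.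

Lemma ae_imply P Q : {ae @lebesgue_measure R, forall t, P t} ->
  (forall t, P t -> Q t) -> {ae @lebesgue_measure R, forall t, Q t}.
Proof.
by move=> aeP PQ; apply: negligibleS aeP => t nQ Pt; exact: nQ (PQ t Pt).
Qed.

Lemma ae_imply2 P Q S : {ae @lebesgue_measure R, forall t, P t} ->
  {ae @lebesgue_measure R, forall t, Q t} ->
  (forall t, P t -> Q t -> S t) -> {ae @lebesgue_measure R, forall t, S t}.
Proof.
move=> aeP aeQ PQS; apply: negligibleS (negligibleU aeP aeQ) => t nS.
have [Pt|nPt] := pselect (P t); [right|left] => // Qt; exact: nS (PQS t Pt Qt).
Qed.

Lemma ae_neq (b : R) : {ae @lebesgue_measure R, forall t : R, t != b}.
Proof.
exists [set b]; split => //; first exact: lebesgue_measure_set1.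
by move=> t /= /negP; rewrite negbK => /eqP.
Qed.

End AlmostEverywhere.

Section VectorCurves.
Variables (R : realType) (n : nat).
Implicit Types f g : R -> 'rV[R]_n.

Lemma abs_continuousD f g : abs_continuous01 f -> abs_continuous01 g ->
  abs_continuous01 (fun t => f t + g t).
Proof.
move=> /abs_continuous_coord fac /abs_continuous_coord gac; apply/abs_continuous_coord => i.
by under eq_fun do rewrite mxE; exact: (ac01D (fac i) (gac i)).
Qed.

Lemma abs_continuousS (c : R -> R) f : ac01 c -> abs_continuous01 f ->
  abs_continuous01 (fun t => c t *: f t).
Proof.
move=> cac /abs_continuous_coord fac; apply/abs_continuous_coord => i.
by under eq_fun do rewrite mxE; exact: (ac01M cac (fac i)).
Qed.

Lemma abs_continuous_cst (v : 'rV[R]_n) : abs_continuous01 (fun=> v).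
Proof. by apply/abs_continuous_coord => i; exact: ac01_cst. Qed.

Lemma is_derive_scale (c : R -> R) f (t dc : R) df :
  is_derive t 1 c dc -> is_derive t 1 f df ->
  is_derive t 1 (fun s => c s *: f s) (c t *: df + dc *: f t).
Proof.
move=> cd /is_derive_coord fd; apply/is_derive_coord => i.
have -> : (fun s => (c s *: f s) 0 i) = c * (fun s => f s 0 i).
  by apply/funext => s; rewrite mxE.
have -> : (c t *: df + dc *: f t) 0 i = c t *: df 0 i + f t 0 i *: dc.
  by rewrite !mxE; congr (_ + _); exact: mulrC.
exact: is_deriveM.
Qed.

Lemma is_derive_addv f g (t : R) df dg :
  is_derive t 1 f df -> is_derive t 1 g dg -> is_derive t 1 (fun s => f s + g s) (df + dg).
Proof. by move=> fd gd; exact: is_deriveD. Qed.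

Lemma is_derive_cstv (v : 'rV[R]_n) (t : R) : is_derive t 1 (fun=> v) 0.
Proof. exact: is_derive_cst. Qed.

Lemma abs_continuous_derive0_const f : abs_continuous01 f ->
  {ae @lebesgue_measure R, forall t : R, 0 <= t <= 1 -> is_derive t 1 f 0} ->
  forall t, 0 <= t <= 1 -> f t = f 0.
Proof.
move=> /abs_continuous_coord fac fd t t01; apply/rowP => i.
apply: (ac01_derive0_const (fac i)) => //; apply: (ae_imply fd) => s H s01.
by have /is_derive_coord/(_ i) := H s01; rewrite mxE.
Qed.

Lemma abs_continuous_antiderivative f : abs_continuous01 f ->
  exists X : R -> 'rV[R]_n, [/\ X 0 = 0,
    forall t : R, 0 <= t <= 1 -> is_derive t 1 X (f t) &
    exists M : R, forall i x y, 0 <= x <= 1 -> 0 <= y <= 1 -> `|X y 0 i - X x 0 i| <= M * `|y - x|].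
Proof.
move=> /abs_continuous_coord fac.
have [F FP] := choice (fun i => continuous_antiderivative (ac01_clamp_continuous (fac i))).
have [m mP] := choice (fun i => ac01_bounded (fac i)).
have Fd i (t : R) : 0 <= t <= 1 -> is_derive t 1 (F i) (f t 0 i).
  move=> t01; have := FP i t; rewrite clamp_id//; apply.
  by case/andP: t01 => t0 _; apply: lt_le_trans t0; rewrite ltrN10.
exists (fun t => \row_i (F i t - F i 0)); split.
- by apply/rowP => i; rewrite !mxE subrr.
- move=> t t01; apply/is_derive_coord => i.
  have -> : (fun s => (\row_i0 (F i0 s - F i0 0)) 0 i) = F i - cst (F i 0).
    by apply/funext => s; rewrite mxE.
  rewrite -[f t 0 i]subr0; apply: is_deriveB; exact: Fd.
- exists (\sum_i `|m i|) => i x y.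
  rewrite !mxE opprB addrA subrK => x01 y01.
  wlog xy : x y x01 y01 / x <= y.
    move=> H; have [xy|/ltW yx] := leP x y; first exact: H.
    by rewrite distrC [`|y - x|]distrC; exact: H.
  have in01 z : z \in `[x, y] -> 0 <= z <= 1.
    rewrite in_itv /= => /andP[xz zy]; case/andP: x01 => x0 _; case/andP: y01 => _ y1.
    by rewrite (le_trans x0 xz) (le_trans zy y1).
  have [||c cxy ->] := @MVT_segment R (F i) (fun t => f t 0 i) x y xy.
  - by move=> z zxy; apply: Fd; apply: in01; exact: subset_itv_oo_cc zxy.
  - apply: derivable_within_continuous => z /in01 z01.
    by have [] := Fd i z z01.
  rewrite normrM ler_wpM2r// (le_trans (mP i c (in01 _ cxy)))// (le_trans (ler_norm _))//.
  by rewrite (bigD1 i) //= lerDl sumr_ge0.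
Qed.

End VectorCurves.

(** * Uniqueness and variation of horizontal curves *)

Section Curves.
Variables (R : realType) (n : nat) (br : 'rV[R]_n -> 'rV[R]_n -> 'rV[R]_n).
Variables (V1 V2 : {vspace 'rV[R]_n}).
Hypothesis hG : step2_stratification br V1 V2.

Lemma curve_derive u gamma : curve_of_control br u gamma ->
  {ae @lebesgue_measure R, forall t : R, 0 <= t <= 1 ->
    is_derive t 1 gamma (u t + 2^-1 *: br (gamma t) (u t))}.
Proof.
move=> [_ _ /ae_imply]; apply => t H t01.
by have := H t01; rewrite (diff_carnot_mul hG).
Qed.

Lemma curve_form u gamma m (nu : 'M[R]_(n, m)) : curve_of_control br u gamma ->
  {ae @lebesgue_measure R, forall t : R, 0 <= t <= 1 ->
    (u t + 2^-1 *: br (gamma t) (u t)) *m nu = 0} ->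
  forall t, 0 <= t <= 1 -> gamma t *m nu = 0.
Proof.
move=> cu H t t01; have [gac g0 _] := cu.
rewrite (abs_continuous_derive0_const (f := fun t => gamma t *m nu)) ?g0 ?mul0mx//.
  exact: ac01_mulmx.
apply: (ae_imply2 (curve_derive cu) H) => s D E s01.
by rewrite -(E s01); apply: is_derive_mulmx; exact: D.
Qed.

(** The difference d satisfies d' = 1/2 [d, u], which lies in V2. So the V1 part of d is constant,
    hence zero; then d is central, and d' = 0. *)
Lemma curve_unique u gamma gamma' : (forall t : R, 0 <= t <= 1 -> u t \in V1) ->
  curve_of_control br u gamma -> curve_of_control br u gamma' ->
  forall t, 0 <= t <= 1 -> gamma t = gamma' t.
Proof.
move=> uV cu cu'; have [gac g0 _] := cu; have [gac' g0' _] := cu'.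
pose d t := gamma t + (-1) *: gamma' t.
have dac : abs_continuous01 d.
  by apply: abs_continuousD => //; apply: abs_continuousS => //; exact: ac01_cst.
have d0 : d 0 = 0 by rewrite /d g0 g0' scaler0 addr0.
have dd : {ae @lebesgue_measure R, forall t : R, 0 <= t <= 1 ->
    is_derive t 1 d (2^-1 *: br (d t) (u t))}.
  apply: (ae_imply2 (curve_derive cu) (curve_derive cu')) => t D D' t01.
  have cm1 : is_derive t 1 (fun _ : R => -1 : R) 0 by exact: is_derive_cst.
  have := is_derive_addv (D t01) (is_derive_scale cm1 (D' t01)).
  move=> H; apply: (is_derive_eq H); rewrite scale0r addr0 /d (brDl hG) (brZl hG) !scaleN1r.
  by rewrite scalerBr opprD addrACA subrr add0r.
have [Q1 [Q2 [QE Q1V Q2V _ _]]] := splitting_coordinates (strat_sum hG) (strat_direct hG).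
have dQ t : 0 <= t <= 1 -> d t *m Q1 = 0.
  move=> t01; rewrite (abs_continuous_derive0_const (f := fun t => d t *m Q1)) ?d0 ?mul0mx//.
    exact: ac01_mulmx.
  apply: (ae_imply dd) => s D s01.
  apply: (is_derive_eq (is_derive_mulmx Q1 (D s01))).
  by rewrite -scalemxAl Q2V ?scaler0//; apply: (br_V1 hG); exact: uV.
have dV t : 0 <= t <= 1 -> d t \in V2.
  by move=> t01; rewrite [d t]QE dQ// mul0mx add0r vs_mx_mem.
move=> t t01; apply/eqP; rewrite -subr_eq0 -scaleN1r -/(d t).
rewrite (abs_continuous_derive0_const dac) ?d0//.
apply: (ae_imply dd) => s D s01; apply: (is_derive_eq (D s01)).
by rewrite (br_V2V1 hG (dV _ s01) (uV _ s01)) scaler0.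
Qed.

Lemma endpointE u gamma : (forall t : R, 0 <= t <= 1 -> u t \in V1) ->
  curve_of_control br u gamma -> endpoint br u = gamma 1.
Proof.
move=> uV cu; rewrite /endpoint.
have := @getPex _ [set g | exists2 ga, curve_of_control br u ga & ga 1 = g].
case=> [|ga cga <-]; first by exists (gamma 1), gamma.
by rewrite (curve_unique uV cga cu)// lexx ler01.
Qed.

(** With H the primitive of the step and X that of gamma, the variation is H + 1/2 [H, gamma] plus
    the integral of [gamma, h]. Integration by parts has replaced the integral of [H, u], so that u
    does not appear. *)
Definition step_direction b v gamma (X : R -> 'rV[R]_n) t : 'rV[R]_n :=
  Num.min t b *: v + (2^-1 * Num.min t b) *: (gamma t *m ad_mx br v)
  + X (Num.min t b) *m (- ad_mx br v).

(* The curve of u + e h for the step h = 1_[0,b] v is affine in e, so that the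
   differential of the endpoint map at u in the direction h can be read off. *)
Lemma curve_step u gamma X b v e : (forall t : R, 0 <= t <= 1 -> u t \in V1) ->
  curve_of_control br u gamma -> v \in V1 -> 0 <= b <= 1 ->
  X 0 = 0 -> (forall t : R, 0 <= t <= 1 -> is_derive t 1 X (gamma t)) ->
  (exists M : R, forall i x y, 0 <= x <= 1 -> 0 <= y <= 1 -> `|X y 0 i - X x 0 i| <= M * `|y - x|) ->
  curve_of_control br (fun t => u t + e *: (step b t *: v))
    (fun t => gamma t + e *: step_direction b v gamma X t).
Proof.
move=> uV cu vV /andP[b0 b1] X0 Xd [M XM]; have [gac g0 _] := cu.
have min01 (t : R) : 0 <= t <= 1 -> 0 <= Num.min t b <= 1.
  by move=> /andP[t0 t1]; rewrite le_min t0 b0 ge_min t1.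
have min_dist (x y : R) : `|Num.min y b - Num.min x b| <= `|y - x|.
  have minP (t : R) : t <= b /\ Num.min t b = t \/ b <= t /\ Num.min t b = b.
    by case: leP => tb; [left|right]; split => //; exact: ltW.
  have := ler_norm (y - x); have := ler_norm (- (y - x)); rewrite normrN ler_norml.
  by case: (minP x) => -[+ ->]; case: (minP y) => -[+ ->]; move=> *; apply/andP; split; lra.
have minac : ac01 (fun t => Num.min t b).
  by apply: (@ac01_lipschitz _ _ 1) => x y _ _; rewrite mul1r.
have Xac : abs_continuous01 (fun t => X (Num.min t b)).
  apply/abs_continuous_coord => i; apply: (@ac01_lipschitz _ _ `|M|) => x y x01 y01.
  apply: (le_trans (XM i _ _ (min01 x x01) (min01 y y01))).
  apply: (@le_trans _ _ (`|M| * `|Num.min y b - Num.min x b|)).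
    by rewrite ler_wpM2r// ler_norm.
  by rewrite ler_wpM2l.
split.
- apply: abs_continuousD => //; apply: abs_continuousS; first exact: ac01_cst.
  apply: abs_continuousD; last exact: ac01_mulmx.
  apply: abs_continuousD; first by apply: abs_continuousS => //; exact: abs_continuous_cst.
  by apply: abs_continuousS; [exact: ac01Z|exact: ac01_mulmx].
- by rewrite /step_direction (min_l b0) X0 g0 mulr0 !scale0r mul0mx !addr0 scaler0 ?addr0.
have V2_zero (z w : 'rV[R]_n) : z \in V2 -> w \in V1 -> br z w = 0 by exact: (br_V2V1 hG).
(* t = b is excluded because of the corner of [Num.min t b] there. *)
apply: (ae_imply2 (curve_derive cu) (ae_neq b)) => t D tb t01.
rewrite (diff_carnot_mul hG); have {}D := D t01; have {}uV := uV t t01.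
have hV : u t + e *: (step b t *: v) \in V1 by rewrite memvD ?memvZ.
(* Central terms drop, and so does [v, v]; the latter would be the only term quadratic in e. *)
have SE : br (step_direction b v gamma X t) (u t + e *: (step b t *: v)) =
    Num.min t b *: br v (u t).
  rewrite /step_direction (brDl hG) (brDl hG) (brZl hG) (brZl hG).
  rewrite mulmxN -!(ad_mxE hG) (brC hG v (X _)) opprK.
  rewrite [br (br _ _) _](V2_zero _ _ _ hV); last by rewrite (brC hG) memvN (br_V1 hG).
  rewrite [br (br _ _) _](V2_zero _ _ _ hV); last exact: (br_V1 hG).
  by rewrite scaler0 !addr0 (brDr hG) !(brZr hG) (lie_alternating (strat_lie hG)) !scaler0 addr0.
rewrite (brDl hG) (brZl hG) SE.
have gv (w : 'rV[R]_n) : w *m - ad_mx br v = br w v by rewrite mulmxN -(ad_mxE hG) -(brC hG).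
have bd : br v (u t + 2^-1 *: br (gamma t) (u t)) = br v (u t).
  by rewrite (brDr hG) (brZr hG) (br_V1V2 hG (br_V1 hG (gamma t) uV) vV) scaler0 addr0.
have idd : is_derive t 1 (fun s : R => s) 1 by exact: is_derive_id.
have cstd (k : R) : is_derive t 1 (fun _ : R => k) 0 by exact: is_derive_cst.
have gA : is_derive t 1 (fun s => gamma s *m ad_mx br v) (br v (u t)).
  by apply: (is_derive_eq (is_derive_mulmx (ad_mx br v) D)); rewrite -(ad_mxE hG) bd.
move: tb; rewrite neq_lt => /orP[tb|bt].
  have st : step b t = 1 by rewrite /step (ltW tb); case/andP: t01 => ->.
  apply: (near_eq_is_derive (f := fun s => gamma s + e *: (s *: v + (2^-1 * s) *: (gamma s *m ad_mx br v) + X s *m - ad_mx br v))).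
    near=> s; rewrite /step_direction min_l//.
    by near: s; exact: lt_le_nbhsl.
  have h2 : is_derive t 1 (fun s : R => 2^-1 * s) 2^-1.
    by apply: (is_derive_eq (is_deriveZ (2^-1) idd)); rewrite /GRing.scale /= mulr1.
  have := is_derive_addv D (is_derive_scale (cstd e) (is_derive_addv (is_derive_addv
    (is_derive_scale idd (is_derive_cstv v t)) (is_derive_scale h2 gA))
    (is_derive_mulmx (- ad_mx br v) (Xd t t01)))).
  move=> H; apply: (is_derive_eq H); rewrite gv -(ad_mxE hG) st min_l ?(ltW tb)//.
  rewrite !scale1r scale0r scaler0 add0r addr0 (brDr hG) (brZr hG).
  rewrite (brC hG v (gamma t)) scalerN.
  rewrite gv; move: (u t) (br _ _) (br v _) (br _ v) => p q w z.
  by apply/rowP => i; rewrite !mxE; field.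
have st : step b t = 0 by rewrite /step [t <= b]leNgt bt andbF.
apply: (near_eq_is_derive (f := fun s => gamma s + e *: (b *: v + (2^-1 * b) *: (gamma s *m ad_mx br v) + X b *m - ad_mx br v))).
  near=> s; rewrite /step_direction min_r//.
  by near: s; exact: lt_le_nbhsr.
have := is_derive_addv D (is_derive_scale (cstd e) (is_derive_addv (is_derive_addv
  (is_derive_cstv (b *: v) t) (is_derive_scale (cstd (2^-1 * b)) gA))
  (is_derive_cstv (X b *m - ad_mx br v) t))).
move=> H; apply: (is_derive_eq H); rewrite st min_r ?(ltW bt)//.
rewrite !scale0r !scaler0 !addr0 add0r.
move: (u t) (br _ _) (br v _) => p q w.
by apply/rowP => i; rewrite !mxE; field.
Unshelve. all: by end_near. Qed.

End Curves.

(** * Covectors annihilating the image of the differential *)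

Section AbnormalCurves.
Variables (R : realType) (n : nat) (br : 'rV[R]_n -> 'rV[R]_n -> 'rV[R]_n).
Variables (V1 V2 : {vspace 'rV[R]_n}).
Hypothesis hG : step2_stratification br V1 V2.

Lemma is_derive_zero m (f : R -> 'rV[R]_m) (t : R) d : is_derive t 1 f d ->
  0 < t < 1 -> (forall s, 0 < s < 1 -> f s = 0) -> d = 0.
Proof.
move=> fd /andP[t0 t1] f0.
have fd0 : is_derive t 1 f 0.
  apply: (near_eq_is_derive (f := fun=> 0 : 'rV[R]_m)).
  near=> s; rewrite f0//; apply/andP; split.
    by near: s; exact: lt_nbhsr.
  by near: s; exact: lt_nbhsl.
by rewrite -(@derive_val _ _ _ _ _ _ _ fd) (@derive_val _ _ _ _ _ _ _ fd0).
Unshelve. all: by end_near. Qed.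

Lemma abs_continuous_closure m (f : R -> 'rV[R]_m) k : abs_continuous01 f ->
  (forall s, 0 < s < 1 -> f s = k) -> forall s, 0 <= s <= 1 -> f s = k.
Proof.
move=> /abs_continuous_coord fac fk s s01.
have [/fk//|nin] := boolP (0 < s < 1).
apply/rowP => i; apply/eqP; rewrite -subr_eq0 -normr_eq0 eq_le normr_ge0 andbT.
apply/ler_addgt0Pl => e e0; rewrite addr0.
have [d d0 dP] := ac01_close (fac i) e0.
pose r := Num.min d 1 / 2.
have r0 : 0 < r by rewrite divr_gt0// lt_min d0 ltr01.
have rd : r < d.
  by rewrite /r ltr_pdivrMr// (@le_lt_trans _ _ d) ?ge_min ?lexx// ltr_pMr// ltr1n.
have r1 : r < 1.
  by rewrite /r ltr_pdivrMr// mul1r (@le_lt_trans _ _ 1) ?ge_min ?lexx ?orbT// ltr1n.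
have /orP[/eqP s0|/eqP s1] : (s == 0) || (s == 1).
  move: nin s01; rewrite negb_and -!leNgt => /orP[h /andP[h' _]|h /andP[_ h']].
    by rewrite eq_le h h'.
  by rewrite orbC eq_le h h'.
- apply: ltW; rewrite -(fk r) ?r0//; apply: dP => //; first by rewrite (ltW r0) ltW.
  by rewrite s0 sub0r normrN gtr0_norm.
- have r' : 0 < 1 - r < 1 by rewrite subr_gt0 r1 ltrBlDr ltrDl.
  apply: ltW; rewrite -(fk (1 - r))//; apply: dP => //.
    by case/andP: r' => h1 h2; rewrite (ltW h1) ltW.
  by rewrite s1 opprB addrC subrK gtr0_norm.
Qed.

Lemma L2_norm_ge0 (h : R -> 'rV[R]_n) : 0 <= L2_norm h.
Proof. by rewrite /L2_norm fine_ge0// Lnorm_ge0. Qed.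

(** A covector nu killing the differential on all steps gives, after differentiation in b, (v + 1/2
    [v, gamma 1] + [gamma b, v]) nu = 0. At b = 0 the last term vanishes, so [gamma b, v] nu = 0 for
    all b; b = 1 then yields v nu = 0. *)
Lemma abnormal_form u gamma : L2_control V1 u -> abnormal br V1 u ->
  curve_of_control br u gamma ->
  exists nu : 'cV[R]_n, [/\ nu != 0, forall v, v \in V1 -> v *m nu = 0 &
    forall t v, 0 <= t <= 1 -> v \in V1 -> br (gamma t) v *m nu = 0].
Proof.
move=> [uV _] [D [Dlin _ Dfr] Dprop] cu; have [gac g0 _] := cu.
have [X [X0 Xd XL]] := abs_continuous_antiderivative gac.
have D0 : D (fun=> 0) = 0.
  have := Dlin 1 _ _ (L2_control0 V1) (L2_control0 V1).
  have -> : (fun _ : R => 1 *: (0 : 'rV[R]_n) + 0) = (fun=> 0).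
    by apply/funext => t; rewrite scaler0 addr0.
  by rewrite scale1r => /eqP; rewrite -subr_eq0 opprD addrA subrr sub0r oppr_eq0 => /eqP.
have DZ a h : L2_control V1 h -> D (fun t => a *: h t) = a *: D h.
  move=> hL; have := Dlin a _ _ hL (L2_control0 V1); rewrite D0 addr0 => <-.
  by congr D; apply/funext => t; rewrite addr0.
have DW b v : 0 <= b <= 1 -> v \in V1 ->
    D (fun t => step b t *: v) = step_direction br b v gamma X 1.
  move=> b01 vV; pose h t := step b t *: v; pose W := step_direction br b v gamma X 1.
  have hL : L2_control V1 h by exact: L2_control_step.
  pose N := L2_norm h; have N0 : 0 <= N by exact: L2_norm_ge0.
  have N1 : 0 < N + 1 by rewrite ltr_wpDl.
  have key eps : 0 < eps -> `|W - D h| <= eps * N.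
    move=> eps0; have [d d0 dP] := Dfr eps eps0.
    (* N + 1 keeps the quotient meaningful for a step of norm zero. *)
    pose e := d / (N + 1); have e0 : 0 < e by rewrite divr_gt0.
    have := dP (fun t => e *: h t); rewrite L2_norm_step -/N gtr0_norm// DZ//.
    have cs := @curve_step _ _ _ _ _ hG u gamma X b v e uV cu vV b01 X0 Xd XL.
    rewrite (endpointE hG uV cu) (endpointE hG _ cs); last first.
      by move=> t t01; rewrite memvD ?memvZ ?uV.
    rewrite [gamma 1 + _]addrC addrK -scalerBr normrZ gtr0_norm// mulrCA ler_pM2l//; apply.
    + have -> : (fun t => e *: h t) = (fun t => e *: h t + 0).
        by apply/funext => s; rewrite addr0.
      by apply: L2_control_lin => //; exact: L2_control0.
    + by rewrite mulrAC ltr_pdivrMr// ltr_pM2l// ltrDl.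
  apply/esym/eqP; rewrite -subr_eq0 -normr_eq0 eq_le normr_ge0 andbT.
  apply/ler_addgt0Pl => eps eps0; rewrite addr0.
  apply: (le_trans (key (eps / (N + 1)) _)); first by rewrite divr_gt0.
  by rewrite mulrAC ler_pdivrMr// ler_pM2l// lerDl.
have [nu nu0 nuD] : exists2 nu : 'cV[R]_n, nu != 0 &
    forall w, [set D h | h in [set v | L2_control V1 v]] w -> w *m nu = 0.
  apply: proper_subspace_form.
  - by exists (fun=> 0) => //; exact: L2_control0.
  - move=> a _ _ [h hL <-] [k kL <-]; exists (fun t => a *: h t + k t).
      exact: L2_control_lin.
    by rewrite Dlin.
  - by move=> full; case: Dprop => _; apply => w _; exact: full.
have eqn v b : v \in V1 -> 0 < b < 1 ->
    (v + 2^-1 *: (gamma 1 *m ad_mx br v) + gamma b *m (- ad_mx br v)) *m nu = 0.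
  move=> vV b01; have b01' : 0 <= b <= 1 by case/andP: b01 => h1 h2; rewrite !ltW.
  pose F s := s *: v + (2^-1 * s) *: (gamma 1 *m ad_mx br v) + X s *m (- ad_mx br v).
  have idd : is_derive b 1 (fun s : R => s) 1 by exact: is_derive_id.
  have h2 : is_derive b 1 (fun s : R => 2^-1 * s) 2^-1.
    by apply: (is_derive_eq (is_deriveZ (2^-1) idd)); rewrite /GRing.scale /= mulr1.
  have Fd := is_derive_addv (is_derive_addv
    (is_derive_scale idd (is_derive_cstv v b)) (is_derive_scale h2 (is_derive_cstv (gamma 1 *m ad_mx br v) b)))
    (is_derive_mulmx (- ad_mx br v) (Xd b b01')).
  have := is_derive_zero (is_derive_mulmx nu Fd) b01.
  rewrite !scaler0 !add0r scale1r; apply => s s01.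
  have s01' : 0 <= s <= 1 by case/andP: s01 => h1 h3; rewrite !ltW.
  have := nuD _ (ex_intro2 _ _ _ (L2_control_step s vV) erefl).
  by rewrite DW// /step_direction min_r//; case/andP: s01'.
(* The identity, obtained in the open interval, extends to 0 and 1 by continuity of gamma. *)
have brnu v : v \in V1 -> forall t, 0 <= t <= 1 ->
    gamma t *m (- ad_mx br v) *m nu = - ((v + 2^-1 *: (gamma 1 *m ad_mx br v)) *m nu).
  move=> vV; apply: abs_continuous_closure => [|t t01].
    by apply: ac01_mulmx; exact: ac01_mulmx.
  by apply/eqP; rewrite -addr_eq0 -mulmxDl [gamma t *m _ + _]addrC eqn.
have gv v (w : 'rV[R]_n) : w *m - ad_mx br v = br w v by rewrite mulmxN -(ad_mxE hG) -(brC hG).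
have k0 v : v \in V1 -> (v + 2^-1 *: (gamma 1 *m ad_mx br v)) *m nu = 0.
  move=> vV; apply/eqP; rewrite -oppr_eq0 -(brnu v vV 0) ?lexx ?ler01//.
  by rewrite g0 !mul0mx.
have main t v : 0 <= t <= 1 -> v \in V1 -> br (gamma t) v *m nu = 0.
  by move=> t01 vV; rewrite -gv brnu// k0// oppr0.
exists nu; split => // v vV; have := k0 v vV.
rewrite -(ad_mxE hG) (brC hG) mulmxDl -scalemxAl mulNmx main ?ler01 ?lexx//.
by rewrite oppr0 scaler0 addr0.
Qed.

Let r := \dim V1.
Let c := \dim V2.
Let E1 := vs_mx V1.
Let E2 := vs_mx V2.

Lemma abnormal_set_dim : ((r + c = r + 1 \/ r + c = r + 2)%N \/
   (r + c = (r ^ 2 + r) %/ 2 - 1 \/ r + c = (r ^ 2 + r) %/ 2 - 2)%N \/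
   (r = 4%N /\ r + c = 7)%N) ->
  exists2 m, dimle (abnormal_set br V1 : set (mx_space R 1 n)) m & (m + 3 <= r + c)%N.
Proof.
move=> rc.
have [Q1 [Q2 [QE Q2V Q1V EQ1 EQ2]]] := splitting_coordinates (strat_sum hG) (strat_direct hG).
pose B (k : 'I_c) : 'M[R]_r := \matrix_(i, j) (br (row i E1) (row j E1) *m Q2) 0 k.
have E1V (a : 'rV[R]_r) : a *m E1 \in V1 by exact: vs_mx_mem.
have rowE1 i : row i E1 \in V1 by rewrite rowE E1V.
have BE (a b : 'rV[R]_r) : mxbr B a b = br (a *m E1) (b *m E1) *m Q2.
  rewrite (mulmx_sum_row a) (mulmx_sum_row b) (br_suml hG) mulmx_suml.
  apply/rowP => k; rewrite mxE summxE mxE.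
  under eq_bigr do rewrite mxE mulr_suml.
  rewrite exchange_big; apply: eq_bigr => i _.
  rewrite (br_sumr hG) -scalemxAl mxE mulmx_suml summxE mulr_sumr.
  apply: eq_bigr => j _; rewrite -scalemxAl [b^T _ _]mxE -mulrA [B _ _ _ * _]mulrC.
  by congr (_ * _); rewrite [RHS]mxE; congr (_ * _); rewrite mxE.
have skewB k : skew (B k).
  move=> i j; split; rewrite mxE; last by rewrite (lie_alternating (strat_lie hG)) mul0mx mxE.
  by rewrite (brC hG (row j E1)) mulNmx mxE [in RHS]mxE.
have V2E (z : 'rV[R]_n) : z \in V2 -> z = z *m Q2 *m E2.
  by move=> zV; rewrite {1}[z]QE Q1V// mul0mx add0r.
(* This is the condition V2 = [V1, V1]: a form vanishing on all brackets vanishes on V2. *)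
have omega_inj la : omega B la = 0 -> la = 0.
  move=> la0; have brla v w : v \in V1 -> w \in V1 -> br v w *m (Q2 *m la^T) = 0.
    move=> /vs_mxP[a ->] /vs_mxP[b ->]; rewrite mulmxA -BE mxbr_omega la0.
    by rewrite mulmx0 mul0mx.
  have zla z : z \in V2 -> z *m (Q2 *m la^T) = 0.
    move: (Q2 *m la^T) brla => N brla.
    rewrite (strat_generated hG) /bracket_space => zs.
    rewrite (coord_span (X := in_tuple _) zs) /=.
    rewrite mulmx_suml big1// => i _; rewrite -scalemxAl.
    have : (in_tuple [seq br a b | a <- vbasis V1, b <- vbasis V1])`_i \in
        [seq br a b | a <- vbasis V1, b <- vbasis V1] by rewrite mem_nth.
    by move=> /allpairsP[[a b] /= [aV bV ->]]; rewrite brla ?scaler0//; exact: vbasis_mem.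
  apply: trmx_inj; rewrite trmx0; apply/row_matrixP => k.
  have := zla (row k E2); rewrite {1}rowE vs_mx_mem => /(_ isT).
  by rewrite mulmxA -row_mul EQ2 -row_mul mul1mx row0.
have c0 : (0 < c)%N by rewrite lt0n dimv_eq0; exact: strat_nonabelian hG.
have [m md mrc] := dimle_abnormal skewB omega_inj c0 rc; exists m => //.
pose S' : set (mx_space R 1 n) := [set g | exists2 p, abn B [set la | la != 0] p & g = p.1 *m E1 + p.2 *m E2].
(* [point] is the default value of [get], taken by [endpoint] at a control without a curve. *)
apply: (@dimle_sub _ _ _ (S' `|` [set (point : 'rV[R]_n)])); last first.
  apply: dimleU; last exact: dimle_point.
  apply: (dimle_image (F := fun p : prod_space (mx_space R 1 r) (mx_space R 1 c) =>
    (p.1 *m E1 + p.2 *m E2 : mx_space R 1 n))) md _ => [[i j]|g [p abp ->]]; last by exists p.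
  suff H : ispolmx (fun p : prod_space (mx_space R 1 r) (mx_space R 1 c) => p.1 *m E1 + p.2 *m E2) by exact: H.
  apply: ispolmxD; apply: ispolmxM; try exact: ispolmx_cst.
    exact: (@ispolmx_fst _ (mx_space R 1 r) (mx_space R 1 c) _ _ _ (@ispolmx_id _ _ _)).
  exact: ispolmx_proj2.
move=> _ [u [uL uabn] <-]; have uV := uL.1.
have [[gamma cu]|nocurve] := pselect (exists gamma, curve_of_control br u gamma); last first.
  by right; rewrite /= /endpoint getPN// => g [ga cga _]; apply: nocurve; exists ga.
left; rewrite (endpointE hG uV cu).
have [nu [nu0 nuV1 nubr]] := abnormal_form uL uabn cu.
exists (gamma 1 *m Q1, gamma 1 *m Q2); last exact: QE.
(* The restriction of nu to V2, nonzero because nu vanishes on V1. *)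
pose la := (E2 *m nu)^T; exists la.
  apply: contra nu0 => /eqP/(congr1 trmx); rewrite trmxK trmx0 => E2nu.
  apply/eqP/row_matrixP => i; rewrite row0 rowE [delta_mx _ _]QE mulmxDl.
  by rewrite nuV1 ?E1V// add0r -!mulmxA E2nu !mulmx0.
have ker t : 0 <= t <= 1 -> gamma t *m Q1 *m omega B la = 0.
  move=> t01; apply/rowP => j; rewrite [RHS]mxE.
  have : gamma t *m Q1 *m omega B la *m (delta_mx 0 j : 'rV[R]_r)^T = 0.
    rewrite -mxbr_omega trmxK BE mulmxA -V2E ?(br_V1V1 hG)// -(nubr t (delta_mx 0 j *m E1) t01)//.
    rewrite {2}[gamma t]QE (brDl hG) (br_V2V1 hG (vs_mx_mem _) (E1V _)) addr0 //.
  by rewrite trmx_delta -colE => /matrixP/(_ 0 0); rewrite mxE => ->; rewrite mxE.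
split; first by apply: ker; rewrite lexx ler01.
(* The V2 part of gamma has derivative 1/2 [gamma, u]. The V1 part of gamma stays in the kernel of
   omega la, hence so does its derivative u almost everywhere, and mu kills this bracket. *)
move=> mu muK /=; rewrite -mulmxA; apply: (curve_form hG cu); last by rewrite lexx ler01.
have ne01 : {ae @lebesgue_measure R, forall t : R, t != 0 /\ t != 1}.
  by apply: (ae_imply2 (ae_neq 0) (ae_neq 1)).
apply: (ae_imply2 (curve_derive hG cu) ne01) => t D [t0 t1] t01.
have t01' : 0 < t < 1 by case/andP: t01 => h h'; rewrite !lt_neqAle t1 h' h eq_sym t0.
have uV' := uV t t01.
have uker : u t *m Q1 *m omega B la = 0.
  have := is_derive_zero (is_derive_mulmx (Q1 *m omega B la) (D t01)) t01'.
  rewrite mulmxDl -scalemxAl [br _ _ *m _]mulmxA Q1V ?(br_V1 hG)// mul0mx scaler0 addr0 mulmxA.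
  by apply => s /andP[s0 s1]; rewrite mulmxA ker// !ltW.
rewrite mulmxDl mulmxA Q2V// mul0mx add0r -scalemxAl mulmxA.
have -> : br (gamma t) (u t) *m Q2 = mxbr B (gamma t *m Q1) (u t *m Q1).
  have ut : u t = u t *m Q1 *m E1 by rewrite {1}[u t]QE Q2V// mul0mx addr0.
  rewrite BE -ut {1}[gamma t]QE (brDl hG).
  by rewrite (br_V2V1 hG (vs_mx_mem _) uV') addr0.
by rewrite muK ?scaler0//; exact: ker.
Qed.

End AbnormalCurves.

Theorem mainTheorem1 (R : realType) (n r : nat)
    (br : 'rV[R]_n -> 'rV[R]_n -> 'rV[R]_n) (V1 V2 : {vspace 'rV[R]_n})
    (hG : step2_stratification br V1 V2) (hr : r = \dim V1)
    (hn : (n = r + 1 \/ n = r + 2)%N \/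
          (n = (r ^ 2 + r) %/ 2 - 1 \/ n = (r ^ 2 + r) %/ 2 - 2)%N \/
          (r = 4%N /\ n = 7%N)) :
  exists Z : set 'rV[R]_n,
    [/\ algebraic_set Z, codim_ge 3 Z & abnormal_set br V1 `<=` Z].
Proof.
have nE : (\dim V1 + \dim V2 = n)%N.
  by rewrite -dimv_disjoint_sum ?(strat_direct hG)// (strat_sum hG) dimvf /dim /= mul1n.
have [|m md mn] := abnormal_set_dim hG; first by rewrite nE -hr.
by apply: (dimle_codim md); rewrite -nE.
Qed.
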